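(* Suppose that the cocycle $\mathcal L$ is good and that $\|\varphi\|_K:=\operatorname{ess\,sup}_{\omega\in\Omega}\big(K(\omega)\|\varphi_\omega\|_{BV}\big)<\infty$. Suppose there are positive constants $c_1,c_2,\eta$ such that $\alpha_n\le c_1e^{-c_2n^\eta}$ for every $n$, and set $\gamma=1/\eta$. Then there exists a constant $c_0$ such that for every integer $p\ge1$ and every $n\in\mathbb N$, $$\Big|\mathbb E\big[(S_n-\mathbb E[S_n])^p\big]-(\mathrm{Var}(S_n))^{\frac p2}\,\mathbb E[Z^p]\Big|\le(c_0)^p(p!)^{1+\gamma}\sum_{1\le u\le\frac{p-1}2}n^u\frac{p^u}{(u!)^2}=O\big(n^{[(p-1)/2]}\big),$$ where $Z$ is a standard normal random variable and $[\cdot]$ denotes the integer part (the $O$ is as $n\to\infty$ for fixed $p$). In particular, $\|S_n-\mathbb E[S_n]\|_{L^p}=O(\sqrt n)$ for every $p$. The constant $c_0$ depends only on $c_1,c_2,\eta,\|\varphi\|_K$ and $C_{\mathrm v}$.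
   Context: Variation. $(X,\mathcal B,m)$ is a probability space with a notion of variation $\mathrm v:L^1(X,m)\to[0,\infty]$ such that: (V1) $\mathrm v(th)=|t|\mathrm v(h)$; (V2) $\mathrm v(g+h)\le \mathrm v(g)+\mathrm v(h)$; (V3) $\|h\|_{L^\infty}\le C_{\mathrm v}(\|h\|_1+\mathrm v(h))$ for some constant $1\le C_{\mathrm v}<\infty$; (V4) for any $C>0$ the set $\{h:X\to\mathbb R:\|h\|_1+\mathrm v(h)\le C\}$ is $L^1(m)$-compact; (V5) $\mathrm v(\mathbf 1)=0$, where $\mathbf 1$ is the constant function $1$; (V6) $\{h:X\to\mathbb R_+:\|h\|_1=1,\ \mathrm v(h)<\infty\}$ is $L^1(m)$-dense in $\{h:X\to\mathbb R_+:\|h\|_1=1\}$; (V7) if $f\in L^1(X,m)$ and $\operatorname{ess\,inf}f>0$ then $\mathrm v(1/f)\le \mathrm v(f)/(\operatorname{ess\,inf}f)^2$; (V8) $\mathrm v(fg)\le\|f\|_{L^\infty}\mathrm v(g)+\|g\|_{L^\infty}\mathrm v(f)$; (V9) for $M>0$, $f:X\to[-M,M]$ measurable and $h:[-M,M]\to\mathbb C$ of class $C^1$, $\mathrm v(h\circ f)\le\|h'\|_{L^\infty}\mathrm v(f)$. $BV=\{g\in L^1(X,m):\mathrm v(g)<\infty\}$ is a Banach space with norm $\|g\|_{BV}=\|g\|_1+\mathrm v(g)$. Base map and random maps. $(\xi_n)_{n\in\mathbb Z}$ is a two-sided stationary sequence with values in a measurable space $\mathcal Y$; $\Omega=\mathcal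 Y^{\mathbb Z}$, $\mathbb P$ is the law of $(\xi_n)$ on $\Omega$, $\sigma((\omega_j)_j)=(\omega_{j+1})_j$ is the left shift, and $(\Omega,\mathcal F,\mathbb P,\sigma)$ is an invertible ergodic measure preserving system. $T_\omega:X\to X$, $\omega\in\Omega$, are non-singular maps ($m\circ T_\omega^{-1}\ll m$) with $T_\omega=T_{\omega_0}$ depending only on the $0$-th coordinate, such that the skew product $\tau(\omega,x)=(\sigma\omega,T_\omega x)$ is measurable. $T_\omega^n=T_{\sigma^{n-1}\omega}\circ\cdots\circ T_\omega$. The transfer operator $\mathcal L_\omega$ on $L^1(X,m)$ is given by $\int(\mathcal L_\omega f)g\,dm=\int f\,(g\circ T_\omega)\,dm$ for $f\in L^1,g\in L^\infty$, and $\mathcal L_\omega^n=\mathcal L_{\sigma^{n-1}\omega}\circ\cdots\circ\mathcal L_\omega$. Tempered: a measurable $Q:\Omega\to(0,\infty)$ is tempered if $\lim_{n\to\pm\infty}\frac1n\log Q(\sigma^n\omega)=0$ for $\mathbb P$-a.e. $\omega$. Good cocycle: $\mathcal L=(\mathcal L_\omega)_{\omega\in\Omega}$ is good if: (1) $\Omega$ is a Borel subset of a separable complete metric space, $\sigma$ is a homeomorphism, and $\Omega$ is a countable union of measurable sets on each of which $\omega\mapsto\mathcal L_\omega$ is continuous; (2) there is a tempered $N(\omega)$ with $\mathrm v(g\circ T_\omega)\le N(\omega)\mathrm v(g)$ for a.e. $\omega$ and all $g\in BV$; (3) there is a random variable $C:\Omega\to(0,\infty)$ with $\log C\in L^1(\mathbb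 P)$ and $\|\mathcal L_\omega h\|_{BV}\le C(\omega)\|h\|_{BV}$ for a.e. $\omega$ and all $h\in BV$; (4) there are $N\in\mathbb N$ and random variables $\alpha^N,K^N:\Omega\to(0,\infty)$ with $\int\log\alpha^N d\mathbb P<0$, $\log K^N\in L^1(\mathbb P)$ and $\mathrm v(\mathcal L^N_\omega h)\le\alpha^N(\omega)\mathrm v(h)+K^N(\omega)\|h\|_1$ for a.e. $\omega$ and all $h\in BV$; (5) for each $a>0$ and a.e. $\omega$ there are a random number $n_c(\omega)<\infty$ and positive random numbers $\alpha_0(\omega),\alpha_1(\omega),\dots$ such that $\operatorname{ess\,inf}_x(\mathcal L_\omega^nh)(x)\ge\alpha_n(\omega)\|h\|_1$ for $n\ge n_c(\omega)$ and every $h\in L^\infty(X,m)$ with $h\ge0$, $\mathrm v(h)\le a\|h\|_1$; (6) $\log(\operatorname{ess\,inf}_x(\mathcal L_\omega\mathbf 1)(x))\in L^1(\mathbb P)$. Known facts fixing notation. For a good cocycle there is an essentially unique measurable family $h_\omega\in BV$, $h_\omega\ge0$, $\int h_\omega dm=1$, $\mathcal L_\omega h_\omega=h_{\sigma\omega}$ a.s.; $\|1/h_\omega\|_{BV}$ is tempered. Put $d\mu_\omega=h_\omega dm$, $\mu=\int\mu_\omega\,d\mathbb P(\omega)$ (a $\tau$-invariant probability measure on $\Omega\times X$), and $L_\omega^ng=\mathcal L_\omega^n(gh_\omega)/h_{\sigma^n\omega}$. With $\Pi(\omega)g=g-(\int g\,dm)h_\omega$ and $\tilde\Pi(\omega)g=g-\mu_\omega(g)$,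 there are $\lambda>0$ and tempered random variables $D,\tilde D$ such that, a.s. and for all $n\in\mathbb N$, $\|\mathcal L_\omega^n\Pi(\omega)\|_{BV}\le D(\omega)e^{-\lambda n}$, $\|\mathcal L^n_\omega(\mathrm{Id}-\Pi(\omega))\|_{BV}\le D(\omega)e^{\epsilon' n}$ (for a fixed $\epsilon'>0$, with $D$ depending on $\epsilon'$), $\|L_\omega^n\tilde\Pi(\omega)\|_{BV}\le\tilde D(\omega)e^{-\lambda n}$, $\|L_\omega^n(\mathrm{Id}-\tilde\Pi(\omega))\|_{BV}\le\tilde D(\omega)$. Set $\tilde K(\omega)=\max(D(\omega),\tilde D(\omega),N(\omega),\|1/h_\omega\|_{BV})$, fix $0<\varepsilon<\lambda/3$, and let $K:\Omega\to(1,\infty)$ be a tempered random variable with $1/K(\omega)\le\tilde K(\omega)\le K(\omega)$ and $K(\omega)e^{-\varepsilon|n|}\le K(\sigma^n\omega)\le K(\omega)e^{\varepsilon|n|}$ for a.e. $\omega$ and all $n\in\mathbb Z$ (such $K$ exists). Observable. $\varphi:\Omega\times X\to\mathbb R$ is measurable, $\int\varphi\,d\mu=0$, and $\varphi_\omega=\varphi(\omega,\cdot)$ depends on $\omega$ only through $\omega_0$. $S_n=\sum_{j=0}^{n-1}\varphi\circ\tau^j$, viewed as random variables on $(\Omega\times X,\mu)$; expectation and variance of $S_n$ and $L^p$ norms are with respect to $\mu$. Mixing. For sub-$\sigma$-algebras $\mathcal A,\mathcal H$ of the probability space with measure $\mathbf P$ on which $(\xi_n)$ is defined, $\alpha(\mathcal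 A,\mathcal H)=\sup\{|\mathbf P(A\cap B)-\mathbf P(A)\mathbf P(B)|:A\in\mathcal A,B\in\mathcal H\}$, and $\alpha_n=\alpha(\sigma(\xi_j:j\le0),\sigma(\xi_j:j\ge n))$.
   Formalization: The constant c_0 is allowed to depend also on the decay rate λ of the transfer operators, besides c_1, c_2, η, ‖φ‖_K and C_v; independence from λ is false, e.g. for nearly decomposable Markov maps. *)

(* Defs.v *)
From HB Require Import structures.
From mathcomp Require Import all_boot all_order all_algebra.
From mathcomp Require Import complex.
From mathcomp Require Import all_classical all_reals all_analysis.
From mathcomp Require Import measurable_realfun ess_sup_inf.

Set Implicit Arguments.
Unset Strict Implicit.
Unset Printing Implicit Defensive.

Import Order.TTheory GRing.Theory Num.Theory.
Import numFieldNormedType.Exports.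

Local Open Scope classical_set_scope.
Local Open Scope ring_scope.
Local Open Scope complex_scope.

Notation normc := ComplexField.Normc.normc.

Section ComplexFunctions.
Context d (X : measurableType d) (R : realType).
Variable m : {measure set X -> \bar R}.
Implicit Types f g : X -> R[i].

Definition cfun (f : X -> R) : X -> R[i] := fun x => (f x)%:C.

Definition cmeasurable f : Prop :=
  measurable_fun setT (fun x => complex.Re (f x)) /\
  measurable_fun setT (fun x => complex.Im (f x)).

Definition cLnorm (p : \bar R) f : \bar R :=
  'N[m]_p[(fun x => (normc (f x))%:E)]%E.

Definition cLfun (p : \bar R) f : Prop :=
  cmeasurable f /\ (cLnorm p f < +oo)%E.

Definition cintegral f : R[i] :=
  (\int[m]_x complex.Re (f x)) +i* (\int[m]_x complex.Im (f x)).

End ComplexFunctions.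

Arguments cfun {d X R} f x.
Arguments cLnorm {d X R} m p%_E f.
Arguments cLfun {d X R} m p%_E f.
Arguments cintegral {d X R} m f.

Section L1.
Context d (X : measurableType d) (R : realType).
Variable m : {measure set X -> \bar R}.

(* Integrable complex functions, not quotiented by almost everywhere equality:
   the distance below is only a pseudometric, which affects neither
   compactness nor closures. *)
Record L1fun := MkL1fun { L1val :> X -> R[i] ; L1valP : cLfun m 1 L1val }.

HB.instance Definition _ := gen_eqMixin L1fun.
HB.instance Definition _ := gen_choiceMixin L1fun.

Definition L1dist (f g : L1fun) : \bar R := cLnorm m 1 (f \- g).

Definition L1ball (f : L1fun) (e : R) : set L1fun :=
  [set g | (L1dist f g < e%:E)%E].

Lemma measurable_normc (f : X -> R[i]) : cmeasurable f ->
  measurable_fun setT (fun x => normc (f x)).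
Proof.
move=> [mRe mIm].
rewrite (_ : (fun x => _) = (fun x =>
    Num.sqrt (complex.Re (f x) ^+ 2 + complex.Im (f x) ^+ 2))); last first.
  by apply/funext => x; case: (f x).
apply: (measurableT_comp (continuous_measurable_fun (@sqrt_continuous R))).
by apply: measurable_funD; apply: measurable_funX.
Qed.

Lemma L1distE (f g : L1fun) :
  L1dist f g = (\int[m]_x (normc (f x - g x))%:E)%E.
Proof.
rewrite /L1dist /cLnorm Lnorm1; apply: eq_integral => x _ /=.
by rewrite ger0_norm//; case: (f x - g x) => a b; exact: sqrtr_ge0.
Qed.

Lemma cmeasurableB (f g : X -> R[i]) :
  cmeasurable f -> cmeasurable g -> cmeasurable (f \- g).
Proof.
move=> [mf mf'] [mg mg']; split.
- rewrite (_ : (fun x => _) = (fun x => complex.Re (f x) - complex.Re (g x))).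
    exact: measurable_funB.
  by apply/funext => x /=; case: (f x); case: (g x).
- rewrite (_ : (fun x => _) = (fun x => complex.Im (f x) - complex.Im (g x))).
    exact: measurable_funB.
  by apply/funext => x /=; case: (f x); case: (g x).
Qed.

Lemma L1ball_center (f : L1fun) (e : R) : 0 < e -> L1ball f e f.
Proof.
move=> e0; rewrite /L1ball /= L1distE.
under eq_integral do rewrite subrr ComplexField.Normc.normc0.
by rewrite integral0 lte_fin.
Qed.

Lemma L1ball_sym (f g : L1fun) (e : R) : L1ball f e g -> L1ball g e f.
Proof.
rewrite /L1ball /= !L1distE.
by under eq_integral do rewrite -opprB normcN.
Qed.

Lemma L1ball_triangle (f g h : L1fun) (e1 e2 : R) :
  L1ball f e1 g -> L1ball g e2 h -> L1ball f (e1 + e2) h.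
Proof.
rewrite /L1ball /= !L1distE => fg gh.
rewrite EFinD; apply: le_lt_trans (lteD fg gh).
have nn (a b : L1fun) x : setT x -> (0 <= (normc (a x - b x))%:E)%E.
  by move=> _; rewrite lee_fin; case: (a x - b x) => *; exact: sqrtr_ge0.
have mm (a b : L1fun) : measurable_fun setT (fun x => (normc (a x - b x))%:E).
  apply/measurable_EFinP/measurable_normc/cmeasurableB.
  - exact: (L1valP a).1.
  - exact: (L1valP b).1.
rewrite -ge0_integralD//; try exact: nn; try exact: mm.
apply: ge0_le_integral => //; try exact: nn; try exact: mm.
- apply: emeasurable_funD; exact: mm.
- move=> x _; rewrite -EFinD lee_fin.
  have -> : f x - h x = (f x - g x) + (g x - h x) by rewrite addrA subrK.
  exact: le_normcD.
Qed.

Let ent : set_system (L1fun * L1fun) := entourage_ L1ball.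

HB.instance Definition _ := hasNbhs.Build L1fun (nbhs_ ent).
HB.instance Definition _ := @Nbhs_isPseudoMetric.Build R L1fun
  ent erefl L1ball L1ball_center L1ball_sym L1ball_triangle erefl.

End L1.

Section Variation.
Context d (X : measurableType d) (R : realType).
Variables (m : probability X R) (v : (X -> R[i]) -> \bar R).
Implicit Types f g h : X -> R[i].

Definition BVnorm f : \bar R := (cLnorm m 1 f + v f)%E.

Definition BV f : Prop := cLfun m 1 f /\ (v f < +oo)%E.

Definition BVopnorm (A : (X -> R[i]) -> (X -> R[i])) : \bar R :=
  ereal_sup [set BVnorm (A f) | f in [set f | BV f /\ (BVnorm f <= 1)%E]].

(* [h] is of class C^1 on the closed interval [-M, M], with derivative [h']
   (one-sided at the end points). *)
Definition C1_on (M : R) (h h' : R -> R[i]) : Prop :=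
  {within `[- M, M], continuous (h' : R -> R[i]^o)} /\
  forall x, x \in `[- M, M] ->
    ((h y - h x) / (y - x)%:C : R[i]^o) @[y --> within `[- M, M] x^']
      --> (h' x : R[i]^o).

Definition supnorm_on (M : R) (h : R -> R[i]) : \bar R :=
  ereal_sup [set (normc (h y))%:E | y in `[- M, M]].

(* [v] is defined on L^1, hence constant on classes of almost everywhere equal
   integrable functions; outside L^1 it is extended by [+oo]. *)
Record is_variation (Cv : R) : Prop := IsVariation {
  var_ge0 : forall f, (0 <= v f)%E ;
  var_notL1 : forall f, ~ cLfun m 1 f -> v f = +oo%E ;
  var_ae : forall f g, cLfun m 1 f -> cLfun m 1 g ->
    {ae m, forall x, f x = g x} -> v f = v g ;
  varV1 : forall (t : R[i]) h, cLfun m 1 h ->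
    v (fun x => t * h x) = ((normc t)%:E * v h)%E ;
  varV2 : forall g h, cLfun m 1 g -> cLfun m 1 h ->
    (v (g \+ h)%R <= v g + v h)%E ;
  varV3_ge1 : 1 <= Cv ;
  varV3 : forall h, cLfun m 1 h ->
    (cLnorm m +oo h <= Cv%:E * (cLnorm m 1 h + v h))%E ;
  varV4 : forall C : R, 0 < C ->
    compact [set h : L1fun m | (forall x, complex.Im (h x) = 0) /\
                               (cLnorm m 1 h + v h <= C%:E)%E] ;
  varV5 : v (cst 1) = 0%E ;
  varV6 :
    [set h : L1fun m | (forall x, 0 <= h x) /\ cLnorm m 1 h = 1%E] `<=`
    closure [set h : L1fun m | [/\ (forall x, 0 <= h x),
                                   cLnorm m 1 h = 1%E & (v h < +oo)%E]] ;
  varV7 : forall f : X -> R, cLfun m 1 (cfun f) ->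
    (0 < ess_inf m (EFin \o f)%R)%E ->
    (v (cfun (fun x => (f x)^-1)%R) <=
      v (cfun f) * ((fine (ess_inf m (EFin \o f)%R)) ^- 2)%:E)%E ;
  varV8 : forall f g, cLfun m 1 f -> cLfun m 1 g ->
    cLfun m 1 (f \* g) ->
    (v (f \* g)%R <= cLnorm m +oo f * v g + cLnorm m +oo g * v f)%E ;
  varV9 : forall (M : R) (f : X -> R) (h h' : R -> R[i]), 0 < M ->
    measurable_fun setT f -> (forall x, f x \in `[- M, M]) ->
    C1_on M h h' ->
    (v (h \o f)%R <= supnorm_on M h' * v (cfun f))%E ;
  var_complete : forall u : nat -> X -> R[i], (forall n, BV (u n)) ->
    (forall e : R, 0 < e -> exists n0, forall n k, (n0 <= n)%N -> (n0 <= k)%N ->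
      (BVnorm (u n \- u k)%R <= e%:E)%E) ->
    exists2 f, BV f & (BVnorm (u n \- f)) @[n --> \oo] --> 0%E
}.

Definition transfer_operator (T : X -> X)
    (L : (X -> R[i]) -> (X -> R[i])) : Prop :=
  forall f, cLfun m 1 f -> cLfun m 1 (L f) /\
    forall g, cLfun m +oo g ->
      cintegral m (L f \* g) = cintegral m (f \* (g \o T)).

Definition nonsingular (T : X -> X) : Prop :=
  measurable_fun setT T /\
  forall A, measurable A -> m A = 0%E -> m (T @^-1` A) = 0%E.

End Variation.

Arguments BVnorm {d X R} m v f.
Arguments BVopnorm {d X R} m v A.

Section PathSpace.
Context d (Y : measurableType d).

Definition cylinders : set (set (int -> Y)) :=
  [set A | exists j, exists2 B, measurable B & A = (fun w => w j) @^-1` B].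

(* The product sigma-algebra on the two-sided sequence space. *)
Definition paths := g_sigma_algebraType cylinders.

(* The k-th iterate of the left shift, for every integer k. *)
Definition path_shift (k : int) (w : paths) : paths := fun j => w (j + k).

End PathSpace.

Section BaseSystem.
Context dU (U : measurableType dU) dY (Y : measurableType dY) (R : realType).
Variables (PU : probability U R) (xi : int -> U -> Y).
Variable P : probability (paths Y) R.

Definition xi_path (k : int) (u : U) : paths Y := fun j => xi (j + k) u.

Record stationary_base : Prop := StationaryBase {
  base_measurable : forall j, measurable_fun setT (xi j) ;
  base_stationary : forall A : set (paths Y), measurable A ->
    PU (xi_path 1 @^-1` A) = PU (xi_path 0 @^-1` A) ;
  base_law : forall A : set (paths Y), measurable A ->
    P A = PU (xi_path 0 @^-1` A) ;
  base_ergodic : forall A : set (paths Y), measurable A ->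
    path_shift 1 @^-1` A = A -> P A = 0%E \/ P A = 1%E
}.

Definition sigma_xi (J : set int) : set (set U) :=
  <<s [set A | exists2 j, J j &
                 exists2 B, measurable B & A = xi j @^-1` B] >>.

Definition alpha_coef (F G : set (set U)) : \bar R :=
  ereal_sup [set z | exists A B, [/\ F A, G B &
    z = `| PU (A `&` B) - PU A * PU B |%E]].

Definition alpha_mix (n : nat) : \bar R :=
  alpha_coef (sigma_xi [set j | j <= 0]) (sigma_xi [set j | n%:Z <= j]).

Definition tempered (Q : paths Y -> R) : Prop :=
  [/\ measurable_fun setT Q, forall w, 0 < Q w &
      {ae P, forall w,
        (ln (Q (path_shift n%:Z w)) / n%:R @[n --> \oo] --> (0 : R)) /\
        (ln (Q (path_shift (- n%:Z) w)) / (- n%:R) @[n --> \oo] --> (0 : R))}].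

End BaseSystem.

Section Cocycle.
Context d (X : measurableType d) dY (Y : measurableType dY) (R : realType).
Variables (m : probability X R) (v : (X -> R[i]) -> \bar R).
Variable P : probability (paths Y) R.
Variable T : paths Y -> X -> X.
Variable L : paths Y -> (X -> R[i]) -> (X -> R[i]).

Definition skew (z : paths Y * X) : paths Y * X := (path_shift 1 z.1, T z.1 z.2).

Record random_maps : Prop := RandomMaps {
  maps_coord0 : forall w w', w 0 = w' 0 -> T w = T w' ;
  maps_skew : measurable_fun setT skew ;
  maps_nonsingular : forall w, nonsingular m (T w) ;
  maps_transfer : forall w, transfer_operator m (T w) (L w)
}.

Fixpoint Liter (n : nat) (w : paths Y) (f : X -> R[i]) : X -> R[i] :=
  if n is n'.+1 then L (path_shift n'%:Z w) (Liter n' w f) else f.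

(* The paths form a Borel subset of a complete separable metric space, embedded
   by [iota] and carrying the Borel sigma-algebra; the topology is the one
   induced by [iota], and [L] is continuous for the operator norm of BV along
   each of the countably many pieces [E i]. *)
Definition standard_base_continuity : Prop :=
  exists (S : metricType R) (iota : paths Y -> S),
  [/\ [/\ (forall F : set_system S, ProperFilter F -> cauchy F ->
             exists s : S, F --> s),
          (exists2 Q : set S, countable Q & dense Q),
          injective iota,
          <<s @open S >> (range iota) &
          (forall A : set (paths Y), measurable A <->
             exists2 B, <<s @open S >> B & A = iota @^-1` B)],
      continuous (path_shift 1 : initial_topology iota -> initial_topology iota),
      continuous (path_shift (-1) : initial_topology iota -> initial_topology iota) &
      exists E : nat -> set (paths Y),
        [/\ forall i, measurable (E i), \bigcup_i E i = setT &
            forall i (w : initial_topology iota), E i w -> forall e : R, 0 < e ->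
              \forall w' \near w, E i w' ->
                (BVopnorm m v (fun f => L w' f \- L w f)%R <= e%:E)%E]].

Record good_cocycle (N : paths Y -> R) : Prop := GoodCocycle {
  good1 : standard_base_continuity ;
  good2_tempered : tempered P N ;
  good2 : {ae P, forall w, forall g, BV m v g ->
    (v (g \o T w) <= (N w)%:E * v g)%E} ;
  good3 : exists C : paths Y -> R,
    [/\ measurable_fun setT C, forall w, 0 < C w,
        P.-integrable setT (fun w => (ln (C w))%:E) &
        {ae P, forall w, forall h, BV m v h ->
          (BVnorm m v (L w h) <= (C w)%:E * BVnorm m v h)%E}] ;
  (* The integral of [ln (a w)] may be [-oo]; its positive part is integrable. *)
  good4 : exists (N0 : nat) (a k : paths Y -> R),
    [/\ (0 < N0)%N,
        [/\ measurable_fun setT a, forall w, 0 < a w,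
            (\int[P]_w (maxe (ln (a w))%:E 0) < +oo)%E &
            (\int[P]_w (ln (a w))%:E < 0)%E],
        [/\ measurable_fun setT k, forall w, 0 < k w &
            P.-integrable setT (fun w => (ln (k w))%:E)] &
        {ae P, forall w, forall h, BV m v h ->
          (v (Liter N0 w h) <= (a w)%:E * v h + (k w)%:E * cLnorm m 1 h)%E}] ;
  good5 : forall c : R, 0 < c ->
    exists (nc : paths Y -> nat) (al : nat -> paths Y -> R),
    [/\ measurable_fun setT nc,
        forall n, measurable_fun setT (al n),
        forall n w, 0 < al n w &
        {ae P, forall w, forall n, (nc w <= n)%N ->
          forall h, cLfun m +oo h -> {ae m, forall x, 0 <= h x} ->
            (v h <= c%:E * cLnorm m 1 h)%E ->
            ((al n w)%:E * cLnorm m 1 h <=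
               ess_inf m (fun x => (complex.Re (Liter n w h x))%:E))%E}] ;
  (* [lne 0 = -oo], so that this includes the almost sure positivity. *)
  good6 : P.-integrable setT (fun w =>
    lne (ess_inf m (fun x => (complex.Re (L w (cst 1)%R x))%:E)))
}.

Variable h : paths Y -> X -> R.

Definition fiber_mean (w : paths Y) (g : X -> R[i]) : R[i] :=
  cintegral m (fun x => g x * (h w x)%:C).

(* [mu] has fibres [h w * m] over [P]. *)
Definition skew_measure (mu : probability (paths Y * X)%type R) : Prop :=
  forall A, measurable A ->
    mu A = (\int[P]_w \int[m]_(x in xsection A w) (h w x)%:E)%E.

Record equivariant_density : Prop := EquivariantDensity {
  dens_measurable : measurable_fun setT (fun z : paths Y * X => h z.1 z.2) ;
  dens_BV : {ae P, forall w, BV m v (cfun (h w))} ;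
  dens_ge0 : forall w x, 0 <= h w x ;
  dens_int : {ae P, forall w, (\int[m]_x (h w x)%:E = 1)%E} ;
  dens_equiv : {ae P, forall w, {ae m, forall x,
    L w (cfun (h w)) x = (h (path_shift 1 w) x)%:C}} ;
  dens_gt0 : {ae P, forall w, {ae m, forall x, 0 < h w x}} ;
  dens_inv : exists2 Q, tempered P Q &
    {ae P, forall w, BVnorm m v (cfun (fun x => (h w x)^-1)) = (Q w)%:E}
}.

Definition Lnorm_iter (n : nat) (w : paths Y) (g : X -> R[i]) : X -> R[i] :=
  fun x => Liter n w (fun y => g y * (h w y)%:C) x / (h (path_shift n%:Z w) x)%:C.

Definition Proj (w : paths Y) (g : X -> R[i]) : X -> R[i] :=
  fun x => g x - cintegral m g * (h w x)%:C.

Definition nProj (w : paths Y) (g : X -> R[i]) : X -> R[i] :=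
  fun x => g x - fiber_mean w g.

Record spectral_gap (lambda eps' : R) (D D' : paths Y -> R) : Prop :=
  SpectralGap {
  gap_tempered : tempered P D ;
  gap_tempered' : tempered P D' ;
  gap_eps' : 0 < eps' ;
  gap_contr : {ae P, forall w, forall n, (0 < n)%N ->
    (BVopnorm m v (fun g => Liter n w (Proj w g)) <=
      (D w * expR (- lambda * n%:R))%:E)%E} ;
  gap_bound : {ae P, forall w, forall n, (0 < n)%N ->
    (BVopnorm m v (fun g => Liter n w (g \- Proj w g))%R <=
      (D w * expR (eps' * n%:R))%:E)%E} ;
  gap_ncontr : {ae P, forall w, forall n, (0 < n)%N ->
    (BVopnorm m v (fun g => Lnorm_iter n w (nProj w g)) <=
      (D' w * expR (- lambda * n%:R))%:E)%E} ;
  gap_nbound : {ae P, forall w, forall n, (0 < n)%N ->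
    (BVopnorm m v (fun g => Lnorm_iter n w (g \- nProj w g))%R <= (D' w)%:E)%E}
}.

Definition Ktilde (D D' N : paths Y -> R) (w : paths Y) : R :=
  Num.max (Num.max (D w) (D' w))
    (Num.max (N w) (fine (BVnorm m v (cfun (fun x => (h w x)^-1))))).

Record tempered_bound (eps : R) (Kt K : paths Y -> R) : Prop := TemperedBound {
  bound_tempered : tempered P K ;
  bound_gt1 : forall w, 1 < K w ;
  bound_Kt : {ae P, forall w, (K w)^-1 <= Kt w <= K w} ;
  bound_growth : {ae P, forall w, forall n : int,
    K w * expR (- eps * `|n|%:~R) <= K (path_shift n w) <= K w * expR (eps * `|n|%:~R)}
}.

Definition norm_K (K : paths Y -> R) (phi : paths Y * X -> R) : \bar R :=
  ess_sup P (fun w => (K w)%:E * BVnorm m v (cfun (fun x => phi (w, x))))%E.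

Definition birkhoff_sum (phi : paths Y * X -> R) (n : nat) (z : paths Y * X) : R :=
  \sum_(0 <= j < n) phi (iter j skew z).

End Cocycle.

Section Moments.
Context (R : realType).

Definition moment_bound (c0 gamma : R) (p n : nat) : R :=
  c0 ^+ p * (p`!%:R `^ (1 + gamma)) *
  \sum_(1 <= u < (p.-1)./2.+1) n%:R ^+ u * (p%:R ^+ u / u`!%:R ^+ 2).

Definition centered d (T : measurableType d) (mu : probability T R) (S : T -> R) :
  T -> R := fun z => S z - fine ('E_mu[S])%E.

Definition normal_moment (p : nat) : \bar R :=
  ('E_(normal_prob (0 : R) 1)[(fun x : R => x ^+ p)%R])%E.

End Moments.

(* Main.v *)
Require Import Defs.
From HB Require Import structures.
From mathcomp Require Import all_boot all_order all_algebra.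
From mathcomp Require Import complex.
From mathcomp Require Import all_classical all_reals all_analysis.
From mathcomp Require Import measurable_realfun ess_sup_inf.
From mathcomp Require Import ring lra zify.

Set Implicit Arguments.
Unset Strict Implicit.
Unset Printing Implicit Defensive.

Import Order.TTheory GRing.Theory Num.Theory.
Import numFieldNormedType.Exports.

Local Open Scope classical_set_scope.
Local Open Scope ring_scope.
Local Open Scope complex_scope.

(* All moments are encoded by the formal power series E exp(t S_n). Sums are
   started after a long time M, so that the fibre measures may be replaced by m.
   The contraction of the transfer operators, whose nonuniformity is paid for by
   the factor 1 / K in the bound on phi, shows that the fibre means G_e of
   exp(t S_e) satisfy G_(e+1) = G_e + sum_(l <= e) X_(l,e+1) G_l, where X_(l,e)
   depends on the coordinates between l and e only and decays exponentially in
   e - l. Averaging over the base and iterating the recursion expresses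
   E G_(e+1) - E G_e as a sum over chains of disjoint intervals; each chain is a
   covariance across any of its gaps, hence small by mixing. In a norm with
   radius of order p ^ (- 1 / eta) each step changes log E G_e by at most 1, so
   that E exp(t S_n) = exp kappa with kappa of norm at most n. The p-th
   coefficient of exp (kappa - kappa_1 t) is a sum over the powers u <= p / 2 of
   kappa - kappa_1 t: the power p / 2 gives the Gaussian moment, the others the
   error, and this bound passes to the limit M -> oo. *)

(** * Formal power series *)

(** Why [m] replaces the fibre measures: the density h_w may depend on the whole past of w, whereas
    [m] does not depend on w. A fibre mean for [m] taken from time l on involves no coordinate
    before l, so each factor of a chain is exactly a function of the coordinates of its interval,
    and mixing applies without approximating anything. The measure mu reappears only in the limit M
    -> oo, which is harmless because the bounds count the steps after M only. The weak point is
    mixing: it can be applied once per chain, so a chain must live on the rate of its longest gap.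
    Since each interval contributes at least one power of t and only coefficients up to p matter, at
    most p intervals occur, and half of that rate can be cut into p equal factors, one for each gap.
    Their sum over the length of a gap is of order p ^ (1 / eta), which fixes the radius of the
    norm; p ^ (p / eta) <= (e ^ p p!) ^ (1 / eta) is then the origin of the power gamma of p!. *)

Section FormalPowerSeries.
Variable R : realType.

Record fps := Fps { coef :> nat -> R }.

HB.instance Definition _ := gen_eqMixin fps.
HB.instance Definition _ := gen_choiceMixin fps.

Implicit Types f g h : fps.

Lemma fpsP f g : (forall k, f k = g k) -> f = g.
Proof. by case: f => f; case: g => g H; congr Fps; apply/funext. Qed.

Definition fps0 := Fps (fun _ => 0).
Definition fps1 := Fps (fun k => (k == 0%N)%:R).
Definition fpsD f g := Fps (fun k => f k + g k).
Definition fpsN f := Fps (fun k => - f k).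
Definition fpsM f g := Fps (fun k => \sum_(i < k.+1) f i * g (k - i)%N).

(** The ring laws and the Leibniz rule are transported from polynomials, a coefficient of a product
    being the one of the product of sufficiently long truncations. *)
Definition trunc n f : {poly R} := \poly_(i < n) f i.

Lemma coef_trunc n f k : (k < n)%N -> (trunc n f)`_k = f k.
Proof. by move=> kn; rewrite coef_poly kn. Qed.

Lemma fpsM_trunc n f g k : (k < n)%N -> fpsM f g k = (trunc n f * trunc n g)`_k.
Proof.
move=> kn; rewrite coefM /=; apply: eq_bigr => i _.
by rewrite !coef_trunc//; have := ltn_ord i; lia.
Qed.

Lemma fpsMC : commutative fpsM.
Proof. by move=> f g; apply: fpsP => k; rewrite !(@fpsM_trunc k.+1)// mulrC. Qed.

Lemma fpsMA : associative fpsM.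
Proof.
move=> f g h; apply: fpsP => k; set n := k.+1.
have kn j : (j <= k)%N -> (j < n)%N by [].
transitivity ((trunc n f * (trunc n g * trunc n h))`_k).
  rewrite coefM; apply: eq_bigr => i _.
  by rewrite coef_trunc ?ltn_ord// -fpsM_trunc// kn// leq_subr.
rewrite mulrA coefM; apply: eq_bigr => i _.
by rewrite coef_trunc ?kn ?leq_subr// -fpsM_trunc ?ltn_ord.
Qed.

Lemma fps1M : left_id fps1 fpsM.
Proof.
move=> f; apply: fpsP => k /=.
rewrite big_ord_recl /= subn0 mul1r big1 ?addr0// => i _.
by rewrite mul0r.
Qed.

Lemma fpsMDl : left_distributive fpsM fpsD.
Proof.
move=> f g h; apply: fpsP => k /=.
by rewrite -big_split; apply: eq_bigr => i _; rewrite mulrDl.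
Qed.

Lemma fpsDA : associative fpsD.
Proof. by move=> f g h; apply: fpsP => k /=; rewrite addrA. Qed.
Lemma fpsDC : commutative fpsD.
Proof. by move=> f g; apply: fpsP => k /=; rewrite addrC. Qed.
Lemma fps0D : left_id fps0 fpsD.
Proof. by move=> f; apply: fpsP => k /=; rewrite add0r. Qed.
Lemma fpsND : left_inverse fps0 fpsN fpsD.
Proof. by move=> f; apply: fpsP => k /=; rewrite addNr. Qed.
Lemma fps1_neq0 : fps1 != fps0.
Proof. by apply/eqP => /(congr1 (fun f => coef f 0%N)) /= /eqP; rewrite oner_eq0. Qed.

HB.instance Definition _ := GRing.isZmodule.Build fps fpsDA fpsDC fps0D fpsND.
HB.instance Definition _ :=
  GRing.Zmodule_isComNzRing.Build fps fpsMA fpsMC fps1M fpsMDl fps1_neq0.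

Lemma coefD_fps f g k : (f + g) k = f k + g k. Proof. by []. Qed.
Lemma coefN_fps f k : (- f) k = - f k. Proof. by []. Qed.
Lemma coefB_fps f g k : (f - g) k = f k - g k. Proof. by []. Qed.
Lemma coef0_fps k : (0 : fps) k = 0. Proof. by []. Qed.
Lemma coef1_fps k : (1 : fps) k = (k == 0%N)%:R. Proof. by []. Qed.
Lemma coefM_fps f g k : (f * g) k = \sum_(i < k.+1) f i * g (k - i)%N.
Proof. by []. Qed.
Lemma coef_sum_fps (I : Type) (s : seq I) (P : pred I) (F : I -> fps) k :
  (\sum_(i <- s | P i) F i) k = \sum_(i <- s | P i) F i k.
Proof. by elim/big_rec2: _ => // i x y _ <-. Qed.
Lemma coefMn_fps f n k : (f *+ n) k = f k *+ n.
Proof. by elim: n => // n IH; rewrite !mulrS coefD_fps IH. Qed.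
Lemma coefM0_fps f g : (f * g) 0%N = f 0%N * g 0%N.
Proof. by rewrite coefM_fps big_ord1. Qed.
Lemma coefM_trunc n f g k : (k < n)%N -> (f * g) k = (trunc n f * trunc n g)`_k.
Proof. exact: fpsM_trunc. Qed.

Lemma coef_lowX f k n : f 0%N = 0 -> (n < k)%N -> (f ^+ k) n = 0.
Proof.
move=> f0; elim: k n => // k IH n nk.
rewrite exprS coefM_fps big_ord_recl /= f0 mul0r add0r big1// => i _.
by rewrite IH ?mulr0// /bump /=; have := ltn_ord i; lia.
Qed.

Definition fder f := Fps (fun k => k.+1%:R * f k.+1).

Lemma fderD f g : fder (f + g) = fder f + fder g.
Proof. by apply: fpsP => k /=; rewrite mulrDr. Qed.

Lemma fderM f g : fder (f * g) = fder f * g + f * fder g.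
Proof.
apply: fpsP => k; transitivity (k.+1%:R * (f * g) k.+1) => //.
rewrite (@coefM_trunc k.+2)// mulr_natl -coef_deriv derivM.
rewrite coefD !coefM; congr (_ + _); apply: eq_bigr => -[i ik] _ /=;
  rewrite coef_deriv !coef_trunc ?mulr_natl//; lia.
Qed.

Lemma fder1 : fder 1 = 0.
Proof. by apply: fpsP => k /=; rewrite mulr0. Qed.

Lemma fderX f n : fder (f ^+ n.+1) = (f ^+ n * fder f) *+ n.+1.
Proof.
elim: n => [|n IH]; first by rewrite mul1r.
rewrite exprS fderM IH mulrnAr mulrA -exprS [_ *+ n.+2]mulrS.
by rewrite mulrC.
Qed.

(** A linear differential equation determines the coefficients one after the other. The identities
    between exponentials and logarithms below are reduced to this. *)
Lemma fps_ode_unique a f g :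
  fder f = a * f -> fder g = a * g -> f 0%N = g 0%N -> f = g.
Proof.
move=> Hf Hg H0; apply: fpsP => k; have [n] := ubnP k.
elim: n k => // n IH [|k] // kn.
have /(congr1 (fun h => h k)) := Hf; have /(congr1 (fun h => h k)) := Hg.
rewrite !coefM_fps /= => Eg Ef.
apply: (@mulfI _ k.+1%:R); first by rewrite pnatr_eq0.
rewrite Ef Eg; apply: eq_bigr => i _; rewrite IH//; lia.
Qed.

(** Cutting the sum at [n] is legitimate when [f 0 = 0], since then [f ^+ k] has no coefficient
    below [k]; otherwise the formula is not a composition. *)
Definition fcomp (c : nat -> R) f :=
  Fps (fun n => \sum_(k < n.+1) c k * (f ^+ k) n).

Lemma fcomp_wide c f N n : f 0%N = 0 -> (n <= N)%N ->
  fcomp c f n = \sum_(k < N.+1) c k * (f ^+ k) n.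
Proof.
move=> f0 nN; rewrite /= -!(big_mkord predT (fun k => c k * (f ^+ k) n)).
rewrite [RHS](@big_cat_nat _ _ _ n.+1)//=.
rewrite [X in _ = _ + X]big_nat_cond [X in _ = _ + X]big1 ?addr0// => i.
by rewrite andbT => /andP[ni _]; rewrite coef_lowX ?mulr0.
Qed.

Lemma fcomp0 c f : fcomp c f 0%N = c 0%N.
Proof. by rewrite /= big_ord1 expr0 mulr1. Qed.

Lemma fder_fcomp c f : f 0%N = 0 ->
  fder (fcomp c f) = fcomp (fun k => k.+1%:R * c k.+1) f * fder f.
Proof.
move=> f0; apply: fpsP => n.
have -> : fder (fcomp c f) n = \sum_(k < n.+2) c k * fder (f ^+ k) n.
  by rewrite /= mulr_sumr; apply: eq_bigr => k _; rewrite mulrCA.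
rewrite big_ord_recl expr0 fder1 coef0_fps mulr0 add0r.
transitivity (\sum_(k < n.+1) (k.+1%:R * c k.+1) * (f ^+ k * fder f) n).
  apply: eq_bigr => k _; have /(congr1 (fun h => h n)) := fderX f k.
  rewrite lift0 coefMn_fps => ->.
  by rewrite mulrnAr -mulrnAl -mulr_natl.
rewrite coefM_fps.
transitivity (\sum_(i < n.+1) \sum_(k < n.+1)
   (k.+1%:R * c k.+1) * ((f ^+ k) i * fder f (n - i)%N)).
  rewrite exchange_big; apply: eq_bigr => k _; rewrite coefM_fps mulr_sumr.
  by apply: eq_bigr.
apply: eq_bigr => i _; rewrite (@fcomp_wide _ _ n)//; last by rewrite -ltnS.
by rewrite mulr_suml; apply: eq_bigr => k _; rewrite mulrA.
Qed.

Definition fexp f := fcomp (fun k => k`!%:R^-1) f.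
(** This is log (1 + f). The coefficient at k = 0 vanishes through the convention [0^-1 = 0]. *)
Definition flog f := fcomp (fun k => - (-1) ^+ k / k%:R) f.

Lemma fexp0 f : fexp f 0%N = 1.
Proof. by rewrite /fexp fcomp0 fact0 invr1. Qed.

Lemma flog0 f : flog f 0%N = 0.
Proof. by rewrite /flog fcomp0 invr0 mulr0. Qed.

Lemma fder_fexp f : f 0%N = 0 -> fder (fexp f) = fder f * fexp f.
Proof.
move=> f0; rewrite /fexp fder_fcomp// mulrC; congr (_ * _).
apply: fpsP => n /=; apply: eq_bigr => k _; congr (_ * _).
by rewrite factS natrM invfM mulrA divff ?mul1r// pnatr_eq0.
Qed.

Lemma fexpD f g : f 0%N = 0 -> g 0%N = 0 -> fexp (f + g) = fexp f * fexp g.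
Proof.
move=> f0 g0; apply: (@fps_ode_unique (fder f + fder g)).
- by rewrite fder_fexp ?fderD// coefD_fps f0 g0 addr0.
- by rewrite fderM !fder_fexp// mulrDl mulrA [in RHS]mulrA [in RHS](mulrCA (fder g)) mulrA.
- by rewrite coefM0_fps !fexp0 mulr1.
Qed.

Lemma fexp_0 : fexp 0 = 1.
Proof.
apply: fpsP => n; rewrite coef1_fps /fexp /fcomp [LHS]/= big_ord_recl fact0 invr1 mul1r.
by rewrite expr0 coef1_fps big1 ?addr0// => i _; rewrite exprS mul0r mulr0.
Qed.

Lemma fexpK f : f 0%N = 0 -> fexp f * fexp (- f) = 1.
Proof. by move=> f0; rewrite -fexpD ?subrr ?fexp_0// coefN_fps f0 oppr0. Qed.

(** Both sides solve F' = (y' / (1 + y)) F with the same constant term; the inverse of 1 + y is the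
    geometric series [g], checked in degree n on its partial sum. *)
Lemma fexp_flog (y : fps) : y 0%N = 0 -> fexp (flog y) = 1 + y.
Proof.
move=> y0; pose g := fcomp (fun k => (-1) ^+ k) y.
have gK : (1 + y) * g = 1.
  apply: fpsP => n.
  have -> : ((1 + y) * g) n = ((1 + y) * \sum_(k < n.+1) (- y) ^+ k) n.
    rewrite !coefM_fps; apply: eq_bigr => i _; congr (_ * _).
    rewrite (@fcomp_wide _ _ n) ?leq_subr// coef_sum_fps; apply: eq_bigr => k _.
    rewrite [in RHS]exprNn -signr_odd -[in RHS]signr_odd.
    by case: (odd k); rewrite ?mul1r// !expr1 !mulN1r.
  have -> : 1 + y = 1 - (- y) by rewrite opprK.
  rewrite -opprB mulNr -subrX1 opprB coefB_fps coef_lowX ?subr0//.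
  by rewrite coefN_fps y0 oppr0.
have Dl : fder (flog y) = g * fder y.
  rewrite /flog fder_fcomp//; congr (_ * _).
  apply: fpsP => n /=; apply: eq_bigr => k _; congr (_ * _).
  by rewrite exprS mulN1r opprK mulrC mulfVK// pnatr_eq0.
apply: (@fps_ode_unique (g * fder y)).
- by rewrite fder_fexp ?flog0// Dl.
- by rewrite fderD fder1 add0r mulrAC [g * _]mulrC gK mul1r.
- by rewrite fexp0 coefD_fps y0 coef1_fps addr0.
Qed.

(** The series exp (a t): averaging [ex (S z)] over z coefficientwise gives the moment generating
    series of S. *)
Definition ex (a : R) := Fps (fun k => a ^+ k / k`!%:R).

Lemma exD a b : ex (a + b) = ex a * ex b.
Proof.
apply: fpsP => k; rewrite coefM_fps /= exprDn mulr_suml.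
rewrite [LHS](reindex_inj rev_ord_inj) /=; apply: eq_bigr => i _.
have ik : (i <= k)%N by rewrite -ltnS.
rewrite subSS subKn// -mulr_natl bin_sub//.
have -> : 'C(k, i)%:R = k`!%:R / (i`!%:R * (k - i)`!%:R) :> R.
  by rewrite -(bin_fact ik) !natrM mulfK// -natrM pnatr_eq0 -lt0n muln_gt0 !fact_gt0.
have nz j : j`!%:R != 0 :> R by rewrite pnatr_eq0 -lt0n fact_gt0.
by field; rewrite !nz.
Qed.

Lemma ex0 : ex 0 = 1.
Proof.
by apply: fpsP => k; rewrite coef1_fps /= expr0n; case: k => [|k] /=;
  rewrite ?fact0 ?invr1 ?mulr1 ?mul0r.
Qed.

(** Truncation at degree [p] allows the radius to depend on [p]: no convergence at a fixed radius is
    ever claimed. *)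
Definition nrm (r : R) p f := \sum_(k < p.+1) `|f k| * r ^+ k.

Section Norm.
Variables (r : R) (p : nat).
Hypothesis r0 : 0 <= r.
Local Notation "''|' f |" := (nrm r p f) (at level 0, f at level 99).

Lemma nrm_ge0 f : 0 <= nrm r p f.
Proof. by apply: sumr_ge0 => k _; rewrite mulr_ge0 ?exprn_ge0. Qed.

Lemma nrmD f g : nrm r p (f + g) <= nrm r p f + nrm r p g.
Proof.
rewrite /nrm -big_split; apply: ler_sum => k _ /=.
by rewrite -mulrDl ler_wpM2r ?exprn_ge0// ler_normD.
Qed.

Lemma nrmN f : nrm r p (- f) = nrm r p f.
Proof. by apply: eq_bigr => k _; rewrite coefN_fps normrN. Qed.

Lemma nrm0 : nrm r p 0 = 0.
Proof. by apply: big1 => k _; rewrite coef0_fps normr0 mul0r. Qed.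

Lemma nrm1 : nrm r p 1 = 1.
Proof.
rewrite /nrm big_ord_recl coef1_fps normr1 expr0 mulr1 big1 ?addr0// => k _.
by rewrite coef1_fps normr0 mul0r.
Qed.

Lemma nrm_sum (I : Type) (s : seq I) (F : I -> fps) :
  nrm r p (\sum_(i <- s) F i) <= \sum_(i <- s) nrm r p (F i).
Proof.
elim: s => [|i s IH]; first by rewrite !big_nil nrm0.
by rewrite !big_cons (le_trans (nrmD _ _))// lerD2l.
Qed.

Lemma nrm_le f g : (forall k, (k <= p)%N -> `|f k| <= `|g k|) ->
  nrm r p f <= nrm r p g.
Proof.
move=> H; apply: ler_sum => k _; rewrite ler_wpM2r ?exprn_ge0//.
by apply: H; rewrite -ltnS.
Qed.

(** The norms are values at [r] of the polynomials of absolute coefficients; their product only has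
    additional nonnegative coefficients, those of degree above [p] included. *)
Lemma nrmM f g : nrm r p (f * g) <= nrm r p f * nrm r p g.
Proof.
pose pp f : {poly R} := \poly_(i < p.+1) `|f i|.
have Hpp h : nrm r p h = (pp h).[r].
  by rewrite (@horner_coef_wide _ p.+1) ?size_poly//; apply: eq_bigr => i _;
    rewrite coef_poly ltn_ord.
have pp0 h i : 0 <= (pp h)`_i by rewrite coef_poly; case: ifP.
rewrite !Hpp -hornerM; set N := (p.+1 + size (pp f * pp g)%R)%N.
rewrite [leRHS](@horner_coef_wide _ N) ?leq_addl//.
rewrite [leLHS](@horner_coef_wide _ N) ?(leq_trans (size_poly _ _)) ?leq_addr//.
apply: ler_sum => i _; rewrite ler_wpM2r ?exprn_ge0// coef_poly.
case: ifP => ip; last by rewrite coefM; apply: sumr_ge0 => *; rewrite mulr_ge0.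
rewrite coefM coefM_fps (le_trans (ler_norm_sum _ _ _))//; apply: ler_sum => j _.
have jp : (j < p.+1)%N by rewrite (leq_trans (ltn_ord j)).
have ijp : (i - j < p.+1)%N by rewrite (leq_ltn_trans (leq_subr _ _)).
by rewrite normrM !coef_poly jp ijp.
Qed.

Lemma nrmX f k : nrm r p (f ^+ k) <= nrm r p f ^+ k.
Proof.
elim: k => [|k IH]; first by rewrite nrm1.
by rewrite !exprS (le_trans (nrmM _ _))// ler_wpM2l ?nrm_ge0.
Qed.

Lemma nrm_coef f k : (k <= p)%N -> `|f k| * r ^+ k <= nrm r p f.
Proof.
move=> kp; have kp' : (k < p.+1)%N by [].
rewrite /nrm (bigD1 (Ordinal kp'))//= lerDl sumr_ge0// => i _.
by rewrite mulr_ge0// exprn_ge0.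
Qed.

Lemma nrm_fcomp c f : f 0%N = 0 ->
  nrm r p (fcomp c f) <= \sum_(k < p.+1) `|c k| * nrm r p f ^+ k.
Proof.
move=> f0.
apply: (@le_trans _ _ (\sum_(n < p.+1) \sum_(k < p.+1) `|c k| * (`|(f ^+ k) n| * r ^+ n))).
  apply: ler_sum => n _; rewrite (@fcomp_wide _ _ p)//; last by rewrite -ltnS.
  rewrite (le_trans (ler_wpM2r (exprn_ge0 _ r0) (ler_norm_sum _ _ _)))//.
  by rewrite mulr_suml; apply: ler_sum => k _; rewrite normrM mulrA.
rewrite exchange_big; apply: ler_sum => k _ /=; rewrite -mulr_sumr.
by rewrite ler_wpM2l// nrmX.
Qed.

End Norm.

(** The truncation is essential: for eta < 1 a rate exp (- c d ^ eta) cannot absorb exp (s d), but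
    it absorbs a polynomial of degree [p] in d once s is of order p ^ (- 1 / eta). *)
Definition texp p (x : R) := \sum_(k < p.+1) x ^+ k / k`!%:R.

Lemma texp_nrm p (x : R) : 0 <= x -> texp p x = nrm 1 p (ex x).
Proof.
move=> x0; apply: eq_bigr => k _.
by rewrite expr1n mulr1 ger0_norm// divr_ge0 ?exprn_ge0.
Qed.

Lemma texpD p (x y : R) : 0 <= x -> 0 <= y -> texp p (x + y) <= texp p x * texp p y.
Proof.
by move=> x0 y0; rewrite !texp_nrm ?addr_ge0// exD nrmM.
Qed.

Lemma texp_ge0 p (x : R) : 0 <= x -> 0 <= texp p x.
Proof. by move=> x0; rewrite texp_nrm// nrm_ge0. Qed.

Lemma ler_texp p (x y : R) : 0 <= x -> x <= y -> texp p x <= texp p y.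
Proof.
move=> x0 xy; apply: ler_sum => k _; rewrite ler_wpM2r ?invr_ge0//.
by rewrite lerXn2r ?nnegrE// (le_trans x0).
Qed.

Lemma texp_le_expR p (x : R) : 0 <= x -> texp p x <= expR x.
Proof.
move=> x0; rewrite /texp -(big_mkord predT (fun k => x ^+ k / k`!%:R)).
apply: (@nondecreasing_cvgn_le _ (series (exp_coeff x))).
  by apply: nondecreasing_series => n _ _; apply: exp_coeff_ge0.
exact: is_cvg_series_exp_coeff.
Qed.

Lemma nrm_fexp (r : R) p f : 0 <= r -> f 0%N = 0 -> nrm r p (fexp f) <= texp p (nrm r p f).
Proof.
move=> r0 f0; rewrite (le_trans (nrm_fcomp _ _ _ _))//; apply: ler_sum => k _.
by rewrite ger0_norm ?invr_ge0// mulrC.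
Qed.

Lemma nrm_flog (r : R) p f : 0 <= r -> f 0%N = 0 -> nrm r p f <= 2^-1 ->
  nrm r p (flog f) <= 2 * nrm r p f.
Proof.
move=> r0 f0 H; rewrite (le_trans (nrm_fcomp _ _ _ _))//.
set x : R := nrm r p f in H *; have x0 : 0 <= x by exact: nrm_ge0.
rewrite big_ord_recl /= invr0 mulr0 normr0 mul0r add0r.
apply: (@le_trans _ _ (\sum_(i < p) x * x ^+ i)).
  apply: ler_sum => i _; rewrite /bump /= add1n -[x * x ^+ i]exprS.
  apply: ler_piMl; first by rewrite exprn_ge0.
  rewrite normrM normrN normrX normrN1 expr1n mul1r ger0_norm ?invr_ge0//.
  by rewrite invf_le1 ?ltr0n// ler1n.
rewrite -mulr_sumr mulrC ler_wpM2r//.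
have : (1 - x) * (\sum_(i < p) x ^+ i) = 1 - x ^+ p by rewrite -opprB mulNr -subrX1 opprB.
have : 0 <= \sum_(i < p) x ^+ i by apply: sumr_ge0 => i _; exact: exprn_ge0.
have : 0 <= x ^+ p by exact: exprn_ge0.
nra.
Qed.

End FormalPowerSeries.

(** * Bounded measurable functions *)

Section BoundedMeasurable.
Context d (T : measurableType d) (R : realType).
Implicit Types f g : T -> R.

(** Bounds are required everywhere, so that real-valued means are linear without integrability
    conditions. Almost sure bounds are brought to this form by clipping. *)
Definition bm f := measurable_fun setT f /\ exists C : R, forall x, `|f x| <= C.

Lemma bm_cst (c : R) : bm (fun _ => c).
Proof. by split=> //; exists `|c|. Qed.

Lemma bmD f g : bm f -> bm g -> bm (fun x => f x + g x).
Proof.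
move=> [mf [C fC]] [mg [C' gC]]; split; first exact: measurable_funD.
by exists (C + C') => x; rewrite (le_trans (ler_normD _ _))// lerD.
Qed.

Lemma bmM f g : bm f -> bm g -> bm (fun x => f x * g x).
Proof.
move=> [mf [C fC]] [mg [C' gC]]; split; first exact: measurable_funM.
by exists (C * C') => x; rewrite normrM ler_pM.
Qed.

Lemma bmZ (c : R) f : bm f -> bm (fun x => c * f x).
Proof. by move=> bf; apply: bmM => //; exact: bm_cst. Qed.

Lemma bmN f : bm f -> bm (fun x => - f x).
Proof.
by move=> /(bmZ (-1)); congr bm; apply/funext => x; rewrite mulN1r.
Qed.

Lemma bmB f g : bm f -> bm g -> bm (fun x => f x - g x).
Proof. by move=> bf /bmN; exact: bmD. Qed.

Lemma bmX f n : bm f -> bm (fun x => f x ^+ n).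
Proof.
move=> bf; elim: n => [|n IH]; first exact: bm_cst.
by rewrite (_ : (fun _ => _) = (fun x => f x * f x ^+ n)); [exact: bmM|
  apply/funext => x; rewrite exprS].
Qed.

Lemma bm_sum (I : Type) (s : seq I) (F : I -> T -> R) :
  (forall i, bm (F i)) -> bm (fun x => \sum_(i <- s) F i x).
Proof.
move=> H; elim: s => [|i s IH].
  rewrite (_ : (fun _ => _) = (fun=> 0)); first exact: bm_cst.
  by apply/funext => x; rewrite big_nil.
rewrite (_ : (fun _ => _) = (fun x => F i x + \sum_(j <- s) F j x)); first exact: bmD.
by apply/funext => x; rewrite big_cons.
Qed.

Lemma bm_indic (A : set T) : measurable A -> bm (\1_A : T -> R).
Proof.
move=> mA; split; first exact: measurable_indic.
by exists 1 => x; rewrite indicE; case: (_ \in _); rewrite ?normr1 ?normr0.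
Qed.

End BoundedMeasurable.

Lemma bm_comp d d' (T : measurableType d) (T' : measurableType d') (R : realType)
  (f : T' -> R) (g : T -> T') : bm f -> measurable_fun setT g -> bm (fun x => f (g x)).
Proof.
move=> [mf [C fC]] mg; split; last by exists C.
exact: (measurableT_comp mf mg).
Qed.

Section Mean.
Context d (T : measurableType d) (R : realType).
Variable mu : probability T R.
Implicit Types f g : T -> R.

Definition mean f : R := \int[mu]_x f x.

Lemma bm_integrable f : bm f -> mu.-integrable setT (EFin \o f).
Proof.
move=> [mf [C fC]].
apply: (@le_integrable _ _ _ mu setT _ _ (EFin \o cst C)) => //.
- exact/measurable_EFinP.
- by move=> x _ /=; rewrite lee_fin (le_trans (fC x))// ler_norm.
- exact: finite_measure_integrable_cst.
Qed.

Lemma mean_EFin f : bm f -> (\int[mu]_x (f x)%:E = (mean f)%:E)%E.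
Proof.
move=> bf; rewrite /mean /Rintegral fineK//.
exact: integrable_fin_num (bm_integrable bf).
Qed.

Lemma meanD f g : bm f -> bm g -> mean (fun x => f x + g x) = mean f + mean g.
Proof. by move=> bf bg; rewrite /mean RintegralD//; apply: bm_integrable. Qed.

Lemma meanZ (c : R) f : bm f -> mean (fun x => c * f x) = c * mean f.
Proof. by move=> bf; rewrite /mean RintegralZl//; apply: bm_integrable. Qed.

Lemma meanB f g : bm f -> bm g -> mean (fun x => f x - g x) = mean f - mean g.
Proof. by move=> bf bg; rewrite /mean RintegralB//; apply: bm_integrable. Qed.

Lemma mean_cst c : mean (fun _ => c) = c.
Proof.
rewrite -[RHS]mulr1 -[X in _ = _ * X]/(fine 1%E) -(probability_setT mu).
exact: Rintegral_cst.
Qed.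

Lemma mean_sum (I : Type) (s : seq I) (F : I -> T -> R) :
  (forall i, bm (F i)) -> mean (fun x => \sum_(i <- s) F i x) = \sum_(i <- s) mean (F i).
Proof.
move=> H; elim: s => [|i s IH].
  rewrite (_ : (fun _ => _) = (fun=> 0)) ?big_nil ?mean_cst//.
  by apply/funext => x; rewrite big_nil.
rewrite (_ : (fun _ => _) = (fun x => F i x + \sum_(j <- s) F j x)); last first.
  by apply/funext => x; rewrite big_cons.
by rewrite meanD// ?IH ?big_cons//; exact: bm_sum.
Qed.

Lemma ler_mean f g : bm f -> bm g -> (forall x, f x <= g x) -> mean f <= mean g.
Proof. by move=> bf bg fg; rewrite le_Rintegral//; exact: bm_integrable. Qed.

Lemma mean_ae f g : bm f -> bm g -> {ae mu, forall x, f x = g x} -> mean f = mean g.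
Proof.
move=> [mf _] [mg _] fg; rewrite /mean /Rintegral; congr fine.
apply: ae_eq_integral => //; try exact/measurable_EFinP.
by apply: filterS fg => x -> _.
Qed.

Lemma mean_norm f : bm f -> `|mean f| <= mean (fun x => `|f x|).
Proof. by move=> bf; rewrite le_normr_Rintegral//; exact: bm_integrable. Qed.

Lemma bm_norm f : bm f -> bm (fun x => `|f x|).
Proof.
move=> [mf [C fC]]; split; first exact: measurableT_comp.
by exists C => x; rewrite normr_id.
Qed.

Lemma mean_le_norm f C : bm f -> (forall x, `|f x| <= C) -> `|mean f| <= C.
Proof.
move=> bf fC; rewrite (le_trans (mean_norm bf))//.
by rewrite -[leRHS]mean_cst ler_mean//; [exact: bm_norm|exact: bm_cst].
Qed.

Lemma mean_indic A : measurable A -> mean (\1_A : T -> R) = fine (mu A).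
Proof. by move=> mA; rewrite /mean /Rintegral integral_indic// setIT. Qed.

End Mean.

Section FibreMean.
Context d1 d2 (W : measurableType d1) (X : measurableType d2) (R : realType).
Variable m : probability X R.

Lemma bm_xsection (f : W * X -> R) w : bm f -> bm (fun x => f (w, x)).
Proof. by move=> bf; apply: (@bm_comp _ _ _ _ _ f (pair w) bf); exact: pair1_measurable. Qed.

Lemma bm_fibre (f : W * X -> R) : bm f -> bm (fun w => mean m (fun x => f (w, x))).
Proof.
move=> bf; have [mf [C fC]] := bf; split; last first.
  by exists C => w; apply: mean_le_norm => //; exact: bm_xsection.
(* Adding the bound makes the integrand nonnegative, as Tonelli requires. *)
pose g z := f z + C.
have g0 z : (0 <= (g z)%:E)%E.
  by rewrite lee_fin; have := fC z; rewrite ler_norml /g => /andP[]; lra.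
have bg : bm g by apply: bmD => //; exact: bm_cst.
have mg : measurable_fun setT (EFin \o g) by apply/measurable_EFinP; exact: bg.1.
have := @measurable_fun_fubini_tonelli_F _ _ _ _ R m _ mg g0.
rewrite (_ : (fun w => mean m (fun x => f (w, x))) =
   (fun w => fine (fubini_F m (EFin \o g) w) - C)); last first.
  apply/funext => w; rewrite /fubini_F /= mean_EFin; last exact: (bm_xsection w bg).
  rewrite /=.
  by rewrite meanD ?mean_cst ?addrK//; [exact: bm_xsection|exact: bm_cst].
move=> mF; apply: measurable_funB => //.
by apply: measurableT_comp => //; exact: measurable_fine.
Qed.

End FibreMean.

Section UniformApproximation.
Context d (T : measurableType d) (R : realType).

Definition level (f : T -> R) (k i : nat) : set T := [set x | i.+1%:R / k%:R <= f x].

(** The sum counts the positive integers up to [k], at most [k * f x]; it is the integer part of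
    [k * f x], hence at distance at most 1 from it. *)
Lemma level_approx (f : T -> R) k x : (0 < k)%N -> 0 <= f x <= 1 ->
  `|f x - k%:R^-1 * \sum_(i < k) \1_(level f k i) x| <= k%:R^-1.
Proof.
move=> k0 /andP[f0 f1]; have k0' : 0 < k%:R :> R by rewrite ltr0n.
set S := \sum_(i < k) _.
suff : `|k%:R * f x - S| <= 1.
  move=> H; rewrite -(ler_pM2l k0') mulfV ?gt_eqF//.
  rewrite -{1}(gtr0_norm k0') -normrM mulrBr mulrA mulfV ?gt_eqF// mul1r //.
pose y := k%:R * f x; rewrite -/y.
have y0 : 0 <= y by rewrite mulr_ge0.
have yk : y <= k%:R by rewrite ler_piMr.
have SE : S = \sum_(i < k) (i.+1%:R <= y)%R%:R.
  apply: eq_bigr => i _; rewrite indicE; congr (nat_of_bool _)%:R.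
  apply/idP/idP; rewrite inE /level /= ler_pdivrMr// /y mulrC//.
rewrite SE.
suff H j : (j <= k)%N -> forall z : R, 0 <= z -> z <= j%:R ->
    `|z - \sum_(i < j) (i.+1%:R <= z)%R%:R| <= 1 by exact: (H k).
elim: j => [|j IH] jk z z0 zj.
  by rewrite big_ord0 subr0 ger0_norm// (le_trans zj).
rewrite big_ord_recr /=; have [zj'|zj'] := lerP z j%:R.
  have -> : (j.+1%:R <= z) = false by apply/negbTE; rewrite -ltNge (le_lt_trans zj')// ltr_nat.
  by rewrite addr0 IH// ltnW.
have -> : \sum_(i < j) (i.+1%:R <= z)%R%:R = j%:R :> R.
  rewrite (eq_bigr (fun=> 1)) ?sumr_const ?card_ord// => i _.
  by rewrite (_ : (_ <= z) = true)// (le_trans _ (ltW zj'))// ler_nat.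
rewrite ler_norml; move: zj; rewrite -natr1.
by case: (_ <= z) => /=; rewrite ?mulr1n ?mulr0n; move=> zj; apply/andP; split; lra.
Qed.

Lemma bm_level (f : T -> R) k : measurable_fun setT f ->
  bm (fun x => k%:R^-1 * \sum_(i < k) \1_(level f k i) x : R).
Proof.
move=> mf; apply: bmZ; apply: bm_sum => i; apply: bm_indic.
rewrite /level -[X in measurable X]setTI.
exact: (@measurable_fun_le _ _ _ _ (cst (i.+1%:R / k%:R))).
Qed.

End UniformApproximation.

(** * Covariance and mixing *)

Section Covariance.
Context d (T : measurableType d) (R : realType) (P : probability T R).
Implicit Types f g : T -> R.

Definition cov f g := mean P (fun x => f x * g x) - mean P f * mean P g.

Lemma cov_affine (a b a' b' : R) f g : bm f -> bm g ->
  cov (fun x => a * f x + b) (fun x => a' * g x + b') = a * a' * cov f g.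
Proof.
move=> bf bg; rewrite /cov.
rewrite (_ : (fun x => _) = (fun x => (a * a') * (f x * g x) +
    ((a * b') * f x + ((b * a') * g x + b * b')))); last by apply/funext => x; ring.
have bfg := bmM bf bg.
rewrite !meanD ?meanZ ?mean_cst//; try exact: bm_cst;
  try (by do ?[apply: bmD|apply: bmZ|exact: bm_cst]).
by ring.
Qed.

Lemma cov_sum (I J : Type) (s : seq I) (r : seq J) (F : I -> T -> R) (G : J -> T -> R) :
  (forall i, bm (F i)) -> (forall j, bm (G j)) ->
  cov (fun x => \sum_(i <- s) F i x) (fun x => \sum_(j <- r) G j x) =
  \sum_(i <- s) \sum_(j <- r) cov (F i) (G j).
Proof.
move=> bF bG; rewrite /cov !mean_sum//.
rewrite (_ : (fun x => _) = (fun x => \sum_(i <- s) \sum_(j <- r) F i x * G j x)); last first.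
  by apply/funext => x; rewrite mulr_suml; apply: eq_bigr => i _; rewrite mulr_sumr.
rewrite mean_sum; last by move=> i; apply: bm_sum => j; exact: bmM.
rewrite mulr_suml -sumrB; apply: eq_bigr => i _.
by rewrite mean_sum ?mulr_sumr -?sumrB// => j; exact: bmM.
Qed.

(** For staircases the covariance is, by bilinearity, an average of covariances of pairs of level
    sets, each at most [a]. The bound survives the uniform limit. *)
Lemma cov_le01 (FA FB : set (set T)) (a : R) f g :
  (forall A B, FA A -> FB B -> measurable A -> measurable B ->
     `|fine (P (A `&` B)) - fine (P A) * fine (P B)| <= a) ->
  measurable_fun setT f -> measurable_fun setT g ->
  (forall x, 0 <= f x <= 1) -> (forall x, 0 <= g x <= 1) ->
  (forall t, FA [set x | t <= f x]) -> (forall t, FB [set x | t <= g x]) ->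
  `|cov f g| <= a.
Proof.
move=> Hab mf mg f01 g01 Af Ag.
have bf : bm f by split=> //; exists 1 => x; case/andP: (f01 x) => *; rewrite ger0_norm.
have bg : bm g by split=> //; exists 1 => x; case/andP: (g01 x) => *; rewrite ger0_norm.
apply/ler_addgt0Pr => e e0.
(* Replacing [f] and [g] by staircases moves the mean of the product and the product of the means by
   at most 3 / k each. *)
set k := (Num.bound (6 / e)).+1.
have k0 : 0 < k%:R :> R by rewrite ltr0n.
have ke : 6 * k%:R^-1 <= e.
  rewrite ler_pdivrMr// mulrC -ler_pdivrMr//.
  have := archi_boundP (ltW (divr_gt0 (ltr0n _ 6) e0)).
  by move/ltW/le_trans; apply; rewrite ler_nat.
set u := (fun f x => k%:R^-1 * \sum_(i < k) \1_(level f k i) x : R).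
have k1 : k%:R^-1 <= 1 :> R by rewrite invf_le1// ler1n.
have bu h : measurable_fun setT h -> bm (u h) by exact: bm_level.
have app h x : 0 <= h x <= 1 -> `|h x - u h x| <= k%:R^-1 by exact: level_approx.
have mlev (h : T -> R) : measurable_fun setT h -> forall i, measurable (level h k i).
  move=> mh i; rewrite /level -[X in measurable X]setTI.
  exact: (@measurable_fun_le _ _ _ _ (cst (i.+1%:R / k%:R))).
have Cu : `|cov (u f) (u g)| <= a.
  have -> : cov (u f) (u g) = k%:R^-1 * k%:R^-1 *
      cov (fun x => \sum_(i < k) \1_(level f k i) x)
          (fun x => \sum_(i < k) \1_(level g k i) x).
    rewrite -(@cov_affine _ 0 _ 0); first by congr cov; apply/funext => x; rewrite addr0.
      by apply: bm_sum => i; apply: bm_indic; exact: mlev.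
    by apply: bm_sum => i; apply: bm_indic; exact: mlev.
  rewrite cov_sum; try by move=> i; apply: bm_indic; exact: mlev.
  rewrite normrM (le_trans (ler_wpM2l _ (ler_norm_sum _ _ _)))//.
  have -> : a = `|k%:R^-1 * k%:R^-1| * \sum_(i < k) \sum_(j < k) a.
    have -> : \sum_(i < k) \sum_(j < k) a = k%:R * (k%:R * a) :> R.
      by rewrite !sumr_const !card_ord !mulr_natl.
    rewrite ger0_norm; last by rewrite mulr_ge0 ?invr_ge0 ?ler0n.
    by field; rewrite gt_eqF.
  rewrite ler_wpM2l//; apply: ler_sum => i _.
  rewrite (le_trans (ler_norm_sum _ _ _))//; apply: ler_sum => j _.
  rewrite /cov !mean_indic; try exact: mlev.
  rewrite (_ : (fun x => _) = (\1_(level f k i `&` level g k j))); last first.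
    by apply/funext => x; rewrite indicI.
  rewrite mean_indic; last by apply: measurableI; exact: mlev.
  by apply: Hab; [exact: Af|exact: Ag|exact: mlev|exact: mlev].
have b1 h : bm h -> measurable_fun setT h -> (forall x, 0 <= h x <= 1) ->
    `|mean P h - mean P (u h)| <= k%:R^-1.
  move=> bh mh h01; rewrite -meanB//; last exact: bu.
  by apply: mean_le_norm => [|x]; [apply: bmB => //; exact: bu|exact: app].
have D1 : `|mean P (fun x => f x * g x) - mean P (fun x => u f x * u g x)| <= 3 * k%:R^-1.
  rewrite -meanB//; [|exact: bmM|by apply: bmM; exact: bu].
  apply: mean_le_norm => [|x].
    by apply: bmB; [exact: bmM|apply: bmM; exact: bu].
  have := app f x (f01 x); have := app g x (g01 x).
  move: (f01 x) (g01 x); move: k1 (f x) (g x) (u f x) (u g x).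
  have : 0 <= k%:R^-1 :> R by rewrite invr_ge0 ltW.
  move: (k%:R^-1) => q q0 q1 a1 b1' a2 b2 /andP[? ?] /andP[? ?].
  rewrite !ler_norml => /andP[? ?] /andP[? ?]; apply/andP; split; nra.
have D2 : `|mean P f * mean P g - mean P (u f) * mean P (u g)| <= 3 * k%:R^-1.
  have m01 h : bm h -> (forall x, 0 <= h x <= 1) -> 0 <= mean P h <= 1.
    move=> bh h01; rewrite -{1}(mean_cst P 0) -(mean_cst P 1) !ler_mean//;
      try exact: bm_cst; by move=> x; case/andP: (h01 x).
  have := b1 f bf mf f01; have := b1 g bg mg g01.
  move: (m01 f bf f01) (m01 g bg g01).
  move: k1 (mean P f) (mean P g) (mean P (u f)) (mean P (u g)).
  have : 0 <= k%:R^-1 :> R by rewrite invr_ge0 ltW.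
  move: (k%:R^-1) => q q0 q1 a1 b1' a2 b2 /andP[? ?] /andP[? ?].
  rewrite !ler_norml => /andP[? ?] /andP[? ?]; apply/andP; split; nra.
move: Cu D1 D2 ke; rewrite /cov !ler_norml => /andP[? ?] /andP[? ?] /andP[? ?] ?.
apply/andP; split; lra.
Qed.

(** Rescaling to [0, 1] through f = 2 F (f' - 1/2) multiplies the covariance by 4 F G. Zero bounds
    are treated apart because of the division by F and G. *)
Lemma cov_le (FA FB : set (set T)) (a : R) f g (F G : R) :
  (forall A B, FA A -> FB B -> measurable A -> measurable B ->
     `|fine (P (A `&` B)) - fine (P A) * fine (P B)| <= a) ->
  measurable_fun setT f -> measurable_fun setT g ->
  (forall x, `|f x| <= F) -> (forall x, `|g x| <= G) ->
  (forall t, FA [set x | t <= f x]) -> (forall t, FB [set x | t <= g x]) ->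
  `|cov f g| <= 4 * a * F * G.
Proof.
move=> Hab mf mg fF gG Af Ag.
have F0 : 0 <= F by rewrite (le_trans (normr_ge0 _) (fF point)).
have G0 : 0 <= G by rewrite (le_trans (normr_ge0 _) (gG point)).
have bf : bm f by split=> //; exists F.
have bg : bm g by split=> //; exists G.
have zero (h : T -> R) : (forall x, `|h x| <= 0) -> h = (fun=> 0).
  by move=> h0; apply/funext => x; apply/eqP; rewrite -normr_le0.
have cov0l h : cov (fun=> 0) h = 0.
  by rewrite /cov (_ : (fun x => 0 * h x) = (fun=> 0)) ?mean_cst ?mul0r ?subr0//;
    apply/funext => x; rewrite mul0r.
have cov0r h : cov h (fun=> 0) = 0.
  by rewrite /cov (_ : (fun x => h x * 0) = (fun=> 0)) ?mean_cst ?mulr0 ?subr0//;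
    apply/funext => x; rewrite mulr0.
move: F0; rewrite le_eqVlt => /orP[/eqP F0|F0].
  by move: fF; rewrite -F0 => /zero ->; rewrite cov0l normr0 mulr0 mul0r.
move: G0; rewrite le_eqVlt => /orP[/eqP G0|G0].
  by move: gG; rewrite -G0 => /zero ->; rewrite cov0r normr0 mulr0.
pose f' x := (2 * F)^-1 * f x + 2^-1; pose g' x := (2 * G)^-1 * g x + 2^-1.
have C : `|cov f' g'| <= a.
  apply: (@cov_le01 FA FB) => //.
  - by apply: measurable_funD => //; exact: measurable_funM.
  - by apply: measurable_funD => //; exact: measurable_funM.
  - move=> x; have := fF x; rewrite ler_norml => /andP[h1 h2].
    have -> : f' x = (f x + F) / (2 * F) by rewrite /f'; field; rewrite gt_eqF.
    by rewrite divr_ge0 ?ler_pdivrMr; lra.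
  - move=> x; have := gG x; rewrite ler_norml => /andP[h1 h2].
    have -> : g' x = (g x + G) / (2 * G) by rewrite /g'; field; rewrite gt_eqF.
    by rewrite divr_ge0 ?ler_pdivrMr; lra.
  - move=> t; rewrite (_ : [set x | _] = [set x | 2 * F * (t - 2^-1) <= f x]) //.
    apply/funext => x /=; apply: congr1.
    have -> : f x = 2 * F * (f' x - 2^-1) by rewrite /f'; field; rewrite gt_eqF.
    by rewrite ler_pM2l ?mulr_gt0// lerD2r.
  - move=> t; rewrite (_ : [set x | _] = [set x | 2 * G * (t - 2^-1) <= g x]) //.
    apply/funext => x /=; apply: congr1.
    have -> : g x = 2 * G * (g' x - 2^-1) by rewrite /g'; field; rewrite gt_eqF.
    by rewrite ler_pM2l ?mulr_gt0// lerD2r.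
have -> : cov f g = (4 * F * G) * cov f' g'.
  rewrite (cov_affine _ _ _ _ bf bg); field; rewrite !gt_eqF//.
rewrite normrM gtr0_norm; last by rewrite !mulr_gt0.
rewrite (_ : 4 * a * F * G = 4 * F * G * a); last by ring.
by rewrite ler_wpM2l// ltW// !mulr_gt0.
Qed.

End Covariance.

(** * Mixing for functions of the path *)

Section Base.
Context dU (U : measurableType dU) dY (Y : measurableType dY) (R : realType).
Variables (PU : probability U R) (xi : int -> U -> Y).
Variable P : probability (paths Y) R.
Hypothesis hbase : stationary_base PU xi P.

(** Dependence on coordinates is stated pointwise, hence is preserved by any operation on values;
    [cov_mix] returns to the sigma-algebras of the mixing coefficient by freezing coordinates. *)
Definition past (c : int) (Z : Type) (f : paths Y -> Z) :=
  forall w w', (forall j, j <= c -> w j = w' j) -> f w = f w'.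
Definition future (c : int) (Z : Type) (f : paths Y -> Z) :=
  forall w w', (forall j, c <= j -> w j = w' j) -> f w = f w'.

Lemma measurable_to_paths d (T : measurableType d) (F : T -> paths Y) :
  (forall j, measurable_fun setT (fun u => F u j)) -> measurable_fun setT F.
Proof.
move=> mF; apply: (@measurability _ _ T (paths Y) setT F (@cylinders _ Y)) => //.
move=> _ [_ [j [B mB ->]] <-]; rewrite setTI.
by have := mF j measurableT _ mB; rewrite setTI.
Qed.

Lemma measurable_coord j : measurable_fun setT (fun w : paths Y => w j).
Proof.
move=> _ B mB; rewrite setTI; apply: sub_sigma_algebra.
by exists j, B.
Qed.

Lemma measurable_path_shift k : measurable_fun setT (@path_shift _ Y k).
Proof. by apply: measurable_to_paths => j; exact: measurable_coord. Qed.

Lemma xi_path_law k (A : set (paths Y)) : measurable A -> P A = PU (xi_path xi k @^-1` A).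
Proof.
have step j B : measurable B -> PU (xi_path xi (j + 1) @^-1` B) = PU (xi_path xi j @^-1` B).
  move=> mB; have m' : measurable (path_shift j @^-1` B).
    by have := measurable_path_shift j measurableT mB; rewrite setTI.
  have E k' : xi_path xi (j + k') @^-1` B = xi_path xi k' @^-1` (path_shift j @^-1` B).
    apply/seteqP; split=> u /=; congr (B _); apply/funext => i;
      rewrite /path_shift /xi_path; congr (xi _ _); lia.
  by rewrite E (base_stationary hbase m') -E addr0.
move=> mA; elim: k => [|k IH|k IH].
- exact: (base_law hbase).
- by rewrite IH -step//; congr (PU (xi_path xi _ @^-1` A)); lia.
- by rewrite IH -(step (- k.+1%:Z))//; congr (PU (xi_path xi _ @^-1` A)); lia.
Qed.

Lemma shift_law k (A : set (paths Y)) : measurable A -> P (path_shift k @^-1` A) = P A.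
Proof.
move=> mA; have m' : measurable (path_shift k @^-1` A).
  by have := measurable_path_shift k measurableT mA; rewrite setTI.
rewrite (xi_path_law 0 m') (xi_path_law k mA); congr (PU _).
by apply/seteqP; split=> u /=; congr (A _); apply/funext => i;
  rewrite /path_shift /xi_path; congr (xi _ _); lia.
Qed.

(** The sets [A] with this property form a sigma-algebra containing the cylinders. It serves with
    [r] a retraction of the integers onto a half-line, up to a shift. *)
Lemma sigma_xi_preimage (J : set int) (r : int -> int) (A : set (paths Y)) :
  (forall j, J (r j)) -> measurable A ->
  sigma_xi xi J ((fun u (j : int) => xi (r j) u) @^-1` A).
Proof.
move=> Jr mA; pose F u : paths Y := fun j => xi (r j) u.
suff : <<s @cylinders _ Y >> `<=` image_set_system setT F (sigma_xi xi J).
  by move=> /(_ A mA); rewrite /image_set_system /= setTI.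
apply: smallest_sub; first by apply: sigma_algebra_image; exact: smallest_sigma_algebra.
move=> _ [j [B mB ->]]; rewrite /image_set_system /= setTI.
by apply: sub_sigma_algebra; exists (r j) => //; exists B.
Qed.

Variables c1 c2 eta : R.
Hypothesis hmix : forall n : nat, (0 < n)%N ->
  (alpha_mix PU xi n <= (c1 * expR (- c2 * n%:R `^ eta))%:E)%E.

Lemma cov_mix (c : int) n (f g : paths Y -> R) (F G : R) : (0 < n)%N ->
  measurable_fun setT f -> measurable_fun setT g ->
  past c f -> future (c + n%:Z) g ->
  (forall w, `|f w| <= F) -> (forall w, `|g w| <= G) ->
  `|cov P f g| <= 4 * (c1 * expR (- c2 * n%:R `^ eta)) * F * G.
Proof.
move=> n0 mf mg pf fg fF gG.
apply: (@cov_le _ _ _ P [set A | past c A] [set A | future (c + n%:Z) A]) => //; last first.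
- by move=> t w w' ww' /=; rewrite (fg w w').
- by move=> t w w' ww' /=; rewrite (pf w w').
move=> A B pA fB mA mB; set a := _ * expR _.
have XA : sigma_xi xi [set j | j <= 0] (xi_path xi (- c) @^-1` A).
  (* The coordinates after [c] are replaced by the one at [c], which does not change membership in
     [A]; the shift by [c] places the separation at time 0, as in the definition of the mixing
     coefficient. *)
  rewrite (_ : _ @^-1` _ = (fun u (j : int) => xi (Num.min j c - c) u) @^-1` A).
    by apply: sigma_xi_preimage => // j /=; lia.
  apply/seteqP; split=> u /=; rewrite (pA _ (xi_path xi (- c) u))// => j jc;
   rewrite /xi_path; congr (xi _ _); lia.
have XB : sigma_xi xi [set j | n%:Z <= j] (xi_path xi (- c) @^-1` B).
  rewrite (_ : _ @^-1` _ = (fun u (j : int) => xi (Num.max j (c + n%:Z) - c) u) @^-1` B).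
    by apply: sigma_xi_preimage => // j /=; lia.
  apply/seteqP; split=> u /=; rewrite (fB _ (xi_path xi (- c) u))// => j jc;
   rewrite /xi_path; congr (xi _ _); lia.
have := hmix n0; rewrite /alpha_mix /alpha_coef => H.
have : (`|PU (xi_path xi (- c) @^-1` A `&` xi_path xi (- c) @^-1` B) -
   PU (xi_path xi (- c) @^-1` A) * PU (xi_path xi (- c) @^-1` B)| <= a%:E)%E.
  by apply: le_trans H; apply: ereal_sup_ubound; eexists; eexists; split; [exact: XA|exact: XB|].
rewrite -preimage_setI -!xi_path_law//; last exact: measurableI.
have fn C : measurable C -> P C \is a fin_num by move=> mC; exact: fin_num_measure.
rewrite -{1}(fineK (fn _ (measurableI _ _ mA mB))) -(fineK (fn _ mA)) -(fineK (fn _ mB)).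
by rewrite -EFinM -EFinB /= lee_fin.
Qed.

End Base.

(** * Means along chains of intervals *)

Section Majorants.
Variable R : realType.
Implicit Types f g h : fps R.

Definition maj (f g : fps R) := forall k, `|f k| <= g k.

Lemma majM f0 g0 f1 g1 : maj f0 g0 -> maj f1 g1 -> maj (f0 * f1) (g0 * g1).
Proof.
move=> H0 H1 k; rewrite !coefM_fps (le_trans (ler_norm_sum _ _ _))//.
by apply: ler_sum => i _; rewrite normrM ler_pM.
Qed.
Lemma majD f0 g0 f1 g1 : maj f0 g0 -> maj f1 g1 -> maj (f0 + f1) (g0 + g1).
Proof. by move=> H0 H1 k; rewrite (le_trans (ler_normD _ _))// lerD. Qed.
Lemma majN f0 g0 : maj f0 g0 -> maj (- f0) g0.
Proof. by move=> H k; rewrite coefN_fps normrN. Qed.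
Lemma majB f0 g0 f1 g1 : maj f0 g0 -> maj f1 g1 -> maj (f0 - f1) (g0 + g1).
Proof. by move=> H0 /majN; exact: majD. Qed.
Lemma maj1 : maj 1 1.
Proof. by move=> k; rewrite coef1_fps normr_nat. Qed.
Lemma nrm_maj (r : R) p f0 g0 : 0 <= r -> maj f0 g0 -> nrm r p f0 <= nrm r p g0.
Proof.
by move=> r0 H; apply: nrm_le => // k _; rewrite (le_trans (H k))// ler_norm.
Qed.

Definition fscale (c : R) (f : fps R) : fps R := Fps (fun k => c * f k).

Lemma fscaleM c c' f g : fscale c f * fscale c' g = fscale (c * c') (f * g).
Proof.
apply: fpsP => k; rewrite coefM_fps /= mulr_sumr; apply: eq_bigr => i _.
by rewrite mulrACA.
Qed.
Lemma fscale1 f : fscale 1 f = f.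
Proof. by apply: fpsP => k; rewrite /= mul1r. Qed.
Lemma nrm_fscale (r : R) p c f : nrm r p (fscale c f) = `|c| * nrm r p f.
Proof. by rewrite /nrm mulr_sumr; apply: eq_bigr => k _; rewrite normrM mulrA. Qed.
Lemma maj_scale (c c' : R) f g : c <= c' -> maj f (fscale c g) -> (forall k, 0 <= g k) ->
  maj f (fscale c' g).
Proof. by move=> cc H g0 k; rewrite (le_trans (H k))// ler_wpM2r. Qed.

End Majorants.

Section SeriesMean.
Context d (T : measurableType d) (R : realType) (P : probability T R).
Implicit Types f g : T -> fps R.

Definition bmf f := forall k, bm (fun w => f w k).
Definition meanf f : fps R := Fps (fun k => mean P (fun w => f w k)).

Lemma bmf_cst (c : fps R) : bmf (fun _ => c). Proof. by move=> k; exact: bm_cst. Qed.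
Lemma bmfD f g : bmf f -> bmf g -> bmf (fun w => f w + g w).
Proof. by move=> bf bg k; apply: bmD. Qed.
Lemma bmfB f g : bmf f -> bmf g -> bmf (fun w => f w - g w).
Proof. by move=> bf bg k; apply: bmB. Qed.
Lemma bmfM f g : bmf f -> bmf g -> bmf (fun w => f w * g w).
Proof. by move=> bf bg k; apply: bm_sum => i; apply: bmM. Qed.
Lemma bmf_sum (I : Type) (s : seq I) (F : I -> T -> fps R) :
  (forall i, bmf (F i)) -> bmf (fun w => \sum_(i <- s) F i w).
Proof.
move=> H k; rewrite (_ : (fun w => _) = (fun w => \sum_(i <- s) F i w k)).
  by apply: bm_sum => i; exact: H.
by apply/funext => w; rewrite coef_sum_fps.
Qed.

Lemma meanf_cst c : meanf (fun _ => c) = c.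
Proof. by apply: fpsP => k /=; rewrite mean_cst. Qed.
Lemma meanfD f g : bmf f -> bmf g -> meanf (fun w => f w + g w) = meanf f + meanf g.
Proof. by move=> bf bg; apply: fpsP => k; rewrite /= meanD. Qed.
Lemma meanfB f g : bmf f -> bmf g -> meanf (fun w => f w - g w) = meanf f - meanf g.
Proof. by move=> bf bg; apply: fpsP => k; rewrite /= meanB. Qed.
Lemma meanfZ c f : bmf f -> meanf (fun w => c * f w) = c * meanf f.
Proof.
move=> bf; apply: fpsP => k; rewrite /= mean_sum; last by move=> i; apply: bmZ.
by apply: eq_bigr => i _; rewrite meanZ.
Qed.
Lemma meanf_sum (I : Type) (s : seq I) (F : I -> T -> fps R) :
  (forall i, bmf (F i)) ->
  meanf (fun w => \sum_(i <- s) F i w) = \sum_(i <- s) meanf (F i).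
Proof.
move=> H; apply: fpsP => k; rewrite coef_sum_fps /=.
rewrite (_ : (fun w => _) = (fun w => \sum_(i <- s) F i w k)) ?mean_sum//.
  by move=> i; exact: H.
by apply/funext => w; rewrite coef_sum_fps.
Qed.

Definition covf f g : fps R := meanf (fun w => f w * g w) - meanf f * meanf g.

Lemma covf_center f g : bmf f -> bmf g ->
  meanf (fun w => f w * (g w - meanf g)) = covf f g.
Proof.
move=> bf bg; rewrite (_ : (fun w => _) = (fun w => f w * g w - meanf g * f w)).
  by rewrite meanfB ?meanfZ//; [rewrite mulrC|exact: bmfM|apply: bmfM => //; exact: bmf_cst].
by apply/funext => w; rewrite mulrBr [f w * meanf g]mulrC.
Qed.

Lemma covfC f g : covf f g = covf g f.
Proof.
rewrite /covf mulrC; congr (meanf _ - _).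
by apply/funext => w; rewrite mulrC.
Qed.

Lemma coef_covf f g k : bmf f -> bmf g ->
  covf f g k = \sum_(i < k.+1) cov P (fun w => f w i) (fun w => g w (k - i)%N).
Proof.
move=> bf bg; rewrite /covf coefB_fps /= mean_sum; last by move=> i; exact: bmM.
by rewrite -sumrB.
Qed.

Lemma maj_meanf f (g0 : fps R) : bmf f -> (forall w, maj (f w) g0) -> maj (meanf f) g0.
Proof. by move=> bf H k; apply: mean_le_norm => // w; exact: H. Qed.

End SeriesMean.

Section Chains.
Context d (T : measurableType d) (R : realType) (P : probability T R).
Variable X : nat -> nat -> T -> fps R.
Hypothesis bX : forall l e, bmf (X l e).

Notation E := (meanf P).

(* A chain is a list of disjoint intervals, from left to right. *)
Fixpoint chainc (Q : seq (nat * nat)) : T -> fps R :=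
  if Q is J :: Q' then
    let Z := fun w => X J.1 J.2 w * chainc Q' w in fun w => Z w - E Z
  else fun _ => 1.

Definition chainv (Q : seq (nat * nat)) : fps R :=
  if Q is J :: Q' then E (fun w => X J.1 J.2 w * chainc Q' w) else 0.

Lemma bmf_chainc Q : bmf (chainc Q).
Proof.
elim: Q => [|I Q IH]; first exact: bmf_cst.
by apply: bmfB; [apply: bmfM|exact: bmf_cst].
Qed.

Lemma meanf_chainc I Q : E (chainc (I :: Q)) = 0.
Proof.
have b : bmf (fun w => X I.1 I.2 w * chainc Q w) by apply: bmfM => //; exact: bmf_chainc.
by rewrite [chainc _]/= meanfB//; [rewrite meanf_cst subrr|exact: bmf_cst].
Qed.

Variable G : nat -> T -> fps R.
Hypothesis bG : forall e, bmf (G e).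
Hypothesis G0 : forall w, G 0 w = 1.
Hypothesis GS : forall e w, G e.+1 w = G e w + \sum_(l < e.+1) X l e.+1 w * G l w.

Lemma chain_sum c w : G c w = 1 + \sum_(e < c) \sum_(l < e.+1) X l e.+1 w * G l w.
Proof.
elim: c => [|c IH]; first by rewrite big_ord0 addr0.
by rewrite GS IH [in RHS]big_ord_recr addrA.
Qed.

(* The sum of [f] over all chains obtained from [Q] by adding intervals to the
   left of [c]; at most [fuel] intervals are added. *)
Fixpoint chsum (V : nmodType) (fuel c : nat) (Q : seq (nat * nat))
    (f : seq (nat * nat) -> V) : V :=
  if fuel is n.+1 then
    \sum_(e < c) \sum_(l < e.+1)
      (f ((val l, e.+1) :: Q) + chsum n l ((val l, e.+1) :: Q) f)
  else 0.

Definition chain_term (Q : seq (nat * nat)) : fps R :=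
  chainv Q * E (G (head (0, 0) Q).1).

(** The product [X l e * chainc Q] is split into its mean, which factors out as the value of the
    longer chain, and its centred part, to which the expansion of [G l] can be applied again. *)
Lemma chain_step l e Q :
  E (fun w => X l e w * chainc Q w * G l w) =
  chain_term ((l, e) :: Q) + E (fun w => chainc ((l, e) :: Q) w * G l w).
Proof.
have b : bmf (fun w => X l e w * chainc Q w) by apply: bmfM => //; exact: bmf_chainc.
rewrite /chain_term [chainv _]/= [head _ _]/= -meanfZ// -meanfD//; last first.
- by apply: bmfM => //; exact: bmf_chainc.
- by apply: bmfM => //; exact: bmf_cst.
by congr (E _); apply/funext => w /=; rewrite -mulrDl addrC subrK.
Qed.

(** The term 1 of [chain_sum] disappears because a nonempty chain has mean zero; each added interval
    starts strictly before the current [c], so at most [c] rounds are needed. *)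
Lemma chain_expand fuel c I Q : (c <= fuel)%N ->
  E (fun w => chainc (I :: Q) w * G c w) = chsum fuel c (I :: Q) chain_term.
Proof.
elim: fuel c I Q => [|n IH] c I Q cn.
  move: cn; rewrite leqn0 => /eqP ->.
  rewrite (_ : (fun w => _) = chainc (I :: Q)) ?meanf_chainc//.
  by apply/funext => w; rewrite G0 mulr1.
set V := chainc (I :: Q).
have bV : bmf V by exact: bmf_chainc.
rewrite (_ : (fun w => _) = (fun w => V w +
   \sum_(e < c) \sum_(l < e.+1) X l e.+1 w * V w * G l w)); last first.
  apply/funext => w; rewrite chain_sum mulrDr mulr1; congr (_ + _).
  rewrite mulr_sumr; apply: eq_bigr => e _; rewrite mulr_sumr; apply: eq_bigr => l _.
  by rewrite mulrCA mulrA.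
rewrite meanfD//; last by do 2! apply: bmf_sum => ?; do 2! apply: bmfM => //.
rewrite meanf_chainc add0r meanf_sum; last first.
  by move=> e; apply: bmf_sum => l; do 2! apply: bmfM => //.
apply: eq_bigr => e _; rewrite meanf_sum; last by move=> l; do 2! apply: bmfM => //.
apply: eq_bigr => l _; rewrite chain_step; congr (_ + _).
by apply: IH; have := ltn_ord l; have := ltn_ord e; lia.
Qed.

Lemma mean_recursion e :
  E (G e.+1) = E (G e) + \sum_(l < e.+1)
    (chain_term [:: (val l, e.+1)] + chsum e l [:: (val l, e.+1)] chain_term).
Proof.
rewrite (_ : G e.+1 = fun w => G e w + \sum_(l < e.+1) X l e.+1 w * chainc [::] w * G l w).
  have b l : bmf (fun w => X l e.+1 w * chainc [::] w * G l w).
    by do 2! apply: bmfM => //; exact: bmf_cst.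
  rewrite meanfD//; last by apply: bmf_sum => l.
  rewrite meanf_sum//; congr (_ + _); apply: eq_bigr => l _.
  by rewrite chain_step; congr (_ + _); apply: chain_expand; have := ltn_ord l; lia.
by apply/funext => w; rewrite GS; congr (_ + _); apply: eq_bigr => l _; rewrite mulr1.
Qed.

(** The mirror image of [chainc], centred from the left. It gathers everything to the left of a cut
    into one function of the past. *)
Fixpoint prefix_prod (V : T -> fps R) (Q : seq (nat * nat)) : T -> fps R :=
  if Q is J :: Q' then prefix_prod (fun w => (V w - E V) * X J.1 J.2 w) Q' else V.

Lemma bmf_prefix V Q : bmf V -> bmf (prefix_prod V Q).
Proof.
elim: Q V => //= I Q IH V bV; apply: IH; apply: bmfM => //.
by apply: bmfB => //; exact: bmf_cst.
Qed.

(* Moving the centring from the right factor to the left one at every interval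
   exhibits the value of a chain as a covariance across any given gap. *)
Lemma mean_chain_cut V Q1 J Q2 : bmf V ->
  E (fun w => V w * chainc (Q1 ++ J :: Q2) w) =
  covf P (prefix_prod V Q1) (fun w => X J.1 J.2 w * chainc Q2 w).
Proof.
elim: Q1 V => [|I Q1 IH] V bV.
  by rewrite [LHS]covf_center//; apply: bmfM => //; exact: bmf_chainc.
rewrite -IH; last by apply: bmfM => //; apply: bmfB => //; exact: bmf_cst.
have b : bmf (fun w => X I.1 I.2 w * chainc (Q1 ++ J :: Q2) w).
  by apply: bmfM => //; exact: bmf_chainc.
rewrite [chainc _]/= [LHS]covf_center// covfC -covf_center//.
by congr (E _); apply/funext => w; rewrite mulrC mulrA.
Qed.

Lemma chainv_cut I Q1 J Q2 :
  chainv (I :: Q1 ++ J :: Q2) =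
  covf P (prefix_prod (X I.1 I.2) Q1) (fun w => X J.1 J.2 w * chainc Q2 w).
Proof. exact: mean_chain_cut. Qed.

End Chains.

Section ChainBounds.
Context dY (Y : measurableType dY) (R : realType).
Variable P : probability (paths Y) R.
Variable X : nat -> nat -> paths Y -> fps R.
Hypothesis bX : forall l e, bmf (X l e).
Variables A0 A th C1 : R.
Variable mixrate : nat -> R.
Hypotheses (A00 : 0 <= A0) (A_ge0 : 0 <= A) (th0 : 0 <= th) (C11 : 1 <= C1).
Hypothesis mixrate0 : forall n, 0 <= mixrate n.

(** The series A t / (1 - A t). It has no constant term, so a chain of n intervals contributes from
    order n on only. *)
Definition gser : fps R := Fps (fun k => if k is 0%N then 0 else A ^+ k).

Hypothesis Xmaj : forall l e w, (l < e)%N ->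
  maj (X l e w) (fscale (A0 * th ^+ (e - l).-1) gser).
Hypothesis Xpast : forall l e, (l < e)%N -> past e%:Z (X l e).
Hypothesis Xfuture : forall l e, (l < e)%N -> future l%:Z (X l e).
Hypothesis mixing : forall (c n : nat) (f g : paths Y -> R) (F G : R),
  measurable_fun setT f -> measurable_fun setT g ->
  past c%:Z f -> future (c + n)%N%:Z g ->
  (forall w, `|f w| <= F) -> (forall w, `|g w| <= G) ->
  `|cov P f g| <= C1 * mixrate n * F * G.

Notation E := (meanf P).
Notation chain := (seq (nat * nat)).

Fixpoint okchain (Q : chain) : bool :=
  if Q is J :: Q' then
    [&& (J.1 < J.2)%N, (if Q' is K :: _ then (J.2 <= K.1)%N else true) & okchain Q']
  else true.

Fixpoint gaps (Q : chain) : seq nat :=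
  if Q is J :: Q' then
    if Q' is K :: _ then (K.1 - J.2)%N :: gaps Q' else [::]
  else [::].

(** The factor 2 of each interval pays for its centring, as in [maj_center]. *)
Definition chprod (Q : chain) : R :=
  \prod_(J <- Q) (2 * A0 * th ^+ (J.2 - J.1).-1).

Lemma chprod_ge0 Q : 0 <= chprod Q.
Proof. by apply: prodr_ge0 => J _; rewrite !mulr_ge0 ?exprn_ge0. Qed.

Lemma gserX_ge0 n k : 0 <= (gser ^+ n) k.
Proof.
elim: n k => [|n IH] k; first by rewrite coef1_fps ler0n.
rewrite exprS coefM_fps; apply: sumr_ge0 => i _; apply: mulr_ge0 => //.
by case: (val i) => //= j; rewrite exprn_ge0.
Qed.

Lemma okchain_starts Q J : okchain (J :: Q) ->
  all (fun K : nat * nat => (J.1 <= K.1)%N && (K.1 < K.2)%N) (J :: Q).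
Proof.
elim: Q J => [|K Q IH] J; first by rewrite /= leqnn => /andP[->].
rewrite [okchain _]/= => /and3P[JJ JK okQ].
have := IH _ okQ; rewrite [all _ (J :: _)]/= leqnn JJ /= => /andP[/andP[_ ->] H].
have JK1 := leq_trans (ltnW JJ) JK; rewrite andbT JK1 /=.
by apply: sub_all H => I /andP[h1 ->]; rewrite andbT (leq_trans JK1).
Qed.

Lemma okchain_cut Q d : okchain Q -> d \in gaps Q ->
  exists I Q1 J Q2 c, [/\ Q = I :: Q1 ++ J :: Q2,
    all (fun K : nat * nat => (K.2 <= c)%N && (K.1 < K.2)%N) (I :: Q1) &
    all (fun K : nat * nat => (c + d <= K.1)%N && (K.1 < K.2)%N) (J :: Q2)].
Proof.
elim: Q => // I [|J Q] IH //; rewrite [okchain _]/= [gaps _]/=.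
move=> /and3P[II IJ okQ]; rewrite inE => /orP[/eqP ->|dQ].
  exists I, [::], J, Q, I.2; split=> //=; first by rewrite leqnn II.
  have := okchain_starts okQ; rewrite subnKC//.
have [I' [Q1 [J' [Q2 [c [QE H1 H2]]]]]] := IH okQ dQ.
exists I, (I' :: Q1), J', Q2, c; split; [by rewrite QE| |by []].
move: H1 QE => /= /andP[/andP[h1 h2] h3] [JE _]; rewrite h1 h2 h3 II !andbT.
by move: IJ; rewrite JE => IJ; rewrite (leq_trans IJ)// (leq_trans (ltnW h2)).
Qed.

Lemma maj_center (V : paths Y -> fps R) (g : fps R) : bmf V -> (forall k, 0 <= g k) ->
  (forall w, maj (V w) g) -> forall w, maj (V w - E V) (fscale 2 g).
Proof.
move=> bV g0 H w k; have -> : fscale 2 g k = (g + g) k by rewrite coefD_fps /=; ring.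
by apply: majB => //; exact: maj_meanf.
Qed.

Lemma maj_XM l e (V : paths Y -> fps R) a n : (l < e)%N ->
  (forall w, maj (V w) (fscale a (gser ^+ n))) -> forall w,
  maj (X l e w * V w) (fscale (A0 * th ^+ (e - l).-1 * a) (gser ^+ n.+1)).
Proof.
move=> le H w; rewrite exprS -fscaleM; apply: majM; [exact: Xmaj|exact: H].
Qed.

Lemma fscale_ge0 a n k : 0 <= a -> 0 <= fscale a (gser ^+ n) k.
Proof. by move=> a0; rewrite /= mulr_ge0// gserX_ge0. Qed.

Lemma maj_chainc Q : all (fun K : nat * nat => (K.1 < K.2)%N) Q ->
  forall w, maj (chainc P X Q w) (fscale (chprod Q) (gser ^+ size Q)).
Proof.
elim: Q => [_ w|[l e] Q IH] /=.
  by rewrite /chprod big_nil fscale1 expr0; exact: maj1.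
move=> /andP[le /IH {}IH] w.
have b : bmf (fun w => X l e w * chainc P X Q w) by apply: bmfM => //; exact: bmf_chainc.
have c0 : 0 <= A0 * th ^+ (e - l).-1 * chprod Q.
  by rewrite !mulr_ge0 ?exprn_ge0 ?chprod_ge0.
have := @maj_center _ (fscale (A0 * th ^+ (e - l).-1 * chprod Q) (gser ^+ (size Q).+1)) b.
move=> /(_ (fun k => fscale_ge0 _ _ c0)) /(_ (maj_XM le IH)) /(_ w).
by congr maj; apply: fpsP => k /=; rewrite /chprod big_cons /=; ring.
Qed.

Lemma maj_prefix V Q a n : 0 <= a -> all (fun K : nat * nat => (K.1 < K.2)%N) Q -> bmf V ->
  (forall w, maj (V w) (fscale a (gser ^+ n))) ->
  forall w, maj (prefix_prod P X V Q w) (fscale (a * chprod Q) (gser ^+ (n + size Q))).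
Proof.
elim: Q V a n => [|[l e] Q IH] V a n a0 /=.
  by move=> _ _ H w; rewrite /chprod big_nil mulr1 addn0.
move=> /andP[le aQ] bV H w.
have b : bmf (fun w => V w - E V) by apply: bmfB => //; exact: bmf_cst.
have a0' : 0 <= a * (2 * A0 * th ^+ (e - l).-1) by rewrite !mulr_ge0 ?exprn_ge0.
have bb : bmf (fun w => (V w - E V) * X l e w) by exact: bmfM.
have K w0 : maj ((V w0 - E V) * X l e w0)
    (fscale (a * (2 * A0 * th ^+ (e - l).-1)) (gser ^+ n.+1)).
  have := maj_center bV (fun k => fscale_ge0 n k a0) H w0.
  move=> /majM /(_ (Xmaj w0 le)); congr maj; apply: fpsP => k.
  rewrite (_ : fscale 2 _ = fscale (2 * a) (gser ^+ n)); last by apply: fpsP => j /=; ring.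
  by rewrite fscaleM exprSr /=; ring.
have := IH _ _ n.+1 a0' aQ bb K w.
by rewrite /chprod big_cons [a * (_ * \prod_(J <- Q) _)]mulrA -addSnnS.
Qed.

Lemma past_prefix c V Q : past c V ->
  all (fun K : nat * nat => ((K.2%:Z <= c)%R && (K.1 < K.2)%N)) Q ->
  past c (prefix_prod P X V Q).
Proof.
elim: Q V => //= I Q IH V pV /andP[/andP[h1 h2] aQ]; apply: IH => // w w' ww'.
by rewrite (pV w w')//; congr (_ * _); apply: (Xpast h2) => j jI; apply: ww'; exact: le_trans jI h1.
Qed.

Lemma future_chainc c Q :
  all (fun K : nat * nat => ((c <= K.1%:Z)%R && (K.1 < K.2)%N)) Q ->
  future c (chainc P X Q).
Proof.
elim: Q => [|I Q IH] /=; first by [].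
move=> /andP[/andP[h1 h2] aQ] w w' ww'.
by rewrite (IH aQ w w')//; congr (_ * _ - _); apply: (Xfuture h2) => j jI; apply: ww'; exact: le_trans h1 jI.
Qed.

Lemma maj_covf (V Z : paths Y -> fps R) v z c n : bmf V -> bmf Z ->
  past c%:Z V -> future (c + n)%N%:Z Z ->
  (forall w, maj (V w) v) -> (forall w, maj (Z w) z) ->
  maj (covf P V Z) (fscale (C1 * mixrate n) (v * z)).
Proof.
move=> bV bZ pV fZ Vv Zz k; rewrite coef_covf// (le_trans (ler_norm_sum _ _ _))//.
rewrite [leRHS]/= mulr_sumr; apply: ler_sum => i _; rewrite mulrA.
apply: (@mixing c n) => //; [exact: (bV i).1|exact: (bZ _).1| | | |].
- by move=> w w' H; rewrite (pV w w').
- by move=> w w' H; rewrite (fZ w w').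
- by move=> w; exact: Vv.
- by move=> w; exact: Zz.
Qed.

Definition maxgap (Q : chain) := foldr maxn 0%N (gaps Q).

Lemma foldr_maxn_in (s : seq nat) : s = [::] \/ foldr maxn 0%N s \in s.
Proof.
elim: s => [|a s IH]; [by left|right => /=].
rewrite inE; case: leqP => [|_]; last by rewrite eqxx.
by case: IH => [->|->]; rewrite ?orbT//=; case: a => // ? _; rewrite eqxx.
Qed.

(** Only one covariance is available per chain, so the cut is made at the longest gap. A single
    interval has no gap and receives no mixing factor. *)
Lemma maj_chainv Q : Q != [::] -> okchain Q ->
  maj (chainv P X Q)
    (fscale (C1 * (if gaps Q is [::] then 1 else mixrate (maxgap Q)) * chprod Q)
       (gser ^+ size Q)).
Proof.
move=> Q0 okQ; have [gQ|mQ] := foldr_maxn_in (gaps Q).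
  case: Q Q0 okQ gQ => // I [|J Q] // _ /= /andP[II _] _.
  have H w : maj (X I.1 I.2 w * 1) (fscale (A0 * th ^+ (I.2 - I.1).-1 * 1) (gser ^+ 1)).
    apply: (@maj_XM _ _ (fun _ => 1) 1 0 II) => _.
    by rewrite fscale1 expr0; exact: maj1.
  have b : bmf (fun w => X I.1 I.2 w * 1) by apply: bmfM => //; exact: bmf_cst.
  have HE := @maj_meanf _ _ _ P _ _ b H.
  apply: (@maj_scale _ _ _ _ (gser ^+ 1) _ HE); last by move=> k; exact: gserX_ge0.
  rewrite /chprod big_seq1 !mulr1.
  have : 0 <= A0 * th ^+ (I.2 - I.1).-1 by rewrite mulr_ge0 ?exprn_ge0.
  rewrite -[2 * A0 * _]mulrA; move: (A0 * _) => x x0.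
  have h2 : x <= 2 * x by lra.
  by rewrite (le_trans h2)// ler_peMl// mulr_ge0.
have [I [Q1 [J [Q2 [c [QE H1 H2]]]]]] := okchain_cut okQ mQ.
have -> : (if gaps Q is [::] then 1 else mixrate (maxgap Q)) = mixrate (maxgap Q).
  by move: mQ; case: (gaps Q).
set d := maxgap Q in H2 *.
rewrite QE chainv_cut//.
have [le1 H1'] : (I.1 < I.2)%N /\ all (fun K : nat * nat => (K.1 < K.2)%N) Q1.
  by move: H1 => /= /andP[/andP[_ ->] H]; split=> //; apply: sub_all H => K /andP[].
have [le2 H2'] : (J.1 < J.2)%N /\ all (fun K : nat * nat => (K.1 < K.2)%N) Q2.
  by move: H2 => /= /andP[/andP[_ ->] H]; split=> //; apply: sub_all H => K /andP[].
have p0 a b : 0 <= A0 * th ^+ (a - b).-1 by rewrite mulr_ge0 ?exprn_ge0.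
have m1 : forall w, maj (X I.1 I.2 w) (fscale (A0 * th ^+ (I.2 - I.1).-1) (gser ^+ 1)).
  by move=> w; rewrite expr1; exact: Xmaj.
have M1 := maj_prefix (p0 _ _) H1' (bX I.1 I.2) m1.
have M2 := maj_XM le2 (maj_chainc H2').
have b1 : bmf (prefix_prod P X (X I.1 I.2) Q1) by exact: bmf_prefix.
have b2 : bmf (fun w => X J.1 J.2 w * chainc P X Q2 w) by apply: bmfM => //; exact: bmf_chainc.
have q1 : past c%:Z (prefix_prod P X (X I.1 I.2) Q1).
  apply: past_prefix.
    move=> w w' ww'; apply: (Xpast le1) => j jI; apply: ww'; apply: (le_trans jI).
    by move: H1 => /= /andP[/andP[? _] _]; rewrite lez_nat.
  by move: H1 => /= /andP[_ H]; apply: sub_all H => K /andP[? ->]; rewrite andbT lez_nat.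
have q2 : future (c + d)%N%:Z (fun w => X J.1 J.2 w * chainc P X Q2 w).
  move: H2 => /= /andP[/andP[h1 h2] H] w w' ww'; congr (_ * _).
    by apply: (Xfuture h2) => j jI; apply: ww'; apply: le_trans jI; rewrite lez_nat.
  apply: (@future_chainc (c + d)%N%:Z _ _ w w' ww').
  by apply: sub_all H => K /andP[? ->]; rewrite andbT lez_nat.
have := maj_covf b1 b2 q1 q2 M1 M2.
rewrite fscaleM -exprD => M.
rewrite (_ : size (I :: Q1 ++ J :: Q2) = (1 + size Q1 + (size Q2).+1)%N); last first.
  by rewrite /= size_cat addnS add1n addSn addnS.
rewrite (_ : fscale (C1 * mixrate d) _ = fscale (C1 * mixrate d *
   (A0 * th ^+ (I.2 - I.1).-1 * chprod Q1 * (A0 * th ^+ (J.2 - J.1).-1 * chprod Q2)))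
   (gser ^+ (1 + size Q1 + (size Q2).+1))) in M; last first.
  by apply: fpsP => k /=; rewrite mulrA.
apply: (maj_scale _ M); last by move=> k; exact: gserX_ge0.
apply: ler_wpM2l; first by rewrite mulr_ge0// (le_trans ler01).
rewrite /chprod !big_cons big_cat big_cons /= -/(chprod Q1) -/(chprod Q2).
rewrite -![2 * A0 * _]mulrA.
move: (p0 I.2 I.1) (p0 J.2 J.1) (chprod_ge0 Q1) (chprod_ge0 Q2).
move: (A0 * th ^+ _) (A0 * th ^+ _) (chprod Q1) (chprod Q2) => x y q q' x0 y0 q0 q'0.
(* The first interval of the chain and the one just after the cut are not centred: their two factors
   2 are slack. *)
rewrite (_ : 2 * y * (q * (2 * x * q')) = 4 * (y * q * (x * q'))); last by ring.
have : 0 <= y * q * (x * q') by rewrite !mulr_ge0.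
by move: (y * q * (x * q')) => z z0; lra.
Qed.

End ChainBounds.

(** * Weights of chains *)

Section GevreyBounds.
Variable R : realType.
Implicit Types (x y z c eta t : R).

(** This is x <= exp x at x = c eta z, raised to the power 1 / eta. *)
Lemma powR_le_expR eta c z : 0 < eta -> 0 < c -> 0 <= z ->
  (c * eta) `^ eta^-1 * z `^ eta^-1 <= expR (c * z).
Proof.
move=> e0 c0 z0.
have ce0 : 0 <= c * eta by rewrite mulr_ge0 ?ltW.
rewrite -powRM// (_ : c * z = (c * eta * z) * eta^-1); last by field; rewrite gt_eqF.
rewrite expRM; apply: ge0_ler_powR; rewrite ?nnegrE ?expR_ge0//.
- by rewrite invr_ge0 ltW.
- by rewrite mulr_ge0.
- by rewrite (le_trans _ (expR_ge1Dx _))// lerDr.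
Qed.

Lemma powR_root eta x : 0 < eta -> 0 <= x -> (x `^ eta) `^ eta^-1 = x.
Proof. by move=> e0 x0; rewrite -powRrM mulfV ?gt_eqF// powRr1. Qed.

Lemma powR_root' eta x : 0 < eta -> 0 <= x -> (x `^ eta^-1) `^ eta = x.
Proof. by move=> e0 x0; rewrite -powRrM mulVf ?gt_eqF// powRr1. Qed.

(** The origin of the scale p ^ (1 / eta): measured in this unit, and up to a constant, [M] is at
    most the p-th root of exp (c2 / 2 * M ^ eta), so its powers up to [p] are absorbed by half of
    the mixing rate. *)
Lemma gap_moment eta c2 (p M : nat) : 0 < eta -> 0 < c2 -> (0 < p)%N ->
  (c2 / 2 * eta) `^ eta^-1 / p%:R `^ eta^-1 * M%:R <= expR (c2 / (2 * p%:R) * M%:R `^ eta).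
Proof.
move=> e0 c0 p0; have p0' : 0 < p%:R :> R by rewrite ltr0n.
set z := M%:R `^ eta / p%:R.
have z0 : 0 <= z by rewrite divr_ge0 ?powR_ge0.
have zE : z `^ eta^-1 = M%:R / p%:R `^ eta^-1.
  have pe : p%:R `^ eta^-1 != 0 by rewrite gt_eqF ?powR_gt0.
  have zp : z * p%:R = M%:R `^ eta by rewrite /z mulrVK// unitfE gt_eqF.
  rewrite -[M%:R in RHS](powR_root e0)// -zp powRM//.
  by rewrite mulrK// unitfE.
have := @powR_le_expR eta (c2 / 2) z e0 (divr_gt0 c0 (ltr0n _ 2)) z0.
rewrite zE (_ : c2 / 2 * z = c2 / (2 * p%:R) * M%:R `^ eta); last first.
  by rewrite /z; field; rewrite gt_eqF.
by rewrite mulrA mulrAC.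
Qed.

(** Telescoping, from 1 / (a + u) ^ 2 <= 1 / (a (a + u)) = (1 / a - 1 / (a + u)) / u with a = 1 + u
    k. The induction runs on the exact telescoped value. *)
Lemma sum_inv_sqr (u : R) n : 0 < u ->
  \sum_(d < n) ((1 + u * d%:R) ^+ 2)^-1 <= 1 + u^-1.
Proof.
move=> u0; have u0' := ltW u0.
case: n => [|n']; first by rewrite big_ord0 addr_ge0 ?invr_ge0.
apply: (@le_trans _ _ (1 + u^-1 * (1 - (1 + u * n'%:R)^-1))); last first.
  by rewrite lerD2l ler_piMr ?invr_ge0// gerBl invr_ge0 addr_ge0// mulr_ge0.
elim: n' => [|k IH].
  by rewrite big_ord1 mulr0 addr0 expr1n invr1 subrr mulr0 addr0.
rewrite big_ord_recr /=.
have a0 : 0 < 1 + u * k%:R by rewrite ltr_wpDr// mulr_ge0.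
have -> : 1 + u * k.+1%:R = (1 + u * k%:R) + u by rewrite -natr1 mulrDr mulr1 addrA.
move: IH; set S := \sum_(d < k.+1) _; move: (1 + u * k%:R) a0 => a a0 IH.
have au : 0 < a + u by rewrite addr_gt0.
have H : ((a + u) ^+ 2)^-1 <= (a * (a + u))^-1.
  rewrite lef_pV2 ?posrE ?mulr_gt0 ?exprn_gt0// expr2 ler_wpM2r ?ltW//.
  by rewrite ltrDl.
have E : (a * (a + u))^-1 = u^-1 * (1 - (a + u)^-1) - u^-1 * (1 - a^-1).
  by field; rewrite !gt_eqF.
lra.
Qed.

(** With y = t ^ (1 / eta) d the summand is exp (- y ^ eta), the square of exp (- y ^ eta / 2),
    hence at most C / (1 + y) ^ 2 where C depends on [eta] only. The dependence on [t] is confined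
    to the last factor. *)
Lemma gap_sum eta t (n : nat) : 0 < eta -> 0 < t ->
  \sum_(d < n) expR (- t * d%:R `^ eta) <=
  (1 + ((2^-1 * eta) `^ eta^-1)^-1) ^+ 2 * (1 + (t `^ eta^-1)^-1).
Proof.
move=> e0 t0; set u := t `^ eta^-1; have u0 : 0 < u by rewrite powR_gt0.
set q := (2^-1 * eta) `^ eta^-1; have q0 : 0 < q by rewrite powR_gt0 ?mulr_gt0.
rewrite (le_trans _ (ler_wpM2l _ (sum_inv_sqr n u0))) ?sqr_ge0//.
rewrite mulr_sumr; apply: ler_sum => d _.
have u0' := ltW u0; set y := u * d%:R; have y0 : 0 <= y by rewrite mulr_ge0.
have zE : t * d%:R `^ eta = y `^ eta by rewrite /y powRM ?ler0n// powR_root' ?ltW.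
rewrite mulNr zE expRN; set z := y `^ eta.
have z0 : 0 <= z by exact: powR_ge0.
have := @powR_le_expR eta 2^-1 z e0 _ z0; rewrite invr_gt0 ltr0n => /(_ isT).
rewrite powR_root// -/q => H.
have h1 : 1 <= expR (2^-1 * z) by rewrite -expR0 ler_expR mulr_ge0.
have hE : expR z = expR (2^-1 * z) ^+ 2.
  by rewrite expr2 -expRD; congr expR; field.
have y1 : 0 < 1 + y by rewrite ltr_wpDr.
rewrite hE ler_pdivlMr ?exprn_gt0// mulrC ler_pdivrMr ?exprn_gt0 ?expR_gt0// -exprMn.
have q1 : 0 <= 1 + q^-1 by rewrite addr_ge0// invr_ge0 ltW.
have y1' := ltW y1.
rewrite lerXn2r ?nnegrE//; first by rewrite mulr_ge0 ?expR_ge0.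
rewrite mulrDl mul1r lerD//.
by rewrite mulrC ler_pdivlMr// mulrC.
Qed.

(** With b the p-th root of the exponential to be absorbed, the term of order s is at most (r b) ^ s
    / s! by [gap_moment]; since s <= p and b >= 1, the factor b ^ s is at most b ^ p, and the
    remaining sum is at most exp r. *)
Lemma texp_gap eta c2 d0 (p r M : nat) : 0 < eta -> 0 < c2 -> (0 < p)%N ->
  0 <= d0 -> d0 <= (c2 / 2 * eta) `^ eta^-1 ->
  expR (- (c2 / 2 * M%:R `^ eta)) * texp p (d0 / p%:R `^ eta^-1 * (r * M)%N%:R) <= expR r%:R.
Proof.
move=> e0 c0 p0 d00 d0c; have p0' : 0 < p%:R :> R by rewrite ltr0n.
rewrite (le_trans _ (@texp_le_expR R p r%:R _))// expRN mulrC ler_pdivrMr ?expR_gt0//.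
rewrite /texp mulr_suml; apply: ler_sum => s _.
set b := expR (c2 / (2 * p%:R) * M%:R `^ eta).
have b1 : 1 <= b by rewrite -expR0 ler_expR mulr_ge0 ?powR_ge0// divr_ge0 ?mulr_ge0 ?ltW.
have bp : b ^+ p = expR (c2 / 2 * M%:R `^ eta).
  by rewrite -expRM_natr; congr expR; field; rewrite gt_eqF.
have dM : d0 / p%:R `^ eta^-1 * M%:R <= b.
  apply: le_trans (gap_moment M e0 c0 p0).
  by rewrite !ler_wpM2r ?invr_ge0 ?powR_ge0.
rewrite [leRHS]mulrAC; apply: ler_wpM2r; first by rewrite invr_ge0.
rewrite -bp natrM mulrCA exprMn; apply: ler_wpM2l; first by rewrite exprn_ge0.
apply: (@le_trans _ _ (b ^+ s)); last by apply: ler_weXn2l => //; rewrite -ltnS.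
by rewrite lerXn2r ?nnegrE ?expR_ge0// mulr_ge0// divr_ge0 ?powR_ge0.
Qed.

End GevreyBounds.

Section ChainSums.
Variable R : realType.

Lemma chsumMr (f : seq (nat * nat) -> fps R) (c : fps R) fuel a Q :
  chsum fuel a Q f * c = chsum fuel a Q (fun Q => f Q * c).
Proof.
elim: fuel a Q => [|n IH] a Q /=; first by rewrite mul0r.
rewrite mulr_suml; apply: eq_bigr => e _; rewrite mulr_suml; apply: eq_bigr => l _.
by rewrite mulrDl IH.
Qed.

Lemma nrm_chsum (r : R) p (f : seq (nat * nat) -> fps R) fuel a Q : 0 <= r ->
  nrm r p (chsum fuel a Q f) <= chsum fuel a Q (fun Q => nrm r p (f Q)).
Proof.
move=> r0; elim: fuel a Q => [|n IH] a Q /=; first by rewrite nrm0.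
rewrite (le_trans (nrm_sum _ r0 _ _))//; apply: ler_sum => e _.
rewrite (le_trans (nrm_sum _ r0 _ _))//; apply: ler_sum => l _.
by rewrite (le_trans (nrmD _ r0 _ _))// lerD2l IH.
Qed.

Lemma sum_geometric_le (x : R) n : 0 <= x < 1 -> \sum_(i < n) x ^+ i <= (1 - x)^-1.
Proof.
move=> /andP[x0 x1]; have h : 0 < 1 - x by rewrite subr_gt0.
rewrite -[leRHS]mul1r ler_pdivlMr// mulrC.
have -> : (1 - x) * \sum_(i < n) x ^+ i = 1 - x ^+ n by rewrite -opprB mulNr -subrX1 opprB.
by rewrite gerBl exprn_ge0.
Qed.

End ChainSums.

Section ChainWeights.
Variable R : realType.
Variables A0 A th C1 c2 eta : R.
Hypotheses (A00 : 0 < A0) (A_gt0 : 0 < A) (th0 : 0 < th) (th1 : th < 1) (C11 : 1 <= C1).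
Hypotheses (c20 : 0 < c2) (eta0 : 0 < eta).

Notation chain := (seq (nat * nat)).

(* [gapc] and [intc] are, up to powers of [pgam] and [radius], the total weights
   of a gap and of an interval of a chain; [radius0] makes their product small.
   The three terms of [slope0] serve to bound the norm of a cumulant by 1, to
   absorb [exp (slope * d)] in the mixing rate on a gap of length [d], and to
   absorb it in the exponential decay on an interval. *)
Definition gapc := (1 + ((2^-1 * eta) `^ eta^-1)^-1) ^+ 2 * (1 + ((c2 / 2) `^ eta^-1)^-1).
Definition slope0 := Num.min 1 (Num.min ((c2 / 2 * eta) `^ eta^-1) (ln ((1 + th) / (2 * th)))).
Definition intc := 4 * A0 * A * expR 1 * expR 1 * (2 / (1 - th)).
Definition radius0 := Num.min (2 * A)^-1
  (Num.min (2 * intc * gapc)^-1 (slope0 / (4 * C1 * intc))).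

Lemma gapc_gt0 : 0 < gapc.
Proof.
have q (x : R) : 0 < x -> 0 < (x `^ eta^-1)^-1 by move=> x0; rewrite invr_gt0 powR_gt0.
by rewrite mulr_gt0 ?exprn_gt0// addr_gt0 ?q ?divr_gt0 ?mulr_gt0.
Qed.

Lemma intc_gt0 : 0 < intc.
Proof. by rewrite /intc !mulr_gt0 ?expR_gt0// invr_gt0 subr_gt0. Qed.

Lemma slope0_gt0 : 0 < slope0.
Proof.
rewrite !lt_min ltr01 powR_gt0 ?mulr_gt0//= ln_gt0// ltr_pdivlMr ?mulr_gt0//.
by rewrite mul1r; move: th1; lra.
Qed.

Lemma radius0_gt0 : 0 < radius0.
Proof.
have C10 : 0 < C1 by exact: lt_le_trans ltr01 C11.
have ic := intc_gt0; have gc := gapc_gt0; have s0 := slope0_gt0.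
have q (x y : R) : 0 < x -> 0 < y -> 0 < (x * y)^-1 by move=> *; rewrite invr_gt0 mulr_gt0.
rewrite /radius0 !lt_min; apply/andP; split; first exact: q.
apply/andP; split; first by apply: q => //; apply: mulr_gt0.
by apply: mulr_gt0 => //; apply: q => //; apply: mulr_gt0.
Qed.

Variable p : nat.
Hypothesis p0 : (0 < p)%N.
(* Spread over the [p] factors of a chain, the mixing rate is only
   [exp (- c2 * d ^ eta / (2 * p))], whose sum over [d] grows like [p ^ eta^-1]. *)
Definition pgam := p%:R `^ eta^-1.
Definition slope := slope0 / pgam.
Definition radius := radius0 / pgam.
Local Notation pg := pgam.
Local Notation del := slope.
Local Notation rho := radius.

Lemma pgam_ge1 : 1 <= pg.
Proof.
have {1}-> : 1 = 1 `^ eta^-1 :> R by rewrite powR1.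
apply: ge0_ler_powR; rewrite ?nnegrE ?ler1n//.
by rewrite invr_ge0 ltW.
Qed.
Lemma pgam_gt0 : 0 < pg. Proof. exact: lt_le_trans pgam_ge1. Qed.
Lemma slope_ge0 : 0 <= del. Proof. by rewrite divr_ge0 // ltW // ?slope0_gt0 ?pgam_gt0. Qed.
Lemma radius_ge0 : 0 <= rho. Proof. by rewrite divr_ge0 // ltW // ?radius0_gt0 ?pgam_gt0. Qed.
Lemma slope_le : del <= slope0.
Proof. by rewrite ler_pdivrMr ?pgam_gt0// ler_peMr ?pgam_ge1// ltW// slope0_gt0. Qed.
Lemma radius_le : rho <= radius0.
Proof. by rewrite ler_pdivrMr ?pgam_gt0// ler_peMr ?pgam_ge1// ltW// radius0_gt0. Qed.

Ltac nneg := repeat first [assumption | exact: radius_ge0 | exact: slope_ge0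
  | exact: expR_ge0 | (apply: ltW; assumption) | exact: ler0n | exact: ler01
  | exact: powR_ge0 | apply: exprn_ge0 | apply: mulr_ge0 | apply: texp_ge0].

(** The third term of [slope0] gives [th * expR slope <= th'], so the growth exp (slope * a) on an
    interval of length a is absorbed. Of the two factors [expR 1] of [intw], one bounds
    [expR slope], left over because [th] is raised to a - 1 only, and the other is the contribution
    of one interval to the bound in [texp_gap]. *)
Let th' := (1 + th) / 2.
Definition intw (a : nat) := 4 * A0 * A * expR 1 * expR 1 * rho * th' ^+ a.-1.
Definition gapw (d : nat) := expR (- (c2 / (2 * p%:R)) * d%:R `^ eta).
Definition chainw (Q : chain) :=
  C1 * \prod_(J <- Q) intw (J.2 - J.1) * \prod_(d <- gaps Q) gapw d.

Let th'0 : 0 < th'. Proof. by rewrite /th'; move: th0 th1; lra. Qed.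
Let th'1 : th' < 1. Proof. by rewrite /th'; move: th0 th1; lra. Qed.

Lemma intw_ge0 a : 0 <= intw a.
Proof.
by rewrite /intw; nneg.
Qed.

Lemma chainw_ge0 Q : 0 <= chainw Q.
Proof.
have C10 : 0 <= C1 by exact: le_trans ler01 C11.
by rewrite /chainw; apply: mulr_ge0; [apply: mulr_ge0 => //|];
  apply: prodr_ge0 => i _; [exact: intw_ge0|exact: expR_ge0].
Qed.

Lemma sum_intw n : \sum_(l < n) intw (n - l) <= intc * rho.
Proof.
rewrite (reindex_inj rev_ord_inj) /=.
have -> : \sum_(l < n) intw (n - (n - l.+1)) =
    4 * A0 * A * expR 1 * expR 1 * rho * \sum_(l < n) th' ^+ l.
  rewrite mulr_sumr; apply: eq_bigr => l _; rewrite /intw; congr (_ * _ ^+ _).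
  by rewrite subKn.
rewrite /intc (_ : 4 * A0 * A * expR 1 * expR 1 * (2 / (1 - th)) * rho =
  4 * A0 * A * expR 1 * expR 1 * rho * (2 / (1 - th))); last by ring.
have [th0' th1'] := (th0, th1).
apply: ler_wpM2l; first by nneg.
rewrite (le_trans (sum_geometric_le _ _))//; first by rewrite (ltW th'0).
rewrite (_ : (1 - th')^-1 = 2 / (1 - th))// /th'; field.
by rewrite !gt_eqF//; lra.
Qed.

Lemma sum_gapw n : \sum_(d < n) gapw d <= gapc * pg.
Proof.
have t0 : 0 < c2 / (2 * p%:R) by rewrite divr_gt0// mulr_gt0// ltr0n.
apply: le_trans (gap_sum n eta0 t0) _; rewrite /gapc -mulrA.
apply: ler_wpM2l; first exact: sqr_ge0.
have -> : ((c2 / (2 * p%:R)) `^ eta^-1)^-1 = ((c2 / 2) `^ eta^-1)^-1 * pg.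
  have pe : pg != 0 by rewrite gt_eqF// pgam_gt0.
  have c2p : (c2 / (2 * p%:R)) `^ eta^-1 * pg = (c2 / 2) `^ eta^-1.
    rewrite /pg -powRM ?ler0n ?ltW//; congr (_ `^ _); field.
    by rewrite gt_eqF// ltr0n.
  have c2n : (c2 / 2) `^ eta^-1 != 0 by rewrite gt_eqF// powR_gt0// divr_gt0.
  by rewrite -c2p [(_ * pg)^-1]invfM -mulrA mulVf// mulr1.
by rewrite mulrDl mul1r lerD2r; exact: pgam_ge1.
Qed.

Lemma nrm_gser : A * rho <= 2^-1 -> nrm rho p (gser A) <= 2 * A * rho.
Proof.
move=> H; have x0 : 0 <= A * rho by nneg.
rewrite /nrm big_ord_recl /= normr0 mul0r add0r.
rewrite (eq_bigr (fun i : 'I_p => A * rho * (A * rho) ^+ i)); last first.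
  move=> i _; rewrite /bump /= add1n ger0_norm ?exprn_ge0 ?ltW// -exprMn.
  by rewrite exprS.
rewrite -mulr_sumr (_ : 2 * A * rho = A * rho * 2); last by ring.
apply: ler_wpM2l => //.
rewrite (le_trans (sum_geometric_le _ _))//; first by rewrite x0/=; lra.
by rewrite -[leRHS]invrK lef_pV2 ?posrE//; lra.
Qed.

Lemma intw_bound a : (0 < a)%N ->
  2 * A0 * th ^+ a.-1 * (2 * A * rho) * expR (del * a%:R) * expR 1 <= intw a.
Proof.
case: a => // a _; rewrite -[a.+1%:R]natr1 [a.+1.-1]/= [del * _]mulrDr mulr1 expRD expRM_natr.
rewrite (_ : _ * expR 1 = 4 * A0 * A * expR 1 * rho * expR del * (th * expR del) ^+ a);
  last by rewrite exprMn; ring.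
have e1 : expR del <= expR 1.
  by rewrite ler_expR (le_trans slope_le)// ge_min lexx.
have e2 : th * expR del <= th'.
  have q0 : 0 < (1 + th) / (2 * th) by rewrite divr_gt0 ?addr_gt0 ?mulr_gt0.
  have : expR del <= (1 + th) / (2 * th).
    rewrite -[leRHS]lnK ?posrE// ler_expR (le_trans slope_le)//.
    by rewrite !ge_min lexx !orbT.
  rewrite -(ler_pM2l th0) => /le_trans; apply.
  by rewrite /th' le_eqVlt; apply/orP; left; apply/eqP; field; rewrite gt_eqF.
rewrite /intw (_ : 4 * A0 * A * expR 1 * rho * expR del * _ =
   4 * A0 * A * expR 1 * rho * (expR del * (th * expR del) ^+ a)); last by ring.
rewrite (_ : 4 * A0 * A * expR 1 * expR 1 * rho * _ =
   4 * A0 * A * expR 1 * rho * (expR 1 * th' ^+ a)); last by rewrite /=; ring.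
apply: ler_wpM2l; first by nneg.
have t0 : 0 <= th * expR del by nneg.
by apply: ler_pM => //; [nneg|apply: lerXn2r => //; rewrite nnegrE ltW].
Qed.

Lemma okchain_span J Q : okchain (J :: Q) ->
  (last J Q).2 = (J.1 + (\sum_(K <- J :: Q) (K.2 - K.1) + \sum_(d <- gaps (J :: Q)) d))%N.
Proof.
elim: Q J => [|K Q IH] J.
  by rewrite [okchain _]/= big_seq1 big_nil addn0 => /andP[JJ _]; rewrite subnKC// ltnW.
rewrite [okchain _]/= => /and3P[JJ JK okQ].
have := IH _ okQ; rewrite [gaps (J :: _)]/= -/(gaps (K :: Q)) [last J _]/= => ->.
have E1 : (\sum_(I <- [:: J, K & Q]) (I.2 - I.1) = (J.2 - J.1) + \sum_(I <- K :: Q) (I.2 - I.1))%N.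
  by rewrite big_cons.
have E2 : (\sum_(d <- K.1 - J.2 :: gaps (K :: Q)) d = K.1 - J.2 + \sum_(d <- gaps (K :: Q)) d)%N.
  by rewrite big_cons.
rewrite E1 E2; move: JJ JK; clear; lia.
Qed.

Lemma size_gaps Q : (size (gaps Q) <= size Q)%N.
Proof. by elim: Q => // J [|K Q] IH //; rewrite [gaps _]/= [size (_ :: _)]/= ltnS. Qed.

Lemma sum_gaps_le Q : (\sum_(d <- gaps Q) d <= size Q * maxgap Q)%N.
Proof.
apply: (@leq_trans (size (gaps Q) * maxgap Q)); last by rewrite leq_mul2r size_gaps orbT.
rewrite /maxgap; elim: (gaps Q) => [|d s IH]; first by rewrite big_nil.
rewrite big_cons /= mulSn leq_add ?leq_maxl// (leq_trans IH)// leq_mul2l leq_maxr.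
by rewrite orbT.
Qed.

(** The rate of the longest gap is the p-th power of the weight of that gap. All weights are at most
    1, at most [p] gaps occur, and a shorter gap has a larger weight. *)
Lemma gapw_prod (s : seq nat) : (size s <= p)%N ->
  expR (- (c2 / 2 * (foldr maxn 0%N s)%:R `^ eta)) <= \prod_(d <- s) gapw d.
Proof.
move=> sp; set M := foldr maxn 0%N s.
have p0' : 0 < p%:R :> R by rewrite ltr0n.
set z := expR (- (c2 / (2 * p%:R)) * M%:R `^ eta).
have -> : expR (- (c2 / 2 * M%:R `^ eta)) = z ^+ p.
  by rewrite -expRM_natr; congr expR; field; rewrite gt_eqF.
have z1 : z <= 1.
  rewrite -expR0 ler_expR mulNr oppr_le0 mulr_ge0 ?powR_ge0//.
  by rewrite divr_ge0 ?ltW// mulr_gt0.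
have z0 : 0 <= z by exact: expR_ge0.
apply: (@le_trans _ _ (z ^+ size s)); first exact: ler_wiXn2l.
have : all (fun d => d <= M)%N s.
  rewrite /M; elim: (s) => //= d s' IH; rewrite leq_maxl /=.
  by apply: sub_all IH => x /leq_trans; apply; exact: leq_maxr.
elim: (s) => [|d s' IH] /=; first by rewrite big_nil.
move=> /andP[dM /IH {}IH].
have h : z <= gapw d.
  rewrite /z /gapw ler_expR !mulNr lerN2; apply: ler_wpM2l.
    by rewrite divr_ge0 ?ltW// mulr_gt0.
  by apply: ge0_ler_powR; rewrite ?nnegrE ?ler0n ?ler_nat//; exact: ltW.
by rewrite big_cons exprS; exact: ler_pM z0 (exprn_ge0 _ z0) h IH.
Qed.

End ChainWeights.

(** * Cumulants of a recursion *)

Section CumulantSeries.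
Context dY (Y : measurableType dY) (R : realType).
Variable P : probability (paths Y) R.
Variable X : nat -> nat -> paths Y -> fps R.
Hypothesis bX : forall l e, bmf (X l e).
Variables A0 A th C1 c2 eta : R.
Hypotheses (A00 : 0 < A0) (A_gt0 : 0 < A) (th0 : 0 < th) (th1 : th < 1) (C11 : 1 <= C1).
Hypotheses (c20 : 0 < c2) (eta0 : 0 < eta).
Let mixrate (n : nat) := expR (- c2 * n%:R `^ eta).

Hypothesis Xmaj : forall l e w, (l < e)%N ->
  maj (X l e w) (fscale (A0 * th ^+ (e - l).-1) (gser A)).
Hypothesis Xpast : forall l e, (l < e)%N -> past e%:Z (X l e).
Hypothesis Xfuture : forall l e, (l < e)%N -> future l%:Z (X l e).
Hypothesis mixing : forall (c n : nat) (f g : paths Y -> R) (F G : R),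
  measurable_fun setT f -> measurable_fun setT g ->
  past c%:Z f -> future (c + n)%N%:Z g ->
  (forall w, `|f w| <= F) -> (forall w, `|g w| <= G) ->
  `|cov P f g| <= C1 * mixrate n * F * G.

Notation E := (meanf P).
Notation chain := (seq (nat * nat)).

Variable p : nat.
Hypothesis p0 : (0 < p)%N.
Local Notation del := (slope th c2 eta p).
Local Notation rho := (radius A0 A th C1 c2 eta p).
Local Notation intw := (intw A0 A th C1 c2 eta p).
Local Notation gapw := (gapw c2 eta p).
Local Notation chainw := (chainw A0 A th C1 c2 eta p).
Let rho0 : 0 <= rho. Proof. exact: radius_ge0. Qed.
Let del0 : 0 <= del. Proof. exact: slope_ge0. Qed.
Let C10 : 0 <= C1. Proof. exact: le_trans ler01 C11. Qed.
Ltac nn := repeat first [assumption | exact: rho0 | exact: del0 | exact: C10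
  | exact: expR_ge0 | (apply: ltW; assumption) | exact: ler0n | exact: ler01
  | exact: powR_ge0 | apply: exprn_ge0 | apply: mulr_ge0 | apply: texp_ge0].

(** The factor [texp] is the growth that the division by [E (G e)] will cost over the span of the
    chain. Over the gaps it is absorbed by one half of the mixing rate, over the intervals by their
    exponential decay; the other half of the mixing rate is distributed among the gaps. *)
Lemma chain_estimate J Q : okchain (J :: Q) ->
  nrm rho p (chainv P X (J :: Q)) * texp p (del * ((last J Q).2 - J.1)%N%:R) <=
  chainw (J :: Q).
Proof.
move=> ok; set Q' := J :: Q.
have M := maj_chainv bX (ltW A00) (ltW A_gt0) (ltW th0) C11
  (fun n => expR_ge0 _) Xmaj Xpast Xfuture mixing (isT : Q' != [::]) ok.
have := nrm_maj p rho0 M; rewrite nrm_fscale -/Q' => N.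
have Arho : A * rho <= 2^-1.
  have : rho <= (2 * A)^-1.
    apply: le_trans (radius_le A00 A_gt0 th0 th1 C11 c20 eta0 p0) _.
    by rewrite /radius0 ge_min lexx.
  rewrite -(ler_pM2l A_gt0) => /le_trans; apply.
  by rewrite invfM mulrCA mulfV ?mulr1// gt_eqF.
(* A chain of more than [p] intervals has no coefficient of degree at most [p]. *)
have [pQ|Qp] := ltnP p (size Q').
  suff -> : nrm rho p (chainv P X Q') = 0 by rewrite mul0r; exact: chainw_ge0.
  apply/eqP; rewrite eq_le nrm_ge0// andbT (le_trans N)//.
  rewrite [nrm _ _ (gser A ^+ _)]big1 ?mulr0// => i _.
  by rewrite coef_lowX ?normr0 ?mul0r// (leq_ltn_trans _ pQ)// -ltnS.
set m := (if gaps Q' is [::] then 1 else _) in N.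
have m0 : 0 <= m by rewrite /m; case: (gaps Q') => *; rewrite ?ler01// expR_ge0.
have cp0 : 0 <= chprod A0 th Q' by apply: chprod_ge0; exact: ltW.
rewrite ger0_norm in N; last by nn.
have NX : nrm rho p (gser A ^+ size Q') <= (2 * A * rho) ^+ size Q'.
  apply: le_trans (nrmX p rho0 _ _) _; apply: lerXn2r.
  - by rewrite nnegrE nrm_ge0.
  - by rewrite nnegrE; nn.
  - exact: (nrm_gser A00 A_gt0 th0 th1 C11 c20 eta0 p0).
have {}N : nrm rho p (chainv P X Q') <= C1 * m * chprod A0 th Q' * (2 * A * rho) ^+ size Q'.
  by apply: le_trans N _; apply: ler_wpM2l NX; nn.
set SA := (\sum_(K <- Q') (K.2 - K.1))%N.
set SD := (\sum_(d <- gaps Q') d)%N.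
have -> : ((last J Q).2 - J.1)%N = (SA + SD)%N by rewrite (okchain_span ok) addKn.
have T : texp p (del * (SA + SD)%N%:R) <=
    expR (del * SA%:R) * texp p (del * (size Q' * maxgap Q')%N%:R).
  rewrite natrD mulrDr; apply: le_trans (texpD p _ _) _; [nn|nn|].
  apply: ler_pM; [nn|nn| |]; first by apply: texp_le_expR; nn.
  apply: ler_texp; first by nn.
  by apply: ler_wpM2l => //; rewrite ler_nat sum_gaps_le.
have GP : m * texp p (del * (size Q' * maxgap Q')%N%:R) <=
    \prod_(d <- gaps Q') gapw d * expR (size Q')%:R.
  have dc : slope0 th c2 eta <= (c2 / 2 * eta) `^ eta^-1 by rewrite !ge_min lexx !orbT.
  have TG := texp_gap (size Q') (maxgap Q') eta0 c20 p0 (ltW (slope0_gt0 th0 th1 c20 eta0)) dc.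
  have GW := gapw_prod c20 eta0 p0 (leq_trans (size_gaps Q') Qp).
  have mE : m <= expR (- (c2 / 2 * (maxgap Q')%:R `^ eta)) *
                expR (- (c2 / 2 * (maxgap Q')%:R `^ eta)).
    rewrite -expRD /m /maxgap; case: (gaps Q') => [|d s]; last first.
      by rewrite ler_expR le_eqVlt; apply/orP; left; apply/eqP; rewrite /=; field.
    by rewrite /= powR0 ?gt_eqF// mulr0 oppr0 addr0 expR0.
  have T0 : 0 <= texp p (del * (size Q' * maxgap Q')%N%:R) by nn.
  apply: le_trans (ler_wpM2r T0 mE) _; rewrite -[leLHS]mulrA.
  by apply: ler_pM => //; nn.
have IP : chprod A0 th Q' * (2 * A * rho) ^+ size Q' * expR (del * SA%:R) *
    expR (size Q')%:R <= \prod_(K <- Q') intw (K.2 - K.1).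
  have : all (fun K : nat * nat => (K.1 < K.2)%N) Q'.
    by have := okchain_starts ok; apply: sub_all => K /andP[].
  rewrite /SA /chprod; elim: (Q') => [|K s IH] /=.
    by rewrite !big_nil mulr0 !expR0 expr0 !mulr1.
  move=> /andP[KK /IH {}IH]; rewrite !big_cons natrD [del * _]mulrDr -[(size s).+1%:R]natr1 !expRD exprS.
  have K0 : (0 < K.2 - K.1)%N by rewrite subn_gt0.
  have L0 : 0 <= (2 * A0 * th ^+ (K.2 - K.1).-1 * (2 * A * rho) *
     expR (del * (K.2 - K.1)%:R) * expR 1).
    by nn.
  set s1 := (\prod_(j <- s) _) in IH *.
  have L1 : 0 <= s1 * (2 * A * rho) ^+ size s * expR (del * (\sum_(K <- s) (K.2 - K.1))%N%:R) * expR (size s)%:R.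
    have s10 : 0 <= s1 by apply: prodr_ge0 => i _; nn.
    by nn.
  apply: le_trans (ler_pM L0 L1 (intw_bound A00 A_gt0 th0 th1 C11 c20 eta0 p0 K0) IH).
  by rewrite le_eqVlt; apply/orP; left; apply/eqP; ring.
have T0 : 0 <= texp p (del * (SA + SD)%N%:R) by nn.
have X0 : 0 <= (2 * A * rho) ^+ size Q' by nn.
rewrite (le_trans (ler_wpM2r T0 N))//.
have := ler_wpM2l (mulr_ge0 (mulr_ge0 (mulr_ge0 C10 m0) cp0) X0) T => /le_trans; apply.
rewrite /chainw; set pr := \prod_(K <- Q') _; set pw := \prod_(d <- _) _.
have pw0 : 0 <= pw by apply: prodr_ge0 => *; exact: expR_ge0.
set u := texp _ _ in GP *; set v := chprod _ _ _ in IP *.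
have E0 : 0 <= expR (size Q')%:R :> R by exact: expR_ge0.
have vz0 : 0 <= C1 * (v * (2 * A * rho) ^+ size Q' * expR (del * SA%:R)).
  by nn.
apply: (@le_trans _ _ (C1 * (v * (2 * A * rho) ^+ size Q' * expR (del * SA%:R)) *
   (pw * expR (size Q')%:R))).
  apply: le_trans (ler_wpM2l vz0 GP).
  by rewrite le_eqVlt; apply/orP; left; apply/eqP; ring.
apply: (@le_trans _ _ (C1 * pw * (v * (2 * A * rho) ^+ size Q' * expR (del * SA%:R) * expR (size Q')%:R))).
  by rewrite le_eqVlt; apply/orP; left; apply/eqP; ring.
apply: le_trans (ler_wpM2l (mulr_ge0 C10 pw0) IP) _.
by rewrite mulrAC.
Qed.

(** Adding one interval multiplies the weight by [intw * gapw], whose sum over all positions is at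
    most 1/2 by the choice of [radius0]. An extended chain counts twice, once for itself and once
    for all its further extensions, which gives total 1. The condition on [last] records that the
    right end never moves. *)
Lemma chsum_le (f : chain -> R) fuel J Q : okchain (J :: Q) ->
  (forall K Q', okchain (K :: Q') -> (last K Q').2 = (last J Q).2 -> f (K :: Q') <= chainw (K :: Q')) ->
  chsum fuel J.1 (J :: Q) f <= chainw (J :: Q).
Proof.
elim: fuel J Q => [|n IH] J Q ok Hf /=; first exact: chainw_ge0.
apply: (@le_trans _ _ (\sum_(e < J.1) \sum_(l < e.+1)
    2 * (intw (e.+1 - l) * (gapw (J.1 - e.+1) * chainw (J :: Q))))).
  apply: ler_sum => -[e eJ] _; apply: ler_sum => -[l le] _ /=.
  set Q1 := (l, e.+1) :: J :: Q.
  have ok1 : okchain Q1 by move: ok; rewrite /Q1 /= le eJ.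
  have -> : intw (e.+1 - l) * (gapw (J.1 - e.+1) * chainw (J :: Q)) = chainw Q1.
    by rewrite /chainw /Q1 [gaps (_ :: J :: Q)]/= -/(gaps (J :: Q)) !big_cons /=; ring.
  rewrite (_ : 2 * chainw Q1 = chainw Q1 + chainw Q1); last by ring.
  apply: lerD; first by apply: Hf.
  by apply: (IH (l, e.+1)) => // K Q' okK lK; apply: Hf => //; rewrite lK.
have W0 : 0 <= chainw (J :: Q) by exact: chainw_ge0.
have -> : \sum_(e < J.1) \sum_(l < e.+1)
    2 * (intw (e.+1 - l) * (gapw (J.1 - e.+1) * chainw (J :: Q))) =
  chainw (J :: Q) * (2 * \sum_(e < J.1) gapw (J.1 - e.+1) * \sum_(l < e.+1) intw (e.+1 - l)).
  rewrite !mulr_sumr; apply: eq_bigr => e _; rewrite !mulr_sumr.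
  by apply: eq_bigr => l _; ring.
apply: ler_piMr => //.
have g0 d : 0 <= gapw d by exact: expR_ge0.
have i0 := intc_gt0 A00 A_gt0 th1.
apply: (@le_trans _ _ (2 * ((gapc c2 eta * pgam eta p) * (intc A0 A th * rho)))).
  apply: ler_wpM2l => //.
  apply: (@le_trans _ _ (\sum_(e < J.1) gapw (J.1 - e.+1) * (intc A0 A th * rho))).
    by apply: ler_sum => e _; apply: ler_wpM2l => //; exact: sum_intw.
  rewrite -mulr_suml; apply: ler_wpM2r; first by nn.
  by rewrite (reindex_inj rev_ord_inj) /=; under eq_bigr => e _ do rewrite subnSK// subKn 1?ltnW//;
    exact: sum_gapw.
have gc := gapc_gt0 c20 eta0.
have pg0 := pgam_gt0 eta0 p0.
rewrite /radius (_ : 2 * _ = (2 * intc A0 A th * gapc c2 eta) * radius0 A0 A th C1 c2 eta); last first.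
  by field; rewrite gt_eqF.
have icgc : 0 < 2 * intc A0 A th * gapc c2 eta by apply: mulr_gt0 => //; apply: mulr_gt0.
have : radius0 A0 A th C1 c2 eta <= (2 * intc A0 A th * gapc c2 eta)^-1.
  by rewrite /radius0 !ge_min lexx !orbT.
by rewrite -(ler_pM2l icgc) mulfV ?gt_eqF.
Qed.

Variable G : nat -> paths Y -> fps R.
Hypothesis bG : forall e, bmf (G e).
Hypothesis G0 : forall w, G 0 w = 1.
Hypothesis GS : forall e w, G e.+1 w = G e w + \sum_(l < e.+1) X l e.+1 w * G l w.

(** The logarithm of F e, accumulated from the logarithms of successive quotients: each quotient is
    close to 1 in norm, as [nrm_flog] demands, while F e itself need not be. *)
Fixpoint cumulant (F : nat -> fps R) (e : nat) : fps R :=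
  if e is e'.+1 then cumulant F e' + flog (F e * fexp (- cumulant F e') - 1) else 0.

Let F e := E (G e).
Let kap := cumulant F.

Lemma cumulant0 e : kap e 0%N = 0.
Proof. by elim: e => // e IH; rewrite /kap [cumulant _ _]/= coefD_fps flog0 -/kap IH addr0. Qed.

Lemma mean_G0 e : F e 0%N = 1.
Proof.
rewrite /F /= -[RHS](mean_cst P); congr mean; apply/funext => w.
have X0 l e' : (l < e')%N -> X l e' w 0%N = 0.
  move=> le; have := Xmaj w le 0%N; rewrite /= mulr0 => H.
  by apply/eqP; rewrite -normr_le0.
elim/ltn_ind: e => -[_|e IH]; first by rewrite G0.
rewrite GS coefD_fps IH// coef_sum_fps big1 ?addr0// => l _.
by rewrite coefM0_fps X0 ?mul0r.
Qed.

Lemma fexp_cumulant e : F e = fexp (kap e).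
Proof.
elim: e => [|e IH].
  rewrite /F (_ : G 0 = fun _ => 1); last by apply/funext.
  by rewrite meanf_cst /kap /= fexp_0.
rewrite /kap [cumulant _ _]/= -/kap fexpD ?cumulant0 ?flog0//.
rewrite fexp_flog.
  by rewrite addrC subrK mulrCA fexpK ?cumulant0// mulr1.
by rewrite coefB_fps coefM0_fps mean_G0 fexp0 coef1_fps mulr1 subrr.
Qed.

Lemma cumulant_eq e : F e.+1 = F e -> kap e.+1 = kap e.
Proof.
move=> H; rewrite /kap [cumulant _ _]/= -/kap H fexp_cumulant fexpK ?cumulant0// subrr.
suff -> : flog (0 : fps R) = 0 by rewrite addr0.
apply: fpsP => n /=; rewrite big_ord_recl invr0 mulr0 mul0r add0r big1// => i _.
by rewrite lift0 (expr0n _ i.+1) mulr0.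
Qed.

(* By induction the ratio of the means of [G l] and [G e] has norm at most
   [texp p (del * (e - l))], which the weights of the chains ending at [e.+1] absorb. *)
Lemma nrm_cumulant_step e : nrm rho p (kap e.+1 - kap e) <= del.
Proof.
elim/ltn_ind: e => e IH.
have diff l : (l <= e)%N -> nrm rho p (kap l - kap e) <= del * (e - l)%N%:R.
  move=> le; have -> : kap l - kap e = - (\sum_(l <= i < e) (kap i.+1 - kap i)).
    by rewrite telescope_sumr// opprB.
  rewrite nrmN (le_trans (nrm_sum _ rho0 _ _))//.
  rewrite -[X in X%:R]card_ord -sumr_const mulr_sumr.
  rewrite big_nat_cond; apply: (@le_trans _ _ (\sum_(l <= i < e | (l <= i < e)%N && true) del)).
    by apply: ler_sum => i /andP[/andP[_ ie] _]; exact: IH.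
  rewrite -big_nat_cond sumr_const_nat sumr_const card_ord mulr1.
  by [].
set y := F e.+1 * fexp (- kap e) - 1.
have -> : kap e.+1 - kap e = flog y by rewrite /kap [cumulant _ e.+1]/= addrAC subrr add0r.
have y0 : y 0%N = 0.
  by rewrite coefB_fps coefM0_fps mean_G0 fexp0 coef1_fps mulr1 subrr.
pose f (Q : chain) := chain_term P X G Q * fexp (- kap e).
have fle K Q : okchain (K :: Q) -> (last K Q).2 = e.+1 ->
    nrm rho p (f (K :: Q)) <= chainw (K :: Q).
  move=> ok lK; have sp := okchain_span ok.
  have Ke : (K.1 <= e)%N.
    move: ok sp; rewrite lK big_cons [okchain _]/= => /andP[].
    by move: (\sum_(d <- gaps _) _)%N (\sum_(j <- Q) _)%N; clear; lia.
  apply: le_trans (chain_estimate ok); rewrite lK.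
  rewrite /f /chain_term -mulrA [head _ _]/= -/(F K.1) fexp_cumulant -fexpD ?coefN_fps ?cumulant0 ?oppr0//.
  apply: le_trans (nrmM _ rho0 _ _) _; apply: ler_wpM2l; first exact: nrm_ge0.
  apply: le_trans (nrm_fexp _ _ _) _ => //; first by rewrite coefB_fps !cumulant0 subrr.
  apply: ler_texp; first exact: nrm_ge0.
  apply: le_trans (diff _ Ke) _; apply: ler_wpM2l => //.
  by rewrite ler_nat leq_sub2r.
have yE : y = \sum_(l < e.+1) (f [:: (val l, e.+1)] + chsum e l [:: (val l, e.+1)] f).
  rewrite /y /F (mean_recursion _ bX bG G0 GS) -/(F e) mulrDl {1}fexp_cumulant fexpK ?cumulant0//.
  rewrite addrC addKr mulr_suml; apply: eq_bigr => l _.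
  by rewrite mulrDl chsumMr.
have yle : nrm rho p y <= del / 2.
  rewrite yE; apply: le_trans (nrm_sum _ rho0 _ _) _.
  apply: (@le_trans _ _ (\sum_(l < e.+1) 2 * (C1 * intw (e.+1 - l)))).
    apply: ler_sum => -[l le] _ /=.
    have ok1 : okchain [:: (l, e.+1)] by rewrite /= le.
    rewrite (_ : 2 * _ = chainw [:: (l, e.+1)] + chainw [:: (l, e.+1)]); last first.
      by rewrite /chainw /= big_seq1 big_nil; ring.
    apply: le_trans (nrmD _ rho0 _ _) _; apply: lerD; first exact: fle.
    apply: le_trans (nrm_chsum _ _ _ _ _ rho0) _.
    by apply: (@chsum_le _ _ (l, e.+1) [::] ok1) => K Q' okK lK; exact: fle.
  have -> : \sum_(l < e.+1) 2 * (C1 * intw (e.+1 - l)) = 2 * (C1 * \sum_(l < e.+1) intw (e.+1 - l)).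
    by rewrite !mulr_sumr.
  have i0 := intc_gt0 A00 A_gt0 th1; have pg0 := pgam_gt0 eta0 p0.
  have C1p : 0 < C1 by exact: lt_le_trans ltr01 C11.
  have p4 : 0 < 4 * C1 * intc A0 A th by apply: mulr_gt0 => //; apply: mulr_gt0.
  have SI := sum_intw A00 A_gt0 th0 th1 C11 c20 eta0 p0 e.+1.
  apply: le_trans (_ : 2 * (C1 * (intc A0 A th * rho)) <= _).
    by apply: ler_wpM2l => //; apply: ler_wpM2l.
  have rl : radius0 A0 A th C1 c2 eta * (4 * C1 * intc A0 A th) <= slope0 th c2 eta.
    by rewrite -ler_pdivlMr// /radius0 !ge_min lexx !orbT.
  rewrite /radius /slope ler_pdivlMr// (_ : _ * 2 =
    radius0 A0 A th C1 c2 eta * (4 * C1 * intc A0 A th) / pgam eta p); last by ring.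
  by apply: ler_wpM2r => //; rewrite invr_ge0 ltW.
have d1 : del <= 1.
  apply: le_trans (slope_le th0 th1 c20 eta0 p0) _.
  by rewrite /slope0 ge_min lexx.
have yh : nrm rho p y <= 2^-1 by move: yle d1; lra.
by apply: le_trans (nrm_flog rho0 y0 yh) _; move: yle; lra.
Qed.

Lemma nrm_cumulant a n : nrm rho p (kap (a + n)%N - kap a) <= n%:R * del.
Proof.
elim: n => [|n IH]; first by rewrite addn0 subrr nrm0 mul0r.
rewrite (_ : kap _ - _ = (kap (a + n).+1 - kap (a + n)%N) + (kap (a + n)%N - kap a)); last first.
  by rewrite addnS addrA subrK.
apply: le_trans (nrmD _ rho0 _ _) _; rewrite -natr1 mulrDl mul1r addrC.
by apply: lerD => //; exact: nrm_cumulant_step.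
Qed.

End CumulantSeries.

(** * Duality with functions of bounded variation *)

Section ComplexIntegrable.
Context d (X : measurableType d) (R : realType).
Variable m : probability X R.
Implicit Types (f g : X -> R) (psi : X -> R[i]).

Lemma Re_le_normc (z : R[i]) : `|complex.Re z| <= normc z.
Proof. by case: z => a b /=; rewrite -sqrtr_sqr ler_wsqrtr// lerDl sqr_ge0. Qed.

Lemma normc_le_ReIm (z : R[i]) : normc z <= `|complex.Re z| + `|complex.Im z|.
Proof.
case: z => a b /=; rewrite -[leRHS]ger0_norm ?addr_ge0// -sqrtr_sqr ler_wsqrtr//.
rewrite sqrrD !real_normK ?num_real// -addrA lerD2l lerDr.
by rewrite mulrn_wge0// mulr_ge0.
Qed.

Lemma normc_real (r : R) : normc r%:C = `|r|.
Proof. by rewrite /= expr0n addr0 sqrtr_sqr. Qed.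

Lemma normc_ge0 (z : R[i]) : 0 <= normc z.
Proof. by case: z => a b; exact: sqrtr_ge0. Qed.

Lemma Re_mulr (z : R[i]) (r : R) : complex.Re (z * r%:C) = complex.Re z * r.
Proof. by case: z => a b /=; rewrite mulr0 subr0. Qed.

Lemma Im_mulr (z : R[i]) (r : R) : complex.Im (z * r%:C) = complex.Im z * r.
Proof. by case: z => a b /=; rewrite mulr0 add0r. Qed.

Lemma ReB (z z' : R[i]) : complex.Re (z - z') = complex.Re z - complex.Re z'.
Proof. by case: z; case: z'. Qed.

Lemma cL1E psi : cLnorm m 1 psi = (\int[m]_x (normc (psi x))%:E)%E.
Proof.
rewrite /cLnorm Lnorm1; apply: eq_integral => x _ /=.
by rewrite ger0_norm// normc_ge0.
Qed.

Lemma prob_setT_gt0 : (0 < m setT)%E.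
Proof. by rewrite (_ : m setT = 1%E) ?lte01//; exact: probability_setT. Qed.

Lemma cLinfE psi : cLnorm m +oo psi = ess_sup m (fun x => (normc (psi x))%:E).
Proof.
rewrite /cLnorm unlock; case: ifPn => [_|/negP[]]; last exact: prob_setT_gt0.
congr ess_sup; by apply/funext => x /=; rewrite ger0_norm// normc_ge0.
Qed.

Lemma cLnorm1_ge0 psi : (0 <= cLnorm m 1 psi)%E.
Proof. by rewrite cL1E integral_ge0// => x _; rewrite lee_fin normc_ge0. Qed.

Lemma cLinf_ge0 psi : (0 <= cLnorm m +oo psi)%E.
Proof.
rewrite cLinfE; apply: ess_sup_gee; first exact: prob_setT_gt0.
by apply: nearW => x; rewrite lee_fin normc_ge0.
Qed.

Lemma cmeasurable_cfun f : measurable_fun setT f -> cmeasurable (cfun f).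
Proof. by move=> mf; split => //; exact: measurable_cst. Qed.

Lemma cmeasurableM psi psi' : cmeasurable psi -> cmeasurable psi' ->
  cmeasurable (psi \* psi').
Proof.
move=> [a b] [a' b']; split.
- rewrite (_ : (fun x => _) = (fun x => complex.Re (psi x) * complex.Re (psi' x) -
    complex.Im (psi x) * complex.Im (psi' x))).
    by apply: measurable_funB; apply: measurable_funM.
  by apply/funext => x /=; case: (psi x); case: (psi' x).
- rewrite (_ : (fun x => _) = (fun x => complex.Re (psi x) * complex.Im (psi' x) +
    complex.Im (psi x) * complex.Re (psi' x))).
    by apply: measurable_funD; apply: measurable_funM.
  by apply/funext => x /=; case: (psi x); case: (psi' x).
Qed.

Lemma cLnorm1_le psi (C : R) : cmeasurable psi -> (forall x, normc (psi x) <= C) ->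
  (cLnorm m 1 psi <= C%:E)%E.
Proof.
move=> mpsi H; rewrite cL1E.
have -> : C%:E = (\int[m]_x (cst C x)%:E)%E.
  by rewrite (mean_EFin m (bm_cst _ C)) mean_cst.
apply: ge0_le_integral => //.
- by move=> x _; rewrite lee_fin normc_ge0.
- exact/measurable_EFinP/measurable_normc.
- by apply/measurable_EFinP; exact: measurable_cst.
- by move=> x _; rewrite lee_fin.
Qed.

Lemma cLnorm1_lty psi (C : R) : cmeasurable psi -> (forall x, normc (psi x) <= C) ->
  cLfun m 1 psi.
Proof. by move=> mpsi H; split=> //; rewrite (le_lt_trans (cLnorm1_le mpsi H)) ?ltry. Qed.

Lemma cLfun1_cfun f : bm f -> cLfun m 1 (cfun f).
Proof.
move=> [mf [C fC]]; apply: (@cLnorm1_lty _ C); first exact: cmeasurable_cfun.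
by move=> x; rewrite normc_real.
Qed.

Lemma cLfuny_cfun f : bm f -> cLfun m +oo (cfun f).
Proof.
move=> [mf [C fC]]; split; first exact: cmeasurable_cfun.
rewrite cLinfE (le_lt_trans _ (ltry C))//; apply/ess_supP; apply: nearW => x.
by rewrite lee_fin normc_real.
Qed.

Lemma integrable_Re psi : cLfun m 1 psi -> m.-integrable setT (fun x => (complex.Re (psi x))%:E).
Proof.
move=> [mpsi fin]; apply/integrableP; split; first by apply/measurable_EFinP; exact: mpsi.1.
rewrite (le_lt_trans _ fin)// cL1E; apply: ge0_le_integral => //.
- by apply: measurableT_comp => //; apply/measurable_EFinP; exact: mpsi.1.
- exact/measurable_EFinP/measurable_normc.
- by move=> x _; rewrite lee_fin Re_le_normc.
Qed.

Lemma Rint_Re_le psi (N : R) : cLfun m 1 psi -> (cLnorm m 1 psi <= N%:E)%E ->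
  `|\int[m]_x complex.Re (psi x)| <= N.
Proof.
move=> Lpsi HN; have i := integrable_Re Lpsi.
rewrite (le_trans (le_normr_Rintegral _ i))// -lee_fin (le_trans _ HN)// cL1E.
have in' : m.-integrable setT (fun x => (`|complex.Re (psi x)|)%:E) by exact: integrable_norm i.
rewrite /Rintegral fineK; last exact: (integrable_fin_num _ in').
apply: ge0_le_integral => //.
- by apply/measurable_EFinP; apply: measurableT_comp => //; exact: Lpsi.1.1.
- by apply/measurable_EFinP/measurable_normc; exact: Lpsi.1.
- by move=> x _; rewrite lee_fin Re_le_normc.
Qed.

Lemma Rint_Im_le psi (N : R) : cLfun m 1 psi -> (cLnorm m 1 psi <= N%:E)%E ->
  `|\int[m]_x complex.Im (psi x)| <= N.
Proof.
move=> [mpsi fin] HN; pose psi' x := psi x * (0 +i* (-1)).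
have nE z : normc (z * (0 +i* (-1))) = normc z :> R.
  by case: z => a b /=; congr Num.sqrt; ring.
have RE z : complex.Re (z * (0 +i* (-1))) = complex.Im z :> R.
  by case: z => a b /=; ring.
have IE z : complex.Im (z * (0 +i* (-1))) = - complex.Re z :> R.
  by case: z => a b /=; ring.
have N1 : cLnorm m 1 psi' = cLnorm m 1 psi.
  by rewrite !cL1E; apply: eq_integral => x _; rewrite nE.
have L' : cLfun m 1 psi'.
  split; last by rewrite N1.
  split; first by under eq_fun do rewrite RE; exact: mpsi.2.
  by under eq_fun do rewrite IE; apply: measurableT_comp => //; exact: mpsi.1.
have := Rint_Re_le L'; rewrite N1 => /(_ N HN).
by rewrite /Rintegral; under eq_integral do rewrite RE.
Qed.

(** The operators act on complex functions and the observables are real, so the real part of the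
    duality carries all the estimates. *)
Definition pairing psi f : R := \int[m]_x (complex.Re (psi x) * f x).

Lemma integrable_pairing psi f : cLfun m 1 psi -> bm f ->
  m.-integrable setT (EFin \o (fun x => complex.Re (psi x) * f x)).
Proof.
move=> Lpsi [mf [C fC]]; have i := integrable_Re Lpsi.
apply: (@le_integrable _ _ _ m setT _ _ (fun x => (C%:E * (complex.Re (psi x))%:E)%E)) => //.
- by apply/measurable_EFinP; apply: measurable_funM => //; exact: Lpsi.1.1.
- move=> x _ /=; rewrite lee_fin !normrM mulrC ler_wpM2r//.
  by rewrite (le_trans (fC x))// ler_norm.
- exact: integrableZl.
Qed.

Lemma pairingD psi f g : cLfun m 1 psi -> bm f -> bm g ->
  pairing psi (fun x => f x + g x) = pairing psi f + pairing psi g.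
Proof.
move=> Lpsi bf bg; rewrite /pairing -RintegralD//; try exact: integrable_pairing.
by apply: eq_Rintegral => x _; rewrite mulrDr.
Qed.

Lemma pairingZ psi f c : cLfun m 1 psi -> bm f ->
  pairing psi (fun x => c * f x) = c * pairing psi f.
Proof.
move=> Lpsi bf; rewrite /pairing -RintegralZl//; last exact: integrable_pairing.
by apply: eq_Rintegral => x _; rewrite mulrCA.
Qed.

Lemma pairing_cst psi c : cLfun m 1 psi ->
  pairing psi (fun _ => c) = c * \int[m]_x complex.Re (psi x).
Proof.
move=> Lpsi; rewrite /pairing -RintegralZl//; last exact: integrable_Re.
by apply: eq_Rintegral => x _; rewrite mulrC.
Qed.

Lemma pairing_ae psi psi' f : cLfun m 1 psi -> cLfun m 1 psi' -> bm f ->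
  {ae m, forall x, psi x = psi' x} -> pairing psi f = pairing psi' f.
Proof.
move=> L L' bf H; rewrite /pairing /Rintegral; congr fine.
apply: ae_eq_integral => //.
- exact: (measurable_int m (integrable_pairing L bf)).
- exact: (measurable_int m (integrable_pairing L' bf)).
- by apply: filterS H => x -> _.
Qed.

Lemma pairing_cfun a f : pairing (cfun a) f = mean m (fun x => a x * f x).
Proof. by []. Qed.

Lemma pairingBl psi psi' f : cLfun m 1 psi -> cLfun m 1 psi' -> bm f ->
  pairing (fun x => psi x - psi' x) f = pairing psi f - pairing psi' f.
Proof.
move=> L L' bf; rewrite /pairing -RintegralB//; try exact: integrable_pairing.
by apply: eq_Rintegral => x _; rewrite ReB mulrBl.
Qed.

Lemma cLnorm1_mul psi f (C : R) : cLfun m 1 psi -> bm f -> 0 <= C ->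
  {ae m, forall x, `|f x| <= C} ->
  (cLnorm m 1 (psi \* cfun f)%R <= C%:E * cLnorm m 1 psi)%E.
Proof.
move=> Lpsi bf C0 fC.
have mm : measurable_fun setT (fun x => (normc (psi x))%:E).
  by apply/measurable_EFinP/measurable_normc; exact: Lpsi.1.
rewrite !cL1E -ge0_integralZl//; last by move=> x _; rewrite lee_fin normc_ge0.
apply: ae_ge0_le_integral => //.
- by move=> x _; rewrite lee_fin normc_ge0.
- apply/measurable_EFinP/measurable_normc; apply: cmeasurableM; first exact: Lpsi.1.
  by apply: cmeasurable_cfun; exact: bf.1.
- by move=> x _; rewrite mule_ge0// lee_fin normc_ge0.
- exact: measurable_funeM.
- apply: filterS fC => x fxC _; rewrite /= -EFinM lee_fin ComplexField.Normc.normcM.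
  by rewrite normc_real mulrC ler_wpM2r ?normc_ge0.
Qed.

Lemma cLfun1_mul psi f : cLfun m 1 psi -> bm f -> cLfun m 1 (psi \* cfun f).
Proof.
move=> Lpsi bf; have [mf [C fC]] := bf; split.
  by apply: cmeasurableM; [exact: Lpsi.1|exact: cmeasurable_cfun].
have C0 : 0 <= C by rewrite (le_trans (normr_ge0 _) (fC point)).
rewrite (le_lt_trans (cLnorm1_mul Lpsi bf C0 (aeW m fC)))// lte_mul_pinfty ?Lpsi.2//.
Qed.

Lemma pairing_mul psi a f : pairing psi (fun x => a x * f x) = pairing (psi \* cfun a) f.
Proof. by apply: eq_Rintegral => x _ /=; rewrite Re_mulr mulrA. Qed.

Lemma pairing_le psi f (N C : R) : cLfun m 1 psi -> bm f ->
  (cLnorm m 1 psi <= N%:E)%E -> (forall x, `|f x| <= C) -> `|pairing psi f| <= C * N.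
Proof.
move=> Lpsi bf HN fC.
have C0 : 0 <= C by rewrite (le_trans (normr_ge0 _) (fC point)).
have -> : pairing psi f = \int[m]_x complex.Re ((psi \* cfun f) x).
  by apply: eq_Rintegral => x _ /=; rewrite Re_mulr.
apply: Rint_Re_le; first exact: cLfun1_mul.
apply: (le_trans (cLnorm1_mul Lpsi bf C0 (aeW m fC))).
by rewrite EFinM; apply: lee_wpmul2l => //; rewrite lee_fin.
Qed.

Lemma pairing_transfer (T : X -> X) L psi f : nonsingular m T -> transfer_operator m T L ->
  cLfun m 1 psi -> bm f -> pairing (L psi) f = pairing psi (fun x => f (T x)).
Proof.
move=> [mT _] tL Lpsi bf; have [LL /(_ _ (cLfuny_cfun bf))] := tL _ Lpsi.
move=> /(congr1 (@complex.Re R)) /= H; rewrite /pairing.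
transitivity (\int[m]_x complex.Re ((L psi \* cfun f) x)).
  by apply: eq_Rintegral => x _ /=; rewrite Re_mulr.
by rewrite H; apply: eq_Rintegral => x _ /=; rewrite Re_mulr.
Qed.

End ComplexIntegrable.

Section DualBound.
Context d (X : measurableType d) (R : realType).
Variables (m : probability X R) (v : (X -> R[i]) -> \bar R) (Cv : R).
Hypothesis hv : is_variation m v Cv.
Implicit Types (f g : X -> R) (psi : X -> R[i]).

Lemma var_cst (c : R[i]) : v (fun _ => c) = 0%E.
Proof.
have L1 : cLfun m 1 (cst 1 : X -> R[i]).
  by apply: (@cLfun1_cfun _ _ _ m (cst 1)); exact: bm_cst.
rewrite (_ : (fun _ => c) = (fun x => c * cst 1 x)); last by apply/funext => x; rewrite mulr1.
by rewrite (varV1 hv)// (varV5 hv) mule0.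
Qed.

Lemma cLfun1_scale (r : R) psi : cLfun m 1 psi -> cLfun m 1 (fun x => r%:C * psi x).
Proof.
move=> Lpsi; rewrite (_ : (fun x => _) = psi \* cfun (fun _ => r)); last first.
  by apply/funext => x /=; rewrite mulrC.
by apply: cLfun1_mul => //; exact: bm_cst.
Qed.

Lemma cLnorm1_scale (r : R) psi : cLfun m 1 psi ->
  (cLnorm m 1 (fun x => r%:C * psi x)%R = `|r|%:E * cLnorm m 1 psi)%E.
Proof.
move=> Lpsi; rewrite !cL1E -ge0_integralZl//.
- by apply: eq_integral => x _; rewrite ComplexField.Normc.normcM normc_real EFinM.
- by apply/measurable_EFinP/measurable_normc; exact: Lpsi.1.
- by move=> x _; rewrite lee_fin normc_ge0.
Qed.

Lemma BVnorm_scale (r : R) psi : cLfun m 1 psi ->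
  BVnorm m v (fun x => r%:C * psi x) = (`|r|%:E * BVnorm m v psi)%E.
Proof.
move=> Lpsi; rewrite /BVnorm cLnorm1_scale// (varV1 hv)// normc_real.
by rewrite ge0_muleDr ?cLnorm1_ge0 ?(var_ge0 hv).
Qed.

Lemma BVnorm_fin psi (M : R) : (BVnorm m v psi <= M%:E)%E ->
  exists N V : R, [/\ cLnorm m 1 psi = N%:E, v psi = V%:E, 0 <= N, 0 <= V & N + V <= M].
Proof.
rewrite /BVnorm; have := cLnorm1_ge0 m psi; have := var_ge0 hv psi.
case: (cLnorm m 1 psi) => [N||] //; case: (v psi) => [V||] //.
by rewrite -EFinD !lee_fin => *; exists N, V.
Qed.

Lemma BV_BVnorm psi (M : R) : cLfun m 1 psi -> (BVnorm m v psi <= M%:E)%E -> BV m v psi.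
Proof.
by move=> L /BVnorm_fin[N [V [_ vE _ _ _]]]; split=> //; rewrite vE ltry.
Qed.

Lemma BVnorm_cst1 : BVnorm m v (cfun (fun _ => 1)) = 1%:E.
Proof.
rewrite /BVnorm var_cst adde0 cL1E; under eq_integral do rewrite normc_real normr1.
by rewrite (mean_EFin m (bm_cst _ 1)) mean_cst.
Qed.

(** Apply [varV8] and estimate the supremum of [psi] by [varV3], which costs the factor [Cv]. *)
Lemma BVnorm_mul psi a (Ca Va M : R) : cLfun m 1 psi -> bm a ->
  0 <= Ca -> {ae m, forall x, `|a x| <= Ca} -> (v (cfun a) <= Va%:E)%E ->
  (BVnorm m v psi <= M%:E)%E -> (BVnorm m v (psi \* cfun a)%R <= ((Ca + Cv * Va) * M)%:E)%E.
Proof.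
move=> Lpsi ba Ca0 aC aV BM.
have [N [V [NE VE N0 V0 NV]]] := BVnorm_fin BM.
have Va0 : 0 <= Va by rewrite -lee_fin (le_trans (var_ge0 hv (cfun a))).
have Cv0 : 0 <= Cv by rewrite (le_trans ler01) ?(varV3_ge1 hv).
have H1 : (cLnorm m 1 (psi \* cfun a)%R <= (Ca * N)%:E)%E.
  by rewrite (le_trans (cLnorm1_mul Lpsi ba Ca0 aC))// NE -EFinM.
have H2 : (v (psi \* cfun a)%R <= (Cv * (N + V) * Va + Ca * V)%:E)%E.
  apply: (le_trans (varV8 hv Lpsi (cLfun1_cfun m ba) (cLfun1_mul Lpsi ba))).
  rewrite EFinD; apply: leeD.
    rewrite EFinM; apply: lee_pmul => //.
    - exact: cLinf_ge0.
    - exact: var_ge0 hv _.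
    - by have := varV3 hv Lpsi; rewrite NE VE -EFinD -EFinM.
  rewrite VE EFinM; apply: lee_wpmul2r; first by rewrite lee_fin.
  by rewrite cLinfE; apply/ess_supP; apply: filterS aC => x; rewrite lee_fin normc_real.
rewrite /BVnorm (le_trans (leeD H1 H2))// -EFinD lee_fin.
have -> : Ca * N + (Cv * (N + V) * Va + Ca * V) = (Ca + Cv * Va) * (N + V) by ring.
by apply: ler_wpM2l => //; rewrite addr_ge0// mulr_ge0.
Qed.

(** A bound for f in the dual of BV. Composition with the maps is dual to the transfer operators, so
    it contracts in this norm after centring, whereas the variation of a composition may grow at
    every step. *)
Definition dual_bound f (q : R) := forall psi, cLfun m 1 psi ->
  (BVnorm m v psi <= 1%:E)%E -> `|pairing m psi f| <= q.

Lemma dual_bound_ge0 f q : dual_bound f q -> 0 <= q.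
Proof.
move=> /(_ (cfun (fun _ => 1))) H; apply: le_trans (H _ _); first exact: normr_ge0.
  by apply: cLfun1_cfun; exact: bm_cst.
by rewrite BVnorm_cst1.
Qed.

Lemma dual_bound_scale f q psi C : bm f -> dual_bound f q -> cLfun m 1 psi -> 0 < C ->
  (BVnorm m v psi <= C%:E)%E -> `|pairing m psi f| <= C * q.
Proof.
move=> bf H Lpsi C0 BC.
have := H _ (cLfun1_scale C^-1 Lpsi); rewrite BVnorm_scale// gtr0_norm ?invr_gt0//.
have -> : pairing m (fun x => (C^-1)%:C * psi x) f = C^-1 * pairing m psi f.
  rewrite -pairingZ// pairing_mul; congr pairing; apply/funext => x /=.
  by rewrite mulrC.
rewrite normrM gtr0_norm ?invr_gt0// => /(_ _).
rewrite [C^-1 * _]mulrC ler_pdivrMr// mulrC; apply.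
apply: le_trans (lee_wpmul2l _ BC) _; first by rewrite lee_fin invr_ge0 ltW.
by rewrite -EFinM mulVf// gt_eqF.
Qed.

Lemma dual_bound_le f q q' : dual_bound f q -> q <= q' -> dual_bound f q'.
Proof. by move=> H qq psi L B; rewrite (le_trans (H _ L B)). Qed.

Lemma dual_boundD f g q q' : bm f -> bm g -> dual_bound f q -> dual_bound g q' ->
  dual_bound (fun x => f x + g x) (q + q').
Proof.
move=> bf bg Hf Hg psi L B; rewrite pairingD// (le_trans (ler_normD _ _))//.
by rewrite lerD ?Hf ?Hg.
Qed.

Lemma dual_boundZ f q c : bm f -> dual_bound f q ->
  dual_bound (fun x => c * f x) (`|c| * q).
Proof.
by move=> bf Hf psi L B; rewrite pairingZ// normrM ler_wpM2l// Hf.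
Qed.

Lemma dual_bound_sum (I : Type) (s : seq I) (F : I -> X -> R) (q : I -> R) :
  (forall i, bm (F i)) -> (forall i, dual_bound (F i) (q i)) ->
  dual_bound (fun x => \sum_(i <- s) F i x) (\sum_(i <- s) q i).
Proof.
move=> bF H; elim: s => [|i s IH].
  rewrite big_nil => psi L B; rewrite (_ : (fun x => _) = (fun _ => 0)).
    by rewrite pairing_cst// mul0r normr0.
  by apply/funext => x; rewrite big_nil.
rewrite big_cons (_ : (fun x => _) = (fun x => F i x + \sum_(j <- s) F j x)).
  by apply: dual_boundD => //; exact: bm_sum.
by apply/funext => x; rewrite big_cons.
Qed.

Lemma dual_bound1 : dual_bound (fun _ => 1) 1.
Proof.
move=> psi L B; rewrite -[leRHS]mul1r; apply: pairing_le => //.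
- exact: bm_cst.
- by have [N [V [NE _ N0 V0 NV]]] := BVnorm_fin B; rewrite NE lee_fin; lra.
- by move=> x; rewrite normr1.
Qed.

Lemma dual_bound_mul f q a (Ca Va : R) : bm f -> dual_bound f q -> bm a ->
  0 <= Ca -> {ae m, forall x, `|a x| <= Ca} -> (v (cfun a) <= Va%:E)%E -> 0 < Ca + Cv * Va ->
  dual_bound (fun x => a x * f x) ((Ca + Cv * Va) * q).
Proof.
move=> bf H ba Ca0 aC aV p0 psi L B; rewrite pairing_mul.
apply: dual_bound_scale => //; first exact: cLfun1_mul.
by have := BVnorm_mul L ba Ca0 aC aV B; rewrite mulr1.
Qed.

End DualBound.

Section ComplexL1.
Context d (X : measurableType d) (R : realType).
Variable m : probability X R.
Implicit Types f g : X -> R[i].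

Lemma cLnorm1B f g : cLfun m 1 f -> cLfun m 1 g ->
  (cLnorm m 1 (f \- g)%R <= cLnorm m 1 f + cLnorm m 1 g)%E.
Proof.
move=> [mf _] [mg _].
have mn (u : X -> R[i]) : cmeasurable u -> measurable_fun setT (fun x => (normc (u x))%:E).
  by move=> mu; apply/measurable_EFinP/measurable_normc.
have n0 (u : X -> R[i]) x : setT x -> (0 <= (normc (u x))%:E)%E.
  by move=> _; rewrite lee_fin normc_ge0.
rewrite !cL1E -ge0_integralD//; try exact: mn; try exact: n0.
apply: ge0_le_integral => //; try exact: n0.
- by apply: mn; exact: cmeasurableB.
- by apply: emeasurable_funD; exact: mn.
- move=> x _; rewrite -EFinD lee_fin /= -[normc (g x)]normcN.
  exact: le_normcD.
Qed.

Lemma cLfun1B f g : cLfun m 1 f -> cLfun m 1 g -> cLfun m 1 (f \- g).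
Proof.
move=> Lf Lg; split; first by apply: cmeasurableB; [exact: Lf.1|exact: Lg.1].
by rewrite (le_lt_trans (cLnorm1B Lf Lg))// lte_add_pinfty ?Lf.2 ?Lg.2.
Qed.

Lemma cLfun1_cst (c : R[i]) : cLfun m 1 (fun _ => c).
Proof. by apply: (@cLnorm1_lty _ _ _ m _ (normc c)). Qed.

Lemma cLnorm1_cst (c : R[i]) : cLnorm m 1 (fun _ => c) = (normc c)%:E.
Proof. by rewrite cL1E (mean_EFin m (bm_cst _ (normc c))) mean_cst. Qed.

End ComplexL1.

Section FibreTransfer.
Context d (X : measurableType d) dY (Y : measurableType dY) (R : realType).
Variables (m : probability X R) (v : (X -> R[i]) -> \bar R) (Cv : R).
Hypothesis hv : is_variation m v Cv.
Variables (T : paths Y -> X -> X) (L : paths Y -> (X -> R[i]) -> (X -> R[i])).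
Hypothesis hmaps : random_maps m T L.
Variable h : paths Y -> X -> R.

Definition orbit_map n (w : paths Y) (x : X) : X := (iter n (Defs.skew T) (w, x)).2.

Lemma iter_skew n w x : iter n (Defs.skew T) (w, x) = (path_shift n%:Z w, orbit_map n w x).
Proof.
suff H : (iter n (Defs.skew T) (w, x)).1 = path_shift n%:Z w.
  by rewrite -H /orbit_map; case: (iter _ _ _).
elim: n => [|n IH]; first by apply/funext => j; rewrite /path_shift /= addr0.
rewrite iterS /Defs.skew /= IH; apply/funext => j; rewrite /path_shift; congr (w _); lia.
Qed.

Lemma orbit_mapS n w x : orbit_map n.+1 w x = T (path_shift n%:Z w) (orbit_map n w x).
Proof. by rewrite /orbit_map iterS iter_skew. Qed.

Lemma path_shiftD (a b : int) (w : paths Y) : path_shift a (path_shift b w) = path_shift (a + b) w.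
Proof. by apply/funext => j; rewrite /path_shift; congr (w _); lia. Qed.

Lemma measurable_orbit_map n w : measurable_fun setT (orbit_map n w).
Proof.
elim: n => [|n IH]; first exact: measurable_id.
rewrite (_ : orbit_map n.+1 w = T (path_shift n%:Z w) \o orbit_map n w); last first.
  by apply/funext => x; rewrite orbit_mapS.
by apply: measurableT_comp => //; have [] := maps_nonsingular hmaps (path_shift n%:Z w).
Qed.

Lemma cLfun_Liter n w psi : cLfun m 1 psi -> cLfun m 1 (Liter L n w psi).
Proof.
move=> Lpsi; elim: n => //= n IH.
by have [] := maps_transfer hmaps (path_shift n%:Z w) IH.
Qed.

Lemma pairing_Liter n w psi f : cLfun m 1 psi -> bm f ->
  pairing m (Liter L n w psi) f = pairing m psi (fun x => f (orbit_map n w x)).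
Proof.
elim: n f => [|n IH] f Lpsi bf //=.
have [mT nT] := maps_nonsingular hmaps (path_shift n%:Z w).
rewrite (pairing_transfer (maps_nonsingular hmaps _) (maps_transfer hmaps _))//; last first.
  exact: cLfun_Liter.
rewrite IH//; last exact: bm_comp.
by congr pairing; apply/funext => x; rewrite orbit_mapS.
Qed.

Definition contraction n w (C : R) :=
  (BVopnorm m v (fun g => Liter L n w (Proj m h w g)) <= C%:E)%E.

Lemma contraction_le n w C psi : contraction n w C -> cLfun m 1 psi ->
  (BVnorm m v psi <= 1%:E)%E -> (BVnorm m v (Liter L n w (Proj m h w psi)) <= C%:E)%E.
Proof.
move=> H Lpsi B; apply: le_trans H; apply: ereal_sup_ubound.
by exists psi => //; split => //; exact: BV_BVnorm hv _ _ Lpsi B.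
Qed.

(** A test function with integral 0 is fixed by [Proj]. The integral is bounded through its real and
    imaginary parts by twice the L^1 norm, so division by 3 keeps the BV norm at most 1. *)
Definition cntr psi : X -> R[i] := fun x => (3^-1)%:C * (psi x - cintegral m psi).

Lemma cLfun_cntr psi : cLfun m 1 psi -> cLfun m 1 (cntr psi).
Proof.
by move=> Lpsi; apply: (cLfun1_scale _ (cLfun1B Lpsi (cLfun1_cst m (cintegral m psi)))).
Qed.

Lemma BVnorm_cntr psi : cLfun m 1 psi -> (BVnorm m v psi <= 1%:E)%E ->
  (BVnorm m v (cntr psi) <= 1%:E)%E.
Proof.
move=> Lpsi B; set c := cintegral m psi.
have [N [V [NE VE N0 V0 NV]]] := BVnorm_fin hv B.
have Lc := cLfun1_cst m c; have Lpc := cLfun1B Lpsi Lc.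
have c2N : normc c <= 2 * N.
  rewrite (le_trans (normc_le_ReIm _))// /c /cintegral /= (_ : 2 * N = N + N); last by ring.
  by rewrite lerD// ?Rint_Re_le ?Rint_Im_le ?NE.
rewrite /cntr (BVnorm_scale hv)// gtr0_norm ?invr_gt0//.
have H1 : (cLnorm m 1 (psi \- (fun _ => c))%R <= (3 * N)%:E)%E.
  by rewrite (le_trans (cLnorm1B Lpsi Lc))// NE cLnorm1_cst -EFinD lee_fin; move: c2N; lra.
have H2 : (v (psi \- (fun _ => c))%R <= V%:E)%E.
  apply: le_trans (varV2 hv Lpsi (cLfun1_cst m (- c))) _.
  by rewrite (var_cst hv) adde0 VE.
apply: (@le_trans _ _ ((3^-1)%:E * ((3 * N)%:E + V%:E))%E).
  by apply: lee_wpmul2l; [rewrite lee_fin|exact: leeD].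
by rewrite -EFinD -EFinM lee_fin; move: N0 V0 NV; lra.
Qed.

Lemma Proj_cntr w psi : cLfun m 1 psi -> Proj m h w (cntr psi) = cntr psi.
Proof.
move=> Lpsi; apply/funext => x; rewrite /Proj.
suff -> : cintegral m (cntr psi) = 0 by rewrite mul0r subr0.
have i1 := integrable_Re Lpsi.
have i2 : m.-integrable setT (fun x => (complex.Im (psi x))%:E).
  have L' : cLfun m 1 (psi \* cst (0 +i* (-1))).
    have mm : cmeasurable (psi \* cst (0 +i* (-1))).
      by apply: cmeasurableM; [exact: Lpsi.1|split; exact: measurable_cst].
    split=> //; rewrite cL1E (eq_integral (fun x => (normc (psi x))%:E)) -?cL1E ?Lpsi.2// => y _.
    rewrite /= ComplexField.Normc.normcM (_ : normc (_ +i* _) = 1) ?mulr1//.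
    by rewrite /= expr0n sqrrN expr1n add0r sqrtr1.
  have := integrable_Re L'; congr (_.-integrable _ _); apply/funext => y /=.
  by case: (psi y) => a b /=; congr EFin; ring.
have ic (r : R) : m.-integrable setT (EFin \o cst r) by exact: bm_integrable (bm_cst _ r).
rewrite /cintegral /cntr; apply/eqP; rewrite eq_complex /=; apply/andP; split; apply/eqP.
- rewrite (_ : \int[m]_x _ = \int[m]_x (3^-1 * (complex.Re (psi x) - complex.Re (cintegral m psi)))).
    rewrite RintegralZl//; last exact: (integrableB measurableT i1 (ic _)).
    rewrite RintegralB//; last exact: ic.
    by rewrite -[X in _ - X]/(mean m (fun _ => complex.Re (cintegral m psi))) mean_cst subrr mulr0.
  by apply: eq_Rintegral => y _; rewrite mulrC Re_mulr mulrC ReB.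
- rewrite (_ : \int[m]_x _ = \int[m]_x (3^-1 * (complex.Im (psi x) - complex.Im (cintegral m psi)))).
    rewrite RintegralZl//; last exact: (integrableB measurableT i2 (ic _)).
    rewrite RintegralB//; last exact: ic.
    by rewrite -[X in _ - X]/(mean m (fun _ => complex.Im (cintegral m psi))) mean_cst subrr mulr0.
  apply: eq_Rintegral => y _; rewrite mulrC Im_mulr mulrC; congr (_ * _).
  by case: (psi y) => a b; case: (cintegral m psi).
Qed.

(** Pairing psi with F minus its mean is pairing psi minus its integral with F, hence 3 times the
    pairing of [cntr psi] with F; duality then moves the map to the contracting side. *)
Lemma dual_bound_pull n w C f q : 0 < C -> contraction n w C -> bm f ->
  dual_bound m v f q ->
  dual_bound m v (fun x => f (orbit_map n w x) - mean m (fun x => f (orbit_map n w x)))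
    (3 * (C * q)).
Proof.
move=> C0 H bf Hf psi Lpsi B; set F := fun x => f (orbit_map n w x).
have bF : bm F by apply: bm_comp => //; exact: measurable_orbit_map.
have Lc := cLfun_cntr Lpsi; have Bc := BVnorm_cntr Lpsi B.
have := contraction_le H Lc Bc; rewrite Proj_cntr// => HL.
have := dual_bound_scale hv bf Hf (cLfun_Liter n w Lc) C0 HL.
rewrite pairing_Liter// -/F.
have -> : pairing m (cntr psi) F = 3^-1 * pairing m psi (fun x => F x - mean m F).
  have -> : pairing m (cntr psi) F = 3^-1 * pairing m (fun x => psi x - cintegral m psi) F.
    rewrite -pairingZ//; last exact: (cLfun1B Lpsi (cLfun1_cst m _)).
    rewrite pairing_mul; congr pairing; apply/funext => x /=.
    by rewrite /cntr mulrC.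
  rewrite pairingBl//; last exact: cLfun1_cst.
  rewrite pairingD//; last exact: bm_cst.
  rewrite pairing_cst// mulNr; congr (_ * (_ - _)).
  by rewrite mulrC /pairing -RintegralZl//; exact: bm_integrable.
by rewrite normrM gtr0_norm ?invr_gt0// mulrC ler_pdivrMr// mulrC.
Qed.

(** The contraction is applied to the constant 1, whose image under [Proj] is 1 - h_w. *)
Lemma mean_vs_density n w C f q : 0 < C -> contraction n w C -> bm f ->
  dual_bound m v f q -> cLfun m 1 (cfun (h w)) ->
  `|mean m (fun x => f (orbit_map n w x)) -
    pairing m (cfun (h w)) (fun x => f (orbit_map n w x))| <= C * q.
Proof.
move=> C0 H bf Hf Lh; set F := fun x => f (orbit_map n w x).
have bF : bm F by apply: bm_comp => //; exact: measurable_orbit_map.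
have L1 : cLfun m 1 (cfun (fun _ : X => 1 : R)) by apply: cLfun1_cfun; exact: bm_cst.
have PE : Proj m h w (cfun (fun _ => 1)) = (fun x => cfun (fun _ => 1) x - cfun (h w) x).
  apply/funext => x; rewrite /Proj (_ : cintegral m _ = 1) ?mul1r//.
  by rewrite /cintegral /= [X in X +i* _]mean_cst [X in _ +i* X]mean_cst.
have := contraction_le H L1; rewrite (BVnorm_cst1 hv) => /(_ (lexx _)); rewrite PE => HL.
have Ld := cLfun1B L1 Lh.
have := dual_bound_scale hv bf Hf (cLfun_Liter n w Ld) C0 HL.
rewrite pairing_Liter// -/F pairingBl// pairing_cfun.
by congr (`|mean m _ - _| <= _); apply/funext => x; rewrite mul1r.
Qed.

Lemma pairing_density n w f : bm f -> (forall k, cLfun m 1 (cfun (h (path_shift k%:Z w)))) ->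
  (forall k, {ae m, forall x, L (path_shift k%:Z w) (cfun (h (path_shift k%:Z w))) x =
     cfun (h (path_shift k.+1%:Z w)) x}) ->
  pairing m (cfun (h w)) (fun x => f (orbit_map n w x)) =
  pairing m (cfun (h (path_shift n%:Z w))) f.
Proof.
move=> bf Lh eqv; have w0 : path_shift 0 w = w by apply/funext => j; rewrite /path_shift addr0.
elim: n f bf => [|n IH] f bf; first by rewrite w0.
have [mT nT] := maps_nonsingular hmaps (path_shift n%:Z w).
rewrite (_ : (fun x => _) = (fun x => f (T (path_shift n%:Z w) (orbit_map n w x)))); last first.
  by apply/funext => x; rewrite orbit_mapS.
rewrite (IH (fun x => f (T (path_shift n%:Z w) x))); last exact: bm_comp.
rewrite -(pairing_transfer (maps_nonsingular hmaps _) (maps_transfer hmaps _))//.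
apply: pairing_ae => //.
by have [] := maps_transfer hmaps (path_shift n%:Z w) (Lh n).
Qed.

End FibreTransfer.

(** * Expansion along the fibres *)

Section FibreExpansion.
Context d (X : measurableType d) dY (Y : measurableType dY) (R : realType).
Variables (m : probability X R).
Variables (T : paths Y -> X -> X) (L : paths Y -> (X -> R[i]) -> (X -> R[i])).
Hypothesis hmaps : random_maps m T L.
Variable phi : paths Y * X -> R.
Hypothesis bphi : bm phi.
Hypothesis phi0 : forall w w' x, w 0 = w' 0 -> phi (w, x) = phi (w', x).
Variable M : nat.

Local Notation tau := (Defs.skew T).
Local Notation fibref := (paths Y * X -> fps R).

(* Only the times after [M] contribute, so that sums can be started far away
   from the time at which the fibre measure is [m]. *)
Definition zeta (j : nat) : fibref := fun z => if (M < j)%N then ex (phi z) - 1 else 0.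

Definition fmean (U : fibref) (w : paths Y) : fps R := meanf m (fun x => U (w, x)).
Definition nextmean (U : fibref) (w : paths Y) : fps R := fmean (fun z => U (tau z)) w.

(* [conn e n] lives at time [e - n]. *)
Fixpoint conn (e n : nat) : fibref :=
  if n is n'.+1 then fun z =>
    (1 + zeta (e - n) z) * conn e n' (tau z) - zeta (e - n) z * nextmean (conn e n') z.1
  else zeta e.

Lemma connS e n z : conn e n.+1 z =
  (1 + zeta (e - n.+1) z) * conn e n (tau z) - zeta (e - n.+1) z * nextmean (conn e n) z.1.
Proof. by []. Qed.

Definition acoef (e l : nat) (w : paths Y) : fps R :=
  if (l < e)%N then nextmean (conn e (e - l.+1)) (path_shift l%:Z w) else 0.

(** A single [acoef] need not decay in e - l, because the fibre means of [zeta] need not vanish. The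
    difference compares the measure [m] started at two consecutive times, and this does decay. *)
Definition fibreX (l e : nat) (w : paths Y) : fps R := acoef e l w - acoef e l.+1 w.

Definition fprod (i : nat) : fibref := fun z => \prod_(1 <= j < i.+1) (1 + zeta j (iter j tau z)).

Definition fibreG (e : nat) (w : paths Y) : fps R := fmean (fprod e) w.

Lemma fprodS i z : fprod i.+1 z = fprod i z * (1 + zeta i.+1 (iter i.+1 tau z)).
Proof. by rewrite /fprod big_nat_recr. Qed.

(** The increment at time [e] is pushed back one step at a time. Each step subtracts [zeta] times a
    fibre mean; since [fprod i.-1 * zeta i] is an increment of [fprod], what is subtracted is that
    increment times a function of the base alone, which factors out of fibre means. *)
Lemma fprod_expand e n z : (n < e)%N ->
  fprod e.-1 z * zeta e (iter e tau z) =
  fprod (e - n).-1 z * conn e n (iter (e - n) tau z) +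
  \sum_(e - n <= i < e) (fprod i z - fprod i.-1 z) *
     nextmean (conn e (e - i.+1)) (path_shift i%:Z z.1).
Proof.
elim: n => [|n IH] ne; first by rewrite subn0 big_geq// addr0.
rewrite IH; last exact: ltnW.
have en : (e - n = (e - n.+1).+1)%N by lia.
rewrite en [in RHS]big_ltn; last by lia.
rewrite [in RHS]addrA; congr (_ + _).
have [i iE] : exists i, (e - n.+1 = i.+1)%N by exists (e - n.+2)%N; lia.
have nE : (e - i.+2 = n)%N by lia.
rewrite iE nE connS iE !fprodS [_.-1]/=.
have hz : (iter i.+1 tau z).1 = path_shift i.+1%:Z z.1 by case: (z) => w x; rewrite iter_skew.
rewrite iterS hz.
set q := fprod i _; set Z := zeta _ _; set u := conn e n _; set y := nextmean _ _.
by ring.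
Qed.

Lemma fprod_recursion e z :
  fprod e.+1 z = fprod e z + conn e.+1 e (tau z) +
  \sum_(1 <= i < e.+1) (fprod i z - fprod i.-1 z) *
     nextmean (conn e.+1 (e - i)) (path_shift i%:Z z.1).
Proof.
rewrite fprodS mulrDr mulr1 -addrA; congr (_ + _).
have := @fprod_expand e.+1 e z (ltnSn e); rewrite [_.-1]/= => ->.
by rewrite subSnn [_.-1]/= {1}/fprod big_geq// mul1r; congr (_ + _).
Qed.

Lemma abel_sum (a g : nat -> fps R) n :
  \sum_(l < n.+1) (a l - a l.+1) * g l =
  a 0%N * g 0%N + \sum_(1 <= i < n.+1) (g i - g i.-1) * a i - a n.+1 * g n.
Proof.
elim: n => [|n IH]; first by rewrite big_ord1 big_geq//; ring.
by rewrite big_ord_recr /= IH [in RHS]big_nat_recr//=; ring.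
Qed.

Lemma measurable_tau : measurable_fun setT tau.
Proof. exact: maps_skew hmaps. Qed.

Lemma measurable_iter_tau n : measurable_fun setT (iter n tau).
Proof.
elim: n => [|n IH]; first exact: measurable_id.
rewrite (_ : iter n.+1 tau = tau \o iter n tau)//.
by apply: measurableT_comp => //; exact: measurable_tau.
Qed.

Lemma bmf_comp d1 d2 (T1 : measurableType d1) (T2 : measurableType d2)
  (U : T2 -> fps R) (g : T1 -> T2) : bmf U -> measurable_fun setT g -> bmf (fun z => U (g z)).
Proof. by move=> bU mg k; exact: (bm_comp (bU k) mg). Qed.

Lemma bmf_xsection (U : fibref) w : bmf U -> bmf (fun x => U (w, x)).
Proof. by move=> bU k; exact: bm_xsection (bU k). Qed.

Lemma bmf_fmean (U : fibref) : bmf U -> bmf (fmean U).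
Proof. by move=> bU k; exact: (bm_fibre m (bU k)). Qed.

Lemma bmf_nextmean (U : fibref) : bmf U -> bmf (nextmean U).
Proof. by move=> bU; apply: bmf_fmean; apply: bmf_comp => //; exact: measurable_tau. Qed.

Lemma bmf_zeta j : bmf (zeta j).
Proof.
rewrite /zeta; case: (M < j)%N; last exact: bmf_cst.
apply: bmfB; last exact: bmf_cst.
move=> k /=; rewrite (_ : (fun w => _) = (fun w => k`!%:R^-1 * phi w ^+ k)).
  by apply: bmZ; exact: bmX.
by apply/funext => z; rewrite mulrC.
Qed.

Lemma bmf_conn e n : bmf (conn e n).
Proof.
elim: n => [|n IH]; first exact: bmf_zeta.
have bz := bmf_zeta (e - n.+1).
apply: bmfB; apply: bmfM => //.
- by apply: bmfD => //; exact: bmf_cst.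
- by apply: bmf_comp => //; exact: measurable_tau.
- by apply: bmf_comp; [exact: bmf_nextmean|exact: measurable_fst].
Qed.

Lemma bmf_fprod i : bmf (fprod i).
Proof.
elim: i => [|i IH].
  rewrite (_ : fprod 0 = fun _ => 1); first exact: bmf_cst.
  by apply/funext => z; rewrite /fprod big_geq.
rewrite (_ : fprod i.+1 = fun z => fprod i z * (1 + zeta i.+1 (iter i.+1 tau z))).
  apply: bmfM => //; apply: bmfD; first exact: bmf_cst.
  by apply: bmf_comp; [exact: bmf_zeta|exact: measurable_iter_tau].
by apply/funext => z; rewrite fprodS.
Qed.

Lemma bmf_acoef e l : bmf (acoef e l).
Proof.
rewrite /acoef; case: (l < e)%N; last exact: bmf_cst.
apply: bmf_comp; last exact: measurable_path_shift.
by apply: bmf_nextmean; exact: bmf_conn.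
Qed.

Lemma bmf_fibreX l e : bmf (fibreX l e).
Proof. by apply: bmfB; exact: bmf_acoef. Qed.

Lemma bmf_fibreG e : bmf (fibreG e).
Proof. by apply: bmf_fmean; exact: bmf_fprod. Qed.

Lemma fibreG0 w : fibreG 0 w = 1.
Proof.
rewrite /fibreG /fmean (_ : (fun x => _) = fun _ => 1) ?meanf_cst//.
by apply/funext => x; rewrite /fprod big_geq.
Qed.

Lemma fibreG_recursion e w :
  fibreG e.+1 w = fibreG e w + \sum_(l < e.+1) fibreX l e.+1 w * fibreG l w.
Proof.
(* Summation by parts. The upper boundary term vanishes because [acoef e.+1 e.+1] is 0 by
   definition, and the lower one carries the factor [fibreG 0 = 1]. *)
rewrite /fibreX (abel_sum (fun l => acoef e.+1 l w) (fun l => fibreG l w)) /acoef ltnn mul0r subr0 ltn0Sn fibreG0 mulr1.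
have w0 : path_shift 0%:Z w = w by apply/funext => j; rewrite /path_shift addr0.
rewrite w0 subSS subn0 /fibreG {1}/fmean.
rewrite (_ : (fun x => _) = (fun x => fprod e (w, x) + conn e.+1 e (tau (w, x)) +
  \sum_(1 <= i < e.+1) nextmean (conn e.+1 (e - i)) (path_shift i%:Z w) *
     (fprod i (w, x) - fprod i.-1 (w, x)))); last first.
  apply/funext => x; rewrite fprod_recursion; congr (_ + _).
  by apply: eq_bigr => i _; rewrite mulrC.
have b1 := bmf_xsection w (bmf_fprod e).
have b2 : bmf (fun x => conn e.+1 e (tau (w, x))).
  apply: (@bmf_xsection (fun z => conn e.+1 e (tau z))).
  by apply: bmf_comp; [exact: bmf_conn|exact: measurable_tau].
have b3 i : bmf (fun x => fprod i (w, x) - fprod i.-1 (w, x)).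
  by apply: bmfB; apply: bmf_xsection; exact: bmf_fprod.
have b4 i (c : fps R) : bmf (fun x => c * (fprod i (w, x) - fprod i.-1 (w, x))).
  by apply: bmfM => //; exact: bmf_cst.
rewrite meanfD; [|exact: bmfD|exact: bmf_sum].
rewrite meanfD// -addrA; congr (_ + (_ + _)).
rewrite meanf_sum// !big_nat; apply: eq_bigr => i /andP[i1 ie].
rewrite meanfZ// meanfB; [|exact: bmf_xsection (bmf_fprod _)|exact: bmf_xsection (bmf_fprod _)].
by rewrite ie mulrC subSS.
Qed.

Definition depends_to (n : nat) (Z : Type) (U : paths Y * X -> Z) :=
  forall w w' x, (forall j : int, 0 <= j -> j <= n%:Z -> w j = w' j) -> U (w, x) = U (w', x).

Lemma depends_nextmean n U w w' : depends_to n U ->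
  (forall j : int, 0 <= j -> j <= n.+1%:Z -> w j = w' j) -> nextmean U w = nextmean U w'.
Proof.
move=> dU ww'; rewrite /nextmean /fmean; congr meanf; apply/funext => x.
rewrite /Defs.skew /= (maps_coord0 hmaps (ww' 0 (lexx _) _))//.
by apply: dU => j j0 jn; rewrite /path_shift; apply: ww'; lia.
Qed.

Lemma depends_zeta n j : depends_to n (zeta j).
Proof. by move=> w w' x ww'; rewrite /zeta (phi0 _ (ww' 0 _ _)). Qed.

Lemma depends_conn e n : depends_to n (conn e n).
Proof.
elim: n => [|n IH]; first exact: depends_zeta.
move=> w w' x ww'; have Ez := depends_zeta (e - n.+1) x ww'.
rewrite !connS Ez (depends_nextmean IH ww').
congr (_ * _ - _); rewrite /Defs.skew /= (maps_coord0 hmaps (ww' 0 (lexx _) _))//.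
by apply: IH => j j0 jn; rewrite /path_shift; apply: ww'; lia.
Qed.

Lemma acoef_local e l (w w' : paths Y) :
  (forall j : int, l%:Z <= j -> j <= e%:Z -> w j = w' j) -> acoef e l w = acoef e l w'.
Proof.
move=> ww'; rewrite /acoef; case: ltnP => // le.
apply: depends_nextmean; first exact: depends_conn.
by move=> j j0 je; rewrite /path_shift; apply: ww'; lia.
Qed.

Lemma fibreX_local e l w w' :
  (forall j : int, l%:Z <= j -> j <= e%:Z -> w j = w' j) -> fibreX l e w = fibreX l e w'.
Proof.
move=> ww'; rewrite /fibreX (@acoef_local e l w w')//.
rewrite (@acoef_local e l.+1 w w')// => j lj je; apply: ww' => //.
by apply: le_trans lj; rewrite lez_nat.
Qed.

Lemma fibreX_past l e : past e%:Z (fibreX l e).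
Proof. by move=> w w' ww'; apply: fibreX_local => j _ je; exact: ww'. Qed.

Lemma fibreX_future l e : future l%:Z (fibreX l e).
Proof. by move=> w w' ww'; apply: fibreX_local => j lj _; exact: ww'. Qed.

Lemma conn_coef0 e n z : conn e n z 0%N = 0.
Proof.
have Z0 j z' : zeta j z' 0%N = 0.
  by rewrite /zeta; case: ifP => _ //; rewrite coefB_fps /= expr0 fact0 divr1 subrr.
elim: n z => [|n IH] z; first exact: Z0.
by rewrite connS coefB_fps !coefM0_fps IH Z0 mulr0 mul0r subrr.
Qed.

Lemma nextmean_coef0 e n w : nextmean (conn e n) w 0%N = 0.
Proof.
rewrite /nextmean /fmean /= -[RHS](mean_cst m); congr mean; apply/funext => x.
exact: conn_coef0.
Qed.

Lemma fibreX_coef0 l e w : fibreX l e w 0%N = 0.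
Proof.
have a0 l' : acoef e l' w 0%N = 0.
  by rewrite /acoef; case: ifP => _ //; exact: nextmean_coef0.
by rewrite /fibreX coefB_fps !a0 subrr.
Qed.

Lemma fprod_early e z : (e <= M)%N -> fprod e z = 1.
Proof.
move=> eM; rewrite /fprod big_nat_cond big1// => j; rewrite andbT => /andP[_ je].
by rewrite /zeta ltnNge (leq_trans _ eM)//= addr0.
Qed.

Lemma fibreG_early e w : (e <= M)%N -> fibreG e w = 1.
Proof.
move=> eM; rewrite /fibreG /fmean (_ : (fun x => _) = fun _ => 1) ?meanf_cst//.
by apply/funext => x; rewrite fprod_early.
Qed.

(** The active times are M + 1, ..., M + n, whence the start of the Birkhoff sum at [M.+1]. *)
Lemma fprod_birkhoff n z : fprod (M + n) z = ex (birkhoff_sum T phi n (iter M.+1 tau z)).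
Proof.
elim: n => [|n IH].
  by rewrite addn0 fprod_early// /birkhoff_sum big_geq// ex0.
rewrite addnS fprodS IH /birkhoff_sum big_nat_recr//= exD; congr (_ * _).
by rewrite /zeta ltnS leq_addr addrC subrK -iterSr -iterD addnC.
Qed.

End FibreExpansion.

(** One case analysis, according to whether [e] is the successor of [l], for all the truncated
    differences in [fibreX] at once. *)
Variant gap_spec (l e : nat) : nat -> nat -> nat -> bool -> Prop :=
| GapOne : gap_spec l e 1 0 0 false
| GapMore n : gap_spec l e n.+2 n.+1 n true.

Lemma gapP l e : (l < e)%N -> gap_spec l e (e - l) (e - l.+1) (e - l.+2) (l.+1 < e)%N.
Proof.
move=> le; have -> : (l.+1 < e)%N = (1 < e - l)%N by apply/idP/idP; lia.
have [n ->] : exists n, e = (l + n.+1)%N by exists (e - l.+1)%N; lia.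
have -> : (l + n.+1 - l = n.+1)%N by lia.
have -> : (l + n.+1 - l.+1 = n)%N by lia.
have -> : (l + n.+1 - l.+2 = n.-1)%N by lia.
by case: n => [|n]; constructor.
Qed.

(** * Exponential decay of the coefficients of the recursion *)

Section FibreBounds.
Context d (X : measurableType d) dY (Y : measurableType dY) (R : realType).
Variables (m : probability X R) (v : (X -> R[i]) -> \bar R) (Cv : R).
Hypothesis hv : is_variation m v Cv.
Variables (T : paths Y -> X -> X) (L : paths Y -> (X -> R[i]) -> (X -> R[i])).
Hypothesis hmaps : random_maps m T L.
Variable h : paths Y -> X -> R.
Variable phi : paths Y * X -> R.
Hypothesis mphi : measurable_fun setT phi.
Variable B : R.
Hypothesis B0 : 0 <= B.
Hypothesis phiB : forall z, `|phi z| <= Cv * B.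
Hypothesis phi0 : forall w w' x, w 0 = w' 0 -> phi (w, x) = phi (w', x).
Variables (lam eps : R) (K : paths Y -> R).
Hypotheses (lam0 : 0 < lam) (eps_lam : eps < lam / 3) (K1 : forall w, 1 < K w).
Variable M : nat.

Record good_fibre (w : paths Y) : Prop := GoodFibre {
  fibre_phi : (BVnorm m v (cfun (fun x => phi (w, x))) <= (B / K w)%:E)%E ;
  fibre_gap : forall n : nat, (0 < n)%N ->
    contraction m v L h n w (K w * expR (- lam * n%:R)) ;
  fibre_var : forall g, BV m v g -> (v (g \o T w) <= (K w)%:E * v g)%E ;
  fibre_dens : cLfun m 1 (cfun (h w)) ;
  fibre_equiv : {ae m, forall x, L w (cfun (h w)) x = cfun (h (path_shift 1 w)) x} ;
  fibre_growth : forall n : nat, K w <= K (path_shift n%:Z w) * expR (eps * n%:R)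
}.

Definition good_orbit w := forall k : nat, good_fibre (path_shift k%:Z w).

Local Notation tau := (Defs.skew T).
Local Notation conn := (conn m T phi M).
Local Notation zeta := (zeta phi M).
Local Notation DB := (dual_bound m v).

(* [gb] bounds multiplication by [phi] on BV, while [gc] solves
   [3 + gc * gth = gc], which closes the induction bounding [conn]. *)
Definition gth := expR (- (lam / 3)).
Definition gc := 3 / (1 - gth).
Definition gb := 2 * Cv * B + 1.
Definition gA := gb * (1 + 2 * gc).

Lemma good_shift n w : good_orbit w -> good_orbit (path_shift n%:Z w).
Proof. by move=> H k; rewrite path_shiftD -PoszD; exact: H. Qed.

Lemma good_here w : good_orbit w -> good_fibre w.
Proof. by move=> /(_ 0%N); congr good_fibre; apply/funext => j; rewrite /path_shift addr0. Qed.

Let K0 w : 0 < K w. Proof. exact: lt_trans ltr01 (K1 w). Qed.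
Let Cv1 : 1 <= Cv. Proof. exact: varV3_ge1 hv. Qed.
Let Cv0 : 0 <= Cv. Proof. exact: le_trans ler01 Cv1. Qed.

Lemma gth_gt0 : 0 < gth. Proof. exact: expR_gt0. Qed.
Lemma gth_lt1 : gth < 1.
Proof. by rewrite -expR0 ltr_expR oppr_lt0 divr_gt0. Qed.
Lemma gc_eq : 3 + gc * gth = gc.
Proof.
have t1 : 1 - gth != 0 by rewrite gt_eqF// subr_gt0 gth_lt1.
by rewrite /gc; field.
Qed.
Lemma gc_ge3 : 3 <= gc.
Proof.
have h1 := gth_gt0; have h2 := gth_lt1; rewrite /gc ler_pdivlMr ?subr_gt0//.
by move: (gth) h1 h2 => t; lra.
Qed.
Lemma gb_ge1 : 1 <= gb.
Proof. by rewrite /gb lerDr !mulr_ge0. Qed.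
Lemma gA_ge : 7 * gb <= gA.
Proof.
have h1 := gb_ge1; have h2 := gc_ge3; rewrite /gA; move: (gb) (gc) h1 h2 => x y.
by nra.
Qed.
Lemma gA_gt0 : 0 < gA.
Proof. by have h1 := gb_ge1; have h2 := gA_ge; move: (gA) (gb) h1 h2 => x y; lra. Qed.

(** The ratio gb / gA is 1 / (1 + 2 gc), chosen so that its powers from the first on sum to 1 / (2
    gc). Multiplication by [zeta] thus cancels the constant [gc] of [conn_bound] with a factor 2 to
    spare. *)
Lemma sum_gb k : \sum_(i < k.+1) (if val i is 0%N then 0 else gb ^+ i * gA ^+ (k - i)) <=
  gA ^+ k / (2 * gc).
Proof.
have hb := gb_ge1; have hc := gc_ge3; have hA := gA_gt0.
have c0 : 0 < gc by exact: lt_le_trans hc.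
have b0 : 0 < gb by exact: lt_le_trans hb.
rewrite big_ord_recl add0r; set x := (1 + 2 * gc)^-1.
have y0 : 0 < 1 + 2 * gc by move: (gc) c0 => c; lra.
have x0 : 0 <= x by rewrite invr_ge0 ltW.
have x1 : x < 1 by rewrite invf_lt1//; move: (gc) c0 => c; lra.
have bx : gb = gA * x by rewrite /gA /x mulfK// gt_eqF.
rewrite (eq_bigr (fun i : 'I_k => gA ^+ k * (x * x ^+ i))); last first.
  move=> i _; rewrite lift0 {1}bx exprMn mulrAC -exprD subnKC; last exact: ltn_ord.
  by rewrite exprS.
rewrite -mulr_sumr -mulr_sumr; apply: ler_wpM2l; first by rewrite exprn_ge0 ?ltW.
have := @sum_geometric_le R x k; rewrite x0 x1 => /(_ isT) /(ler_wpM2l x0) /le_trans; apply.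
rewrite le_eqVlt /x; apply/orP; left; apply/eqP; field.
by rewrite !gt_eqF//; move: (gc) c0 => c; lra.
Qed.

Lemma sum_gb0 k : \sum_(i < k.+1) gb ^+ i * gA ^+ (k - i) <= 3 / 2 * gA ^+ k.
Proof.
have hA := gA_gt0; have hc := gc_ge3; have := sum_gb k.
rewrite !big_ord_recl add0r [gb ^+ _]expr0 mul1r subn0 => H.
have h2 : gA ^+ k / (2 * gc) <= gA ^+ k / 2.
  apply: ler_wpM2l; first by rewrite exprn_ge0 ?ltW.
  by rewrite lef_pV2 ?posrE//; move: (gc) hc => c; lra.
rewrite (eq_bigr (fun i : 'I_k => gb ^+ lift ord0 i * gA ^+ (k - lift ord0 i))) in H; last first.
  by move=> i _; rewrite lift0.
have := le_trans H h2; move: (\sum_(i < k) _) (gA ^+ k) => u s; lra.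
Qed.

(** The nonuniform constant [K w] of the contraction is paid for by the 1 / K gained at the arrival
    point. As [eps < lam / 3], a rate of 2 lam / 3 remains, that is, two factors [gth] per step. *)
Lemma K_ratio n w : good_fibre w ->
  K w * expR (- lam * n%:R) / K (path_shift n%:Z w) <= gth ^+ (2 * n).
Proof.
move=> gw; rewrite ler_pdivrMr//.
apply: (@le_trans _ _ (K (path_shift n%:Z w) * expR (eps * n%:R) * expR (- lam * n%:R))).
  by rewrite ler_wpM2r ?expR_ge0//; exact: fibre_growth gw n.
rewrite -mulrA mulrC ler_wpM2r ?(ltW (K0 _))// -expRD /gth -expRM_natr ler_expR natrM.
have n0 : 0 <= n%:R :> R by exact: ler0n.
by move: (n%:R) n0 => u u0; move: eps_lam; nra.
Qed.

(** This is [varV3]. The additional 1 keeps the multiplier constant positive when [B = 0], as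
    [dual_bound_mul] requires, and yields [gb >= 1]. *)
Lemma ae_phi w : good_fibre w -> {ae m, forall x, `|phi (w, x)| <= (Cv * B + 1) / K w}.
Proof.
move=> gw; have bp : bm (fun x => phi (w, x)) by apply: bm_xsection; split=> //; exists (Cv * B).
have := varV3 hv (cLfun1_cfun m bp); rewrite cLinfE.
have : (Cv%:E * (cLnorm m 1 (cfun (fun x => phi (w, x))) + v (cfun (fun x => phi (w, x)))) <=
    ((Cv * B + 1) / K w)%:E)%E.
  apply: le_trans (lee_wpmul2l _ (fibre_phi gw)) _; first by rewrite lee_fin.
  rewrite -EFinM lee_fin mulrA ler_wpM2r// ?lerDl// invr_ge0 ltW//; exact: K0.
move=> /[swap] /le_trans /[apply] /ess_supP; apply: filterS => x.
by rewrite lee_fin normc_real.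
Qed.

Lemma var_phi w : good_fibre w -> (v (cfun (fun x => phi (w, x))) <= (B / K w)%:E)%E.
Proof.
by move=> gw; apply: le_trans (fibre_phi gw); rewrite /BVnorm leeDr// cLnorm1_ge0.
Qed.

Let bphi : bm phi. Proof. by split=> //; exists (Cv * B). Qed.
Let bphix w : bm (fun x => phi (w, x)). Proof. exact: bm_xsection. Qed.
Let Ca0 w : 0 <= (Cv * B + 1) / K w.
Proof. by rewrite divr_ge0 ?(ltW (K0 w))// addr_ge0// mulr_ge0. Qed.
Let CaVa w : (Cv * B + 1) / K w + Cv * (B / K w) = gb / K w.
Proof. by rewrite /gb; field; rewrite gt_eqF. Qed.
Let gbK w : 0 < gb / K w.
Proof. by rewrite divr_gt0// (lt_le_trans ltr01 gb_ge1). Qed.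

Lemma dual_bound_phi w f q : good_fibre w -> bm f -> DB f q ->
  DB (fun x => phi (w, x) * f x) (gb / K w * q).
Proof.
move=> gw bf Hf; rewrite -CaVa.
apply: (dual_bound_mul hv bf Hf (bphix w) (Ca0 w) (ae_phi gw) (var_phi gw)).
by rewrite CaVa.
Qed.

(** Each power of [phi] brings a factor 1 / K. One is kept, to be spent in [K_ratio], and the others
    are bounded by 1. *)
Lemma dual_bound_phiX w f q r : good_fibre w -> bm f -> DB f q ->
  DB (fun x => phi (w, x) ^+ r.+1 * f x) (gb ^+ r.+1 / K w * q).
Proof.
move=> gw bf Hf; have q0 := dual_bound_ge0 hv Hf.
elim: r => [|r IH].
  rewrite expr1 (_ : (fun x => _) = (fun x => phi (w, x) * f x)); first exact: dual_bound_phi.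
  by apply/funext => x; rewrite expr1.
rewrite (_ : (fun x => _) = (fun x => phi (w, x) * (phi (w, x) ^+ r.+1 * f x))); last first.
  by apply/funext => x; rewrite exprS mulrA.
have bpf : bm (fun x => phi (w, x) ^+ r.+1 * f x) by apply: bmM => //; exact: bmX.
apply: (dual_bound_le (dual_bound_phi gw bpf IH)).
rewrite mulrA ler_wpM2r// [leRHS](_ : _ = (gb / K w) * gb ^+ r.+1); last by rewrite exprS; ring.
rewrite ler_wpM2l ?(ltW (gbK w))// ler_piMr ?exprn_ge0 ?(le_trans ler01 gb_ge1)//.
by rewrite invf_le1// ltW.
Qed.

Lemma BVnorm_phiX w r : good_fibre w ->
  (BVnorm m v (cfun (fun x => phi (w, x) ^+ r)%R) <=
    (gb ^+ r * (if r is 0%N then 1 else (K w)^-1))%:E)%E.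
Proof.
move=> gw; elim: r => [|r IH].
  by rewrite mulr1 (_ : (fun x => _) = (fun _ => 1)) ?(BVnorm_cst1 hv)//.
have bp : bm (fun x => phi (w, x) ^+ r) by exact: bmX.
have := BVnorm_mul hv (cLfun1_cfun m bp) (bphix w) (Ca0 w) (ae_phi gw) (var_phi gw) IH.
rewrite CaVa (_ : _ \* _ = cfun (fun x => phi (w, x) ^+ r.+1)); last first.
  by apply/funext => x; rewrite /cfun /= exprSr rmorphM.
move/le_trans; apply; rewrite lee_fin exprS.
rewrite (_ : gb / K w * _ = (gb * gb ^+ r / K w) * (if r is 0%N then 1 else (K w)^-1)); last by ring.
apply: ler_piMr; last by case: (r) => // _; rewrite invf_le1// ltW.
by rewrite divr_ge0 ?(ltW (K0 w))// -exprS exprn_ge0// (le_trans ler01 gb_ge1).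
Qed.

Lemma zeta_coef j r : exists2 c : R, `|c| <= 1 &
  forall z, zeta j z r.+1 = c * phi z ^+ r.+1.
Proof.
rewrite /zeta; case: (M < j)%N; last by exists 0 => [|z]; rewrite ?normr0// mul0r.
exists r.+1`!%:R^-1 => [|z]; last by rewrite coefB_fps coef1_fps subr0 /= mulrC.
by rewrite ger0_norm ?invr_ge0// invf_le1 ?ltr0n ?fact_gt0// ler1n fact_gt0.
Qed.

Lemma zeta_coef0 j z : zeta j z 0%N = 0.
Proof.
by rewrite /zeta; case: (M < j)%N => //; rewrite coefB_fps /= expr0 fact0 divr1 subrr.
Qed.

Lemma bmf_zetax j w : bmf (fun x => zeta j (w, x)).
Proof. by apply: bmf_xsection; exact: bmf_zeta. Qed.

Lemma dual_bound_zetaM j w (U : X -> fps R) Q k : good_fibre w -> bmf U -> 0 <= Q ->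
  (forall k, DB (fun x => U x k) (Q * gA ^+ k)) ->
  DB (fun x => (zeta j (w, x) * U x) k) (Q / (2 * gc) * gA ^+ k / K w).
Proof.
move=> gw bU Q0 HU.
apply: (@dual_bound_le _ _ _ _ _ _ (\sum_(i < k.+1)
   (if val i is 0%N then 0 else gb ^+ i * gA ^+ (k - i)) * (Q / K w))).
  apply: (@dual_bound_sum _ _ _ _ _ _ _ (fun (i : 'I_k.+1) x => zeta j (w, x) i * U x (k - i)%N)).
    by move=> i; apply: bmM; [exact: bmf_zetax|exact: bU].
  move=> [[|i] ik] /=.
    rewrite mul0r (_ : (fun x => _) = (fun x => 0 * U x (k - 0)%N)).
      by have := @dual_boundZ _ _ _ m v _ _ 0 (bU _) (HU (k - 0)%N); rewrite normr0 mul0r.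
    by apply/funext => x; rewrite zeta_coef0.
  have [c c1 Hc] := zeta_coef j i.
  rewrite (_ : (fun x => _) = (fun x => c * (phi (w, x) ^+ i.+1 * U x (k - i.+1)%N))); last first.
    by apply/funext => x; rewrite Hc mulrA.
  have bp : bm (fun x => phi (w, x) ^+ i.+1 * U x (k - i.+1)%N).
    by apply: bmM; [exact: bmX|exact: bU].
  have H := dual_bound_phiX i gw (bU _) (HU (k - i.+1)%N).
  apply: (dual_bound_le (@dual_boundZ _ _ _ m v _ _ c bp H)).
  apply: (@le_trans _ _ (1 * (gb ^+ i.+1 / K w * (Q * gA ^+ (k - i.+1))))).
    by have q0 := dual_bound_ge0 hv H; apply: ler_wpM2r.
  by rewrite le_eqVlt; apply/orP; left; apply/eqP; ring.
rewrite -mulr_suml.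
have QK : 0 <= Q / K w by rewrite divr_ge0 ?(ltW (K0 w)).
apply: le_trans (ler_wpM2r QK (sum_gb k)) _.
by rewrite le_eqVlt; apply/orP; left; apply/eqP; ring.
Qed.

(** By [conn_incr], [conn e n] is a sum of increments composed with powers of the skew product. An
    increment has a factor [zeta] at its own time, hence a 1 / K, times a centred function that has
    already contracted. *)
Definition incr e n : paths Y * X -> fps R := fun z =>
  if n is n'.+1 then zeta (e - n) z * (conn e n' (tau z) - nextmean m T (conn e n') z.1)
  else zeta e z.

Lemma bmf_nextmeanx e n : bmf (fun z : paths Y * X => nextmean m T (conn e n) z.1).
Proof.
apply: (@bmf_comp R _ _ _ _ (nextmean m T (conn e n)) fst); last exact: measurable_fst.
by apply: (bmf_nextmean hmaps); exact: (bmf_conn hmaps bphi).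
Qed.

Lemma bmf_incr e n : bmf (incr e n).
Proof.
case: n => [|n]; first exact: bmf_zeta.
apply: bmfM; first exact: bmf_zeta.
apply: bmfB; last exact: bmf_nextmeanx.
by apply: bmf_comp; [exact: (bmf_conn hmaps bphi)|exact: (measurable_tau hmaps)].
Qed.

Lemma conn_incr e n z : conn e n.+1 z = incr e n.+1 z + conn e n (tau z).
Proof. by rewrite connS /incr; ring. Qed.

Definition pullx (U : paths Y * X -> fps R) w g k : X -> R := fun x => U (iter g tau (w, x)) k.

Lemma bm_pullx U w g k : bmf U -> bm (pullx U w g k).
Proof.
move=> bU; apply: (@bm_xsection _ _ _ _ _ (fun z => U (iter g tau z) k)).
by apply: (bm_comp (bU k)); exact: (measurable_iter_tau hmaps).
Qed.

Definition incr_bound e n := forall w k, good_orbit w ->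
  DB (fun x => incr e n (w, x) k) (gA ^+ k * gth ^+ n / K w).

Definition conn_bound e n := forall w g k, good_orbit w -> (0 < g)%N ->
  DB (fun x => pullx (conn e n) w g k x - mean m (pullx (conn e n) w g k))
     (gc * gA ^+ k * gth ^+ n * gth ^+ (2 * g)).

Let A0 : 0 <= gA. Proof. exact: ltW gA_gt0. Qed.
Let t0 : 0 <= gth. Proof. exact: ltW gth_gt0. Qed.
Let c0 : 0 < gc. Proof. exact: lt_le_trans gc_ge3. Qed.

Lemma pull_incr e n w g k : incr_bound e n -> good_orbit w -> (0 < g)%N ->
  DB (fun x => pullx (incr e n) w g k x - mean m (pullx (incr e n) w g k))
     (3 * gA ^+ k * gth ^+ n * gth ^+ (2 * g)).
Proof.
move=> IB gw g0; have gg := good_here gw.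
have Ke : 0 < K w * expR (- lam * g%:R) by rewrite mulr_gt0 ?expR_gt0.
have bI : bm (fun x => incr e n (path_shift g%:Z w, x) k).
  exact: (@bm_xsection _ _ _ _ _ (fun z => incr e n z k) _ (bmf_incr e n k)).
have := dual_bound_pull hv hmaps Ke (fibre_gap gg g0) bI (IB _ k (good_shift g gw)).
have -> : (fun x => incr e n (path_shift g w, orbit_map T g w x) k) = pullx (incr e n) w g k.
  by apply/funext => x; rewrite /pullx iter_skew.
rewrite (_ : (fun x => incr e n (path_shift g w, orbit_map T g w x) k - _) =
   (fun x => pullx (incr e n) w g k x - mean m (pullx (incr e n) w g k))); last first.
  by apply/funext => x; rewrite /pullx iter_skew.
move=> H; apply: (dual_bound_le H).
have -> : 3 * (K w * expR (- lam * g%:R) * (gA ^+ k * gth ^+ n / K (path_shift g%:Z w))) =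
    3 * gA ^+ k * gth ^+ n * (K w * expR (- lam * g%:R) / K (path_shift g%:Z w)) by ring.
by apply: ler_wpM2l; [rewrite !mulr_ge0 ?exprn_ge0|exact: K_ratio].
Qed.

Lemma pullxS e n w g k : pullx (conn e n.+1) w g k =
  fun x => pullx (incr e n.+1) w g k x + pullx (conn e n) w g.+1 k x.
Proof. by apply/funext => x; rewrite /pullx conn_incr coefD_fps iterS. Qed.

Lemma connB e n : bmf (conn e n). Proof. exact: (bmf_conn hmaps bphi). Qed.

(** Joint induction. The increment n + 1 uses [conn_bound] at g = 1, where [sum_gb] cancels [gc].
    For [conn], the new increment pulled by g and the old [conn] pulled by g + 1 add up to the
    constant 3 + gc * gth = gc; the latter gains gth ^ 2 per step while the claim asks for only one
    more [gth]. *)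
Lemma conn_incr_bounds e n : incr_bound e n /\ conn_bound e n.
Proof.
have hc := gc_ge3; have hA := gA_gt0.
elim: n => [|n [IHi IHc]].
  have I0 : incr_bound e 0.
    move=> w k gw; have gg := good_here gw.
    have H1 j : DB (fun x => (1 : fps R) j) (1 * gA ^+ j).
      case: j => [|j]; first by rewrite expr0 mulr1 coef1_fps; exact: (dual_bound1 hv).
      move=> psi L' _; rewrite coef1_fps pairing_cst// mul0r normr0.
      by rewrite mul1r exprn_ge0.
    have := @dual_bound_zetaM e w (fun _ => 1) 1 k gg (bmf_cst X 1) ler01 H1.
    rewrite (_ : (fun x => _) = (fun x => incr e 0 (w, x) k)); last first.
      by apply/funext => x; rewrite mulr1.
    move=> H; apply: (dual_bound_le H); rewrite expr0 mulr1.
    apply: ler_wpM2r; first by rewrite invr_ge0 (ltW (K0 w)).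
    apply: ler_piMl; first by rewrite exprn_ge0.
    by rewrite mul1r invf_le1; move: (gc) hc => c; lra.
  split=> // w g k gw g0.
  apply: (dual_bound_le (pull_incr k I0 gw g0)).
  by rewrite !ler_wpM2r ?exprn_ge0.
have IS : incr_bound e n.+1.
  move=> w k gw; have gg := good_here gw.
  pose U x := conn e n (tau (w, x)) - nextmean m T (conn e n) w.
  have bU : bmf U.
    apply: bmfB; last exact: bmf_cst.
    apply: (@bmf_xsection _ _ _ _ _ (fun z => conn e n (tau z))).
    by apply: bmf_comp; [exact: connB|exact: (measurable_tau hmaps)].
  have HU j : DB (fun x => U x j) (gc * gth ^+ n * gth ^+ 2 * gA ^+ j).
    have := IHc w 1%N j gw isT; rewrite muln1 (_ : gc * gA ^+ j * _ * _ = gc * gth ^+ n * gth ^+ 2 * gA ^+ j) //.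
    by ring.
  have Q0 : 0 <= gc * gth ^+ n * gth ^+ 2 by apply: mulr_ge0; [apply: mulr_ge0; [exact: ltW c0|exact: exprn_ge0]|exact: exprn_ge0].
  have := @dual_bound_zetaM (e - n.+1) w U _ k gg bU Q0 HU.
  move=> H; apply: (dual_bound_le H).
  rewrite ler_wpM2r ?invr_ge0 ?(ltW (K0 w))//.
  have -> : gc * gth ^+ n * gth ^+ 2 / (2 * gc) * gA ^+ k = gA ^+ k * gth ^+ n.+1 * (gth / 2).
    by rewrite (exprS gth n); field; rewrite gt_eqF.
  apply: ler_piMr; first by rewrite mulr_ge0 ?exprn_ge0.
  by have := gth_lt1; move: (gth) t0 => t; lra.
split=> // w g k gw g0; rewrite pullxS.
have b1 := bm_pullx w g k (bmf_incr e n.+1).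
have b2 := bm_pullx w g.+1 k (connB e n).
rewrite meanD// (_ : (fun x => _) = (fun x =>
   (pullx (incr e n.+1) w g k x - mean m (pullx (incr e n.+1) w g k)) +
   (pullx (conn e n) w g.+1 k x - mean m (pullx (conn e n) w g.+1 k)))); last first.
  by apply/funext => x; ring.
have H := dual_boundD (bmB b1 (bm_cst _ _)) (bmB b2 (bm_cst _ _))
  (pull_incr k IS gw g0) (IHc w g.+1 k gw isT).
apply: (dual_bound_le H).
rewrite mulnS exprD -[in leRHS]gc_eq [gth ^+ n.+1]exprS.
by rewrite le_eqVlt; apply/orP; left; apply/eqP; ring.
Qed.

(** Both means are close to the same number, the integral against the equivariant density at the
    common arrival fibre. The resulting constant 2 is raised to 3 so that [gc_eq] again closes the
    induction for [conn]. *)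
Lemma incr_shift_bound e n w g k : good_orbit w -> (0 < g)%N ->
  `|mean m (pullx (incr e n) w g.+1 k) - mean m (pullx (incr e n) (path_shift 1 w) g k)| <=
  3 * gA ^+ k * gth ^+ n * gth ^+ (2 * g).
Proof.
move=> gw g0; have [IB _] := conn_incr_bounds e n.
set w' := path_shift g.+1%:Z w; set w1 := path_shift 1 w.
have ww : path_shift g%:Z w1 = w' by rewrite path_shiftD /w'; congr (path_shift _ w); rewrite -addn1 PoszD.
have g1 : good_orbit w1 by exact: (good_shift 1).
have bI u : bm (fun x => incr e n (u, x) k).
  exact: (@bm_xsection _ _ _ _ _ (fun z => incr e n z k) _ (bmf_incr e n k)).
have Ke u (j : nat) : 0 < K u * expR (- lam * j%:R) by rewrite mulr_gt0 ?expR_gt0.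
have Hw' := IB w' k (good_shift _ gw).
have PE u j : pullx (incr e n) u j k =
   (fun x => incr e n (path_shift j%:Z u, orbit_map T j u x) k).
  by apply/funext => x; rewrite /pullx iter_skew.
have D u (gu : good_orbit u) j : pairing m (cfun (h u)) (fun x => incr e n (path_shift j%:Z u, orbit_map T j u x) k)
   = pairing m (cfun (h (path_shift j%:Z u))) (fun x => incr e n (path_shift j%:Z u, x) k).
  apply: (pairing_density hmaps j (bI _)).
    by move=> i; exact: fibre_dens (gu i).
  move=> i; have := fibre_equiv (gu i); apply: filterS => x ->.
  by rewrite path_shiftD; congr (cfun (h (path_shift _ _)) _).
have H1 := mean_vs_density hv hmaps (Ke w g.+1) (fibre_gap (good_here gw) (ltn0Sn g))
  (bI w') Hw' (fibre_dens (good_here gw)).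
have Hw1 : DB (fun x => incr e n (path_shift g%:Z w1, x) k) (gA ^+ k * gth ^+ n / K w').
  by rewrite ww.
have H2 := mean_vs_density hv hmaps (Ke w1 g) (fibre_gap (good_here g1) g0)
  (bI _) Hw1 (fibre_dens (good_here g1)).
rewrite (D w gw g.+1) -PE in H1; rewrite (D w1 g1 g) -PE ww in H2.
have q0 : 0 <= gA ^+ k * gth ^+ n by rewrite mulr_ge0 ?exprn_ge0.
have k1 : K w * expR (- lam * g.+1%:R) * (gA ^+ k * gth ^+ n / K w') <=
    gA ^+ k * gth ^+ n * gth ^+ (2 * g).
  rewrite (_ : _ * (_ / _) = gA ^+ k * gth ^+ n * (K w * expR (- lam * g.+1%:R) / K w')); last by ring.
  apply: ler_wpM2l => //; apply: le_trans (K_ratio g.+1 (good_here gw)) _.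
  by apply: ler_wiXn2l; rewrite ?(ltW gth_lt1)// leq_mul2l leqnSn orbT.
have k2 : K w1 * expR (- lam * g%:R) * (gA ^+ k * gth ^+ n / K w') <=
    gA ^+ k * gth ^+ n * gth ^+ (2 * g).
  rewrite (_ : _ * (_ / _) = gA ^+ k * gth ^+ n * (K w1 * expR (- lam * g%:R) / K w')); last by ring.
  by apply: ler_wpM2l => //; rewrite -ww; exact: (K_ratio g (good_here g1)).
have q1 : 0 <= gA ^+ k * gth ^+ n * gth ^+ (2 * g) by rewrite mulr_ge0 ?exprn_ge0.
set a := mean m _ in H1 *; set b := mean m _ in H2 *; set p := pairing _ _ _ in H1 H2.
rewrite (_ : a - b = (a - p) - (b - p)); last by ring.
apply: le_trans (ler_normB _ _) _.
rewrite (_ : 3 * gA ^+ k * gth ^+ n * gth ^+ (2 * g) = 3 * (gA ^+ k * gth ^+ n * gth ^+ (2 * g))); last by ring.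
apply: le_trans (lerD (le_trans H1 k1) (le_trans H2 k2)) _.
by rewrite -mulr2n -[X in X <= _]mulr_natl ler_pM// ler_nat.
Qed.

Lemma conn_shift_bound e n w g k : good_orbit w -> (0 < g)%N ->
  `|mean m (pullx (conn e n) w g.+1 k) - mean m (pullx (conn e n) (path_shift 1 w) g k)| <=
  gc * gA ^+ k * gth ^+ n * gth ^+ (2 * g).
Proof.
have hc := gc_ge3; move=> gw; elim: n g => [|n IH] g g0.
  apply: le_trans (incr_shift_bound e 0 k gw g0) _.
  by rewrite !ler_wpM2r ?exprn_ge0.
rewrite !pullxS !meanD; try by [exact: (bm_pullx _ _ _ (bmf_incr _ _))|exact: (bm_pullx _ _ _ (connB _ _))].
set a := mean m (pullx (incr _ _) w _ _); set b := mean m (pullx (incr _ _) _ _ _).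
set a' := mean m (pullx (conn _ _) w _ _); set b' := mean m (pullx (conn _ _) _ _ _).
rewrite (_ : a + a' - (b + b') = (a - b) + (a' - b')); last by ring.
apply: le_trans (ler_normD _ _) _.
apply: le_trans (lerD (incr_shift_bound e n.+1 k gw g0) (IH g.+1 isT)) _.
rewrite mulnS exprD -[in leRHS]gc_eq [gth ^+ n.+1]exprS.
by rewrite le_eqVlt; apply/orP; left; apply/eqP; ring.
Qed.

Lemma norm_zeta j z k : `|zeta j z k| <= gb ^+ k.
Proof.
have hb := gb_ge1; case: k => [|k]; first by rewrite zeta_coef0 normr0 expr0.
have [c c1 ->] := zeta_coef j k; rewrite normrM normrX.
apply: le_trans (ler_wpM2r _ c1) _; rewrite ?exprn_ge0// mul1r.
rewrite lerXn2r ?nnegrE ?(le_trans ler01 hb)// (le_trans (phiB z))//.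
by rewrite /gb -mulrA; have : 0 <= Cv * B by [rewrite mulr_ge0]; move: (Cv * B) => u; lra.
Qed.

Lemma norm_phi z : `|phi z| <= gb.
Proof.
rewrite (le_trans (phiB z))// /gb -mulrA.
by have : 0 <= Cv * B by [rewrite mulr_ge0]; move: (Cv * B) => u; lra.
Qed.

(** Here a composed observable serves as a test function, so its variation is needed. Composition
    with [T w] costs [K w], which the 1 / K of the next fibre compensates up to exp eps <= 1 /
    gth. *)
Lemma BVnorm_phiT w r : good_fibre w -> good_fibre (path_shift 1 w) ->
  (BVnorm m v (cfun (fun x => phi (tau (w, x)) ^+ r.+1)%R) <= (2 * gb ^+ r.+1 / gth)%:E)%E.
Proof.
move=> gw gw1; have hb := gb_ge1; have b0 : 0 <= gb by exact: le_trans hb.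
have bX : bm (fun x => phi (path_shift 1 w, x) ^+ r.+1) by exact: bmX.
have bY : bm (fun x => phi (tau (w, x)) ^+ r.+1).
  by apply: bmX; apply: (@bm_comp _ _ _ _ _ (fun x => phi (path_shift 1 w, x)) (T w)); [exact: bphix|case: (maps_nonsingular hmaps w)].
have -> : 2 * gb ^+ r.+1 / gth = gb ^+ r.+1 / gth + gb ^+ r.+1 / gth by ring.
rewrite EFinD; apply: leeD.
  apply: (@le_trans _ _ (gb ^+ r.+1)%:E); last first.
    by rewrite lee_fin ler_peMr ?exprn_ge0// invf_ge1 ?ltW ?gth_lt1 ?gth_gt0.
  have := cLnorm1_mul (cLfun1_cst m 1) bY (exprn_ge0 r.+1 b0).
  rewrite (_ : (_ \* _)%R = cfun (fun x => phi (tau (w, x)) ^+ r.+1)); last first.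
    by apply/funext => x /=; rewrite mul1r.
  move=> /(_ _)/le_trans; apply.
    by apply: aeW => x; rewrite normrX lerXn2r ?nnegrE ?norm_phi.
  have := BVnorm_cst1 hv; rewrite /BVnorm (var_cst hv) adde0 => C1.
  by rewrite [cLnorm _ _ _]C1 mule1.
have B1 := BVnorm_phiX r.+1 gw1.
have BVX := BV_BVnorm hv (cLfun1_cfun m bX) B1.
apply: (le_trans (fibre_var gw BVX)).
have V1 : (v (cfun (fun x => phi (path_shift 1 w, x) ^+ r.+1)%R) <= (gb ^+ r.+1 * (K (path_shift 1 w))^-1)%:E)%E.
  by apply: le_trans B1; rewrite /BVnorm leeDr// cLnorm1_ge0.
apply: le_trans (lee_wpmul2l _ V1) _; first by rewrite lee_fin ltW.
rewrite -EFinM lee_fin mulrCA ler_wpM2l ?exprn_ge0// ler_pdivrMr// mulrC.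
apply: le_trans (fibre_growth gw 1%N) _; apply: ler_wpM2l; first exact: ltW.
by rewrite mulr1 /gth -expRN opprK ler_expR ltW.
Qed.

Lemma norm_nextmean_zeta j w k : `|nextmean m T (zeta j) w k| <= gb ^+ k.
Proof.
rewrite /nextmean /fmean /=; apply: mean_le_norm => [|x]; last exact: norm_zeta.
apply: (@bm_xsection _ _ _ _ _ (fun z => zeta j (tau z) k)).
by apply: (@bm_comp _ _ _ _ _ (fun z => zeta j z k)); [exact: bmf_zeta|exact: (measurable_tau hmaps)].
Qed.

Definition gA0 := 3 * gc.

(** For adjacent times only one mean of [zeta] is left. Otherwise the recursion of [conn] splits the
    difference into a correlation of [zeta] with a centred [conn], treated by duality, and 1 plus
    the mean of [zeta] times the effect of starting one step later, treated by [conn_shift_bound].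
    The two parts give 1 + 3 / 2 gc, at most [gA0 = 3 gc]. *)
Lemma fibreX_bound l e w k : good_orbit w -> (l < e)%N ->
  `|fibreX m T phi M l e w k| <= gA0 * gth ^+ (e - l).-1 * gA ^+ k.
Proof.
move=> gw; rewrite /fibreX /acoef => le; rewrite le.
have hb := gb_ge1; have hc := gc_ge3; have hA := gA_gt0; have b0 : 0 <= gb by exact: le_trans hb.
set w' := path_shift l%:Z w; have gw' : good_orbit w' by exact: good_shift.
set w2 := path_shift l.+1%:Z w.
have [j jE] : exists j, j = (e - (e - l.+1))%N by exists (e - (e - l.+1))%N.
case: (gapP le) jE => [_|n jE].
  rewrite subr0 expr0 mulr1; apply: le_trans (norm_nextmean_zeta _ _ _) _.
  apply: (@le_trans _ _ (gA ^+ k)).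
    by rewrite lerXn2r ?nnegrE// (le_trans _ gA_ge)// ler_peMl// ler1n.
  by apply: ler_peMl; [exact: exprn_ge0|rewrite /gA0; move: (gc) hc => c; lra].
rewrite [_.-1]/=.
have -> : w2 = path_shift 1 w'.
  by rewrite /w2 path_shiftD; congr (path_shift _ w); rewrite -addn1 PoszD addrC.
set w1 := path_shift 1 w'; have gw1 : good_orbit w1 by exact: (good_shift 1).
pose ze x := zeta j (tau (w', x)).
pose H x := conn e n (tau (tau (w', x))).
set yb := nextmean m T (conn e n) w1.
have bz : bmf ze.
  apply: (@bmf_xsection _ _ _ _ _ (fun z => zeta j (tau z))).
  by apply: bmf_comp; [exact: bmf_zeta|exact: (measurable_tau hmaps)].
have bH : bmf H.
  by move=> i; exact: (bm_pullx w' 2 i (connB e n)).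
set Hb := meanf m H.
have -> : nextmean m T (conn e n.+1) w' - yb =
    meanf m (fun x => ze x * (H x - Hb)) + (1 + meanf m ze) * (Hb - yb).
  rewrite /nextmean /fmean.
  rewrite (_ : (fun x => _) = (fun x => ze x * (H x - Hb) + ((Hb - yb) * ze x + H x))); last first.
    by apply/funext => x; rewrite connS -jE /= -/(ze x) -/yb -/(H x); ring.
  rewrite meanfD; [|by apply: bmfM => //; apply: bmfB => //; exact: bmf_cst|].
    by rewrite meanfD ?meanfZ// -/Hb; [ring|apply: bmfM => //; exact: bmf_cst].
  by apply: bmfD => //; apply: bmfM => //; exact: bmf_cst.
have HbE i : Hb i = mean m (pullx (conn e n) w' 2 i) by [].
have HH i : DB (fun x => H x i - Hb i) (gc * gA ^+ i * gth ^+ n * gth ^+ 4).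
  have := (conn_incr_bounds e n).2 w' 2%N i gw' isT.
  by rewrite (_ : (2 * 2)%N = 4%N).
have bHH i : bm (fun x => H x i - Hb i) by apply: bmB; [exact: bH|exact: bm_cst].
have sb := conn_shift_bound e n (w := w') (g := 1%N) _ gw' isT.
have sb' i : `|Hb i - yb i| <= gc * gA ^+ i * gth ^+ n * gth ^+ 2 by exact: sb.
rewrite coefD_fps.
apply: le_trans (ler_normD _ _) _.
have T1 : `|meanf m (fun x => ze x * (H x - Hb)) k| <= gth ^+ n.+1 * gA ^+ k.
  rewrite /= mean_sum; last first.
    by move=> i; apply: bmM; [exact: bz|exact: bHH].
  apply: le_trans (ler_norm_sum _ _ _) _.
  apply: (@le_trans _ _ (\sum_(i < k.+1) (if val i is 0%N then 0 else gb ^+ i * gA ^+ (k - i)) *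
     (2 * gc * gth ^+ n * gth ^+ 3))).
    apply: ler_sum => -[[|i] ik] _ /=.
      rewrite mul0r (_ : (fun x => _) = (fun x => 0)) ?mean_cst ?normr0//.
      by apply/funext => x; rewrite zeta_coef0 mul0r.
    have [c c1 Hc] := zeta_coef j i.
    rewrite (_ : (fun x => _) = (fun x => c * (phi (tau (w', x)) ^+ i.+1 * (H x (k - i.+1)%N - Hb (k - i.+1)%N)))); last first.
      by apply/funext => x; rewrite /ze Hc mulrA.
    have bp : bm (fun x => phi (tau (w', x)) ^+ i.+1).
      by apply: bmX; apply: (@bm_comp _ _ _ _ _ (fun x => phi (path_shift 1 w', x)) (T w')); [exact: bphix|case: (maps_nonsingular hmaps w')].
    rewrite meanZ; last by apply: bmM.
    rewrite normrM -pairing_cfun.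
    apply: (@le_trans _ _ (1 * (2 * gb ^+ i.+1 / gth * (gc * gA ^+ (k - i.+1) * gth ^+ n * gth ^+ 4)))).
      apply: ler_pM => //.
      have C0 : 0 < 2 * gb ^+ i.+1 / gth.
        by rewrite divr_gt0 ?gth_gt0// mulr_gt0// exprn_gt0// (lt_le_trans ltr01).
      apply: (dual_bound_scale hv (bHH _) (HH _) (cLfun1_cfun m bp) C0).
      by apply: BVnorm_phiT; exact: good_here.
    rewrite le_eqVlt; apply/orP; left; apply/eqP; field.
    by rewrite gt_eqF// gth_gt0.
  rewrite -mulr_suml; apply: le_trans (ler_wpM2r _ (sum_gb k)) _.
    apply: mulr_ge0; last exact: exprn_ge0.
    by apply: mulr_ge0; [apply: mulr_ge0; [|exact: ltW c0]|exact: exprn_ge0].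
  have -> : gA ^+ k / (2 * gc) * (2 * gc * gth ^+ n * gth ^+ 3) = gth ^+ n.+1 * gA ^+ k * gth ^+ 2.
    by rewrite (exprS gth n) ; field; rewrite gt_eqF.
  by apply: ler_piMr; [rewrite mulr_ge0 ?exprn_ge0|rewrite exprn_ile1// ltW// gth_lt1].
have T2 : `|((1 + meanf m ze) * (Hb - yb)) k| <= 3 / 2 * gc * gth ^+ n.+1 * gA ^+ k.
  rewrite coefM_fps; apply: le_trans (ler_norm_sum _ _ _) _.
  apply: (@le_trans _ _ (\sum_(i < k.+1) gb ^+ i * gA ^+ (k - i) * (gc * gth ^+ n * gth ^+ 2))).
    apply: ler_sum => i _; rewrite normrM.
    rewrite -[X in _ <= X]mulrA; apply: ler_pM => //.
      case: i => -[|i] ik /=.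
        rewrite (_ : (fun x => _) = (fun x => 0)) ?mean_cst ?addr0 ?normr1//.
        by apply/funext => x; rewrite /ze zeta_coef0.
      rewrite add0r.
      by apply: mean_le_norm => [|x]; [exact: bz|exact: norm_zeta].
    apply: le_trans (sb' _) _; rewrite le_eqVlt; apply/orP; left; apply/eqP; ring.
  rewrite -mulr_suml; apply: le_trans (ler_wpM2r _ (sum_gb0 k)) _.
    by apply: mulr_ge0; [apply: mulr_ge0; [exact: ltW c0|exact: exprn_ge0]|exact: exprn_ge0].
  have -> : 3 / 2 * gA ^+ k * (gc * gth ^+ n * gth ^+ 2) = 3 / 2 * gc * gth ^+ n.+1 * gA ^+ k * gth.
    by rewrite (exprS gth n); ring.
  apply: ler_piMr; last by rewrite ltW// gth_lt1.
  apply: mulr_ge0; last exact: exprn_ge0.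
  by apply: mulr_ge0; [apply: mulr_ge0; [|exact: ltW c0]|exact: exprn_ge0].
apply: le_trans (lerD T1 T2) _.
have : 0 <= gth ^+ n.+1 * gA ^+ k by rewrite mulr_ge0 ?exprn_ge0.
rewrite -[3 / 2 * gc * _ * _]mulrA -[gA0 * _ * _]mulrA /gA0; move: (gth ^+ n.+1 * gA ^+ k) (gc) hc => u c c3 u0.
by nra.
Qed.

End FibreBounds.

(** * Cumulants of the fibre means *)

Section ClippedRecursion.
Context dY (Y : measurableType dY) (R : realType).

Definition clip (c x : R) := Num.max (- c) (Num.min c x).

Lemma norm_clip c x : 0 <= c -> `|clip c x| <= c.
Proof. by move=> c0; rewrite /clip ler_norml le_max lexx ge_max ge_min lexx /= andbT; lra. Qed.

Lemma clip_id c x : `|x| <= c -> clip c x = x.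
Proof. by rewrite ler_norml => /andP[xc cx]; rewrite /clip min_r// max_r. Qed.

Lemma bm_clip d (T : measurableType d) (c : R) (f : T -> R) : 0 <= c -> measurable_fun setT f ->
  bm (fun x => clip c (f x)).
Proof.
move=> c0 mf; split; last by exists c => x; exact: norm_clip.
by apply: measurable_maxr => //; apply: measurable_minr.
Qed.

Variable X : nat -> nat -> paths Y -> fps R.
Implicit Types e l : nat.

(* [recursion_table X e] solves the recursion up to index [e] and is constant afterwards. *)
Fixpoint recursion_table e : nat -> paths Y -> fps R :=
  if e is e'.+1 then fun l w =>
    if (l <= e')%N then recursion_table e' l w
    else recursion_table e' e' w + \sum_(i < e) X i e w * recursion_table e' i w
  else fun _ _ => 1.

Definition recursion_solution e := recursion_table e e.

Lemma recursion_tableE e l w : (l <= e)%N -> recursion_table e l w = recursion_solution l w.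
Proof.
elim: e => [|e IH]; first by rewrite leqn0 => /eqP->.
by rewrite leq_eqVlt => /orP[/eqP->//|]; rewrite ltnS /= => le; rewrite le IH.
Qed.

Lemma recursion_solutionS e w : recursion_solution e.+1 w =
  recursion_solution e w + \sum_(l < e.+1) X l e.+1 w * recursion_solution l w.
Proof.
rewrite {1}/recursion_solution /= ltnn; congr (_ + _).
by apply: eq_bigr => l _; rewrite recursion_tableE// -ltnS.
Qed.

Lemma bmf_recursion_solution : (forall l e, bmf (X l e)) -> forall e, bmf (recursion_solution e).
Proof.
move=> bX; elim/ltn_ind => -[_|e IH]; first exact: bmf_cst.
rewrite (_ : recursion_solution e.+1 = fun w =>
  recursion_solution e w + \sum_(l < e.+1) X l e.+1 w * recursion_solution l w); last first.
  by apply/funext => w; rewrite recursion_solutionS.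
apply: bmfD; first exact: IH.
rewrite (_ : (fun w => _) = (fun w => \sum_(i <- iota 0 e.+1)
   (if (i < e.+1)%N then X i e.+1 w * recursion_solution i w else 0))); last first.
  apply/funext => w; rewrite -[iota 0 e.+1]/(index_iota 0 e.+1) big_mkord.
  by apply: eq_bigr => i _; rewrite ltn_ord.
apply: bmf_sum => i; case E : (i < e.+1)%N; last exact: bmf_cst.
by apply: bmfM => //; exact: IH.
Qed.

End ClippedRecursion.

Section CumulantsOfRecursion.
Context dY (Y : measurableType dY) (R : realType).
Variable P : probability (paths Y) R.
Variables A0 A th C1 c2 eta : R.
Hypotheses (A00 : 0 < A0) (A_gt0 : 0 < A) (th0 : 0 < th) (th1 : th < 1) (C11 : 1 <= C1).
Hypotheses (c20 : 0 < c2) (eta0 : 0 < eta).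
Hypothesis mixing : forall (c n : nat) (f g : paths Y -> R) (F G : R),
  measurable_fun setT f -> measurable_fun setT g ->
  past c%:Z f -> future (c + n)%N%:Z g ->
  (forall w, `|f w| <= F) -> (forall w, `|g w| <= G) ->
  `|cov P f g| <= C1 * expR (- c2 * n%:R `^ eta) * F * G.
Variables (X : nat -> nat -> paths Y -> fps R) (G : nat -> paths Y -> fps R).
Hypothesis bX : forall l e, bmf (X l e).
Hypothesis bG : forall e, bmf (G e).
Hypothesis Xpast : forall l e, past e%:Z (X l e).
Hypothesis Xfuture : forall l e, future l%:Z (X l e).
Hypothesis Xmaj : {ae P, forall w, forall l e, (l < e)%N ->
  maj (X l e w) (fscale (A0 * th ^+ (e - l).-1) (gser A))}.
Hypothesis G0 : forall w, G 0 w = 1.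
Hypothesis GS : forall e w, G e.+1 w = G e w + \sum_(l < e.+1) X l e.+1 w * G l w.

Let bound l e k := fscale (A0 * th ^+ (e - l).-1) (gser A) k.
Let bound_ge0 l e k : 0 <= bound l e k.
Proof.
rewrite /bound /=; case: k => [|k]; first by rewrite mulr0.
by rewrite !mulr_ge0 ?exprn_ge0// ltW.
Qed.
(** The majorants hold almost surely only; clipping each coefficient makes them sure and preserves
    the coordinates depended upon. [G] is rebuilt from the clipped coefficients because the
    recursion is used at every point. *)
Let X' l e w : fps R := Fps (fun k => clip (bound l e k) (X l e w k)).
Let G' := recursion_solution X'.

Let bX' l e : bmf (X' l e).
Proof. by move=> k; apply: bm_clip => //; exact: (bX l e k).1. Qed.
Let X'maj l e w : (l < e)%N -> maj (X' l e w) (fscale (A0 * th ^+ (e - l).-1) (gser A)).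
Proof. by move=> _ k; exact: norm_clip. Qed.
Let X'past l e : (l < e)%N -> past e%:Z (X' l e).
Proof. by move=> _ w w' /Xpast ww'; rewrite /X' ww'. Qed.
Let X'future l e : (l < e)%N -> future l%:Z (X' l e).
Proof. by move=> _ w w' /Xfuture ww'; rewrite /X' ww'. Qed.

Let G'E : {ae P, forall w, forall e, G' e w = G e w}.
Proof.
move: Xmaj; apply: filterS => w H; elim/ltn_ind => -[_|e IH]; first by rewrite G0.
rewrite /G' recursion_solutionS GS -!/(G' _) IH//; congr (_ + _).
apply: eq_bigr => l _; rewrite -!/(G' _) IH//; congr (_ * _).
by apply: fpsP => k /=; apply: clip_id; exact: H.
Qed.

Lemma cumulants_of_recursion p M n : (0 < p)%N -> (forall e, (e <= M)%N -> meanf P (G e) = 1) ->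
  exists kap : fps R, [/\ kap 0%N = 0, meanf P (G (M + n)%N) = fexp kap &
    nrm (radius A0 A th C1 c2 eta p) p kap <= n%:R * slope th c2 eta p].
Proof.
move=> p0 GM.
have bG' e : bmf (G' e) by exact: bmf_recursion_solution.
have G'0 w : G' 0%N w = 1 by [].
have G'S e w : G' e.+1 w = G' e w + \sum_(l < e.+1) X' l e.+1 w * G' l w.
  exact: recursion_solutionS.
have E e : meanf P (G' e) = meanf P (G e).
  apply: fpsP => k /=; apply: mean_ae; [exact: bG'|exact: bG|].
  by move: G'E; apply: filterS => w ->.
pose kap := cumulant (fun e => meanf P (G' e)).
exists (kap (M + n)%N); split.
- exact: cumulant0.
- by rewrite -E; exact: (@fexp_cumulant _ _ _ P _ _ _ _ X'maj _ G'0 G'S).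
- have := nrm_cumulant bX' A00 A_gt0 th0 th1 C11 c20 eta0 X'maj X'past X'future mixing
    p0 bG' G'0 G'S M n.
  (* The means equal 1 up to time M, so the cumulant is still 0 there and only [n] steps are
     counted: the bound is uniform in M. *)
  suff -> : cumulant (fun e => meanf P (G' e)) M = 0 by rewrite subr0.
  have : (M <= M)%N by []; elim: {1 3}M => // e IH eM.
  rewrite (cumulant_eq X'maj G'0 G'S) ?IH//; first exact: ltnW.
  by rewrite !E !GM// ltnW.
Qed.

End CumulantsOfRecursion.

Section MixingConstant.
Context dU (U : measurableType dU) dY (Y : measurableType dY) (R : realType).
Variables (PU : probability U R) (xi : int -> U -> Y).
Variable P : probability (paths Y) R.
Hypothesis hbase : stationary_base PU xi P.
Variables c1 c2 eta : R.
Hypotheses (c10 : 0 < c1) (eta0 : 0 < eta).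
Hypothesis hmix : forall n : nat, (0 < n)%N ->
  (alpha_mix PU xi n <= (c1 * expR (- c2 * n%:R `^ eta))%:E)%E.

(** The mixing hypothesis concerns n > 0, but consecutive intervals of a chain may touch. At n = 0
    the trivial bound 2 F G applies, whence the 2 added to 4 c1, which also makes the constant at
    least 1. *)
Lemma cov_mixing (c n : nat) (f g : paths Y -> R) (F G : R) :
  measurable_fun setT f -> measurable_fun setT g ->
  past c%:Z f -> future (c + n)%N%:Z g ->
  (forall w, `|f w| <= F) -> (forall w, `|g w| <= G) ->
  `|cov P f g| <= (4 * c1 + 2) * expR (- c2 * n%:R `^ eta) * F * G.
Proof.
move=> mf mg pf fg fF gG.
have F0 : 0 <= F by exact: le_trans (normr_ge0 _) (fF point).
have G0 : 0 <= G by exact: le_trans (normr_ge0 _) (gG point).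
case: n fg => [_|n fg].
  have bf : bm f by split=> //; exists F.
  have bg : bm g by split=> //; exists G.
  rewrite powR0 ?gt_eqF// mulr0 expR0 mulr1 /cov.
  apply: le_trans (ler_normB _ _) _; rewrite normrM.
  apply: (@le_trans _ _ (F * G + F * G)); last first.
    have := mulr_ge0 (ltW c10) (mulr_ge0 F0 G0); rewrite -mulrA.
    by move: (F * G) => u; lra.
  apply: lerD; last by apply: ler_pM => //; exact: mean_le_norm.
  by apply: mean_le_norm => [|w]; [exact: bmM|rewrite normrM ler_pM].
apply: le_trans (cov_mix hbase hmix (ltn0Sn n) mf mg pf _ fF gG) _.
  by rewrite -PoszD.
rewrite -![_ * F * G]mulrA; apply: ler_wpM2r; first exact: mulr_ge0.
rewrite mulrA; apply: ler_wpM2r; first exact: expR_ge0.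
by rewrite lerDl.
Qed.

End MixingConstant.

Section FibreCumulants.
Context d (X : measurableType d) dU (U : measurableType dU) dY (Y : measurableType dY) (R : realType).
Variables (m : probability X R) (v : (X -> R[i]) -> \bar R) (Cv : R).
Hypothesis hv : is_variation m v Cv.
Variables (T : paths Y -> X -> X) (L : paths Y -> (X -> R[i]) -> (X -> R[i])).
Hypothesis hmaps : random_maps m T L.
Variable h : paths Y -> X -> R.
Variable phi : paths Y * X -> R.
Hypothesis mphi : measurable_fun setT phi.
Variable B : R.
Hypothesis B0 : 0 <= B.
Hypothesis phiB : forall z, `|phi z| <= Cv * B.
Hypothesis phi0 : forall w w' x, w 0 = w' 0 -> phi (w, x) = phi (w', x).
Variables (lam eps : R) (K : paths Y -> R).
Hypotheses (lam0 : 0 < lam) (eps_lam : eps < lam / 3) (K1 : forall w, 1 < K w).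
Variables (PU : probability U R) (xi : int -> U -> Y).
Variable P : probability (paths Y) R.
Hypothesis hbase : stationary_base PU xi P.
Variables c1 c2 eta : R.
Hypotheses (c10 : 0 < c1) (c20 : 0 < c2) (eta0 : 0 < eta).
Hypothesis hmix : forall n : nat, (0 < n)%N ->
  (alpha_mix PU xi n <= (c1 * expR (- c2 * n%:R `^ eta))%:E)%E.
Hypothesis orbit_ae : {ae P, forall w, good_orbit m v T L h phi B lam eps K w}.

Definition system_radius := radius (gA0 lam) (gA Cv B lam) (gth lam) (4 * c1 + 2) c2 eta.
Definition system_slope := slope (gth lam) c2 eta.

Lemma fibre_cumulants M p n : (0 < p)%N ->
  exists kap : fps R, [/\ kap 0%N = 0, meanf P (fibreG m T phi M (M + n)%N) = fexp kap &
    nrm (system_radius p) p kap <= n%:R * system_slope p].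
Proof.
have bphi : bm phi by split=> //; exists (Cv * B).
move=> p0; apply: (@cumulants_of_recursion _ _ _ P _ _ _ _ _ _ _ _ _ _ _ _ _ _
  (fibreX m T phi M) (fibreG m T phi M)) => //.
- by rewrite /gA0 mulr_gt0// (lt_le_trans _ (gc_ge3 lam0)).
- exact: (gA_gt0 hv).
- exact: gth_gt0.
- exact: gth_lt1.
- by move: c10; lra.
- exact: (cov_mixing hbase c10 eta0 hmix).
- by move=> l e; exact: (bmf_fibreX hmaps).
- by move=> e; exact: (bmf_fibreG hmaps).
- by move=> l e; exact: (fibreX_past hmaps).
- by move=> l e; exact: (fibreX_future hmaps).
- move: orbit_ae; apply: filterS => w gw l e le [|k].
    by rewrite fibreX_coef0 normr0 /= mulr0.
  exact: (fibreX_bound hv hmaps mphi B0 phiB lam0 eps_lam K1 M k.+1 gw le).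
- by move=> w; exact: fibreG0.
- by move=> e w; exact: (fibreG_recursion hmaps).
- move=> e eM; rewrite (_ : fibreG m T phi M e = fun _ => 1) ?meanf_cst//.
  by apply/funext => w; rewrite fibreG_early.
Qed.

End FibreCumulants.

(** * Convergence to the invariant density *)

Section MonotoneClass.
Context d (T : measurableType d) (R : realType).
Variable S : (T -> R) -> Prop.
Hypothesis S1 : forall A, measurable A -> S \1_A.
Hypothesis SD : forall f g, bm f -> bm g -> S f -> S g -> S (fun x => f x + g x).
Hypothesis SZ : forall (c : R) f, bm f -> S f -> S (fun x => c * f x).
Hypothesis Slim : forall f, bm f ->
  (forall e : R, 0 < e -> exists2 g, bm g /\ S g & forall x, `|f x - g x| <= e) -> S f.

(** After an affine change to [0, 1], a bounded function is a uniform limit of the staircases of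
    [level_approx], which are combinations of indicators. *)
Lemma bm_class f : bm f -> S f.
Proof.
move=> bf; have [mf [C fC]] := bf.
pose C' := `|C| + 1; have C'0 : 0 < C' by rewrite /C' ltr_wpDl.
pose f1 x := (2 * C')^-1 * (f x + C').
have b1 : bm f1 by apply: bmZ; apply: bmD => //; exact: bm_cst.
have f01 x : 0 <= f1 x <= 1.
  have := fC x; rewrite ler_norml => /andP[H1 H2]; have H3 := ler_norm C.
  rewrite /f1 mulr_ge0 ?invr_ge0//=; [|by rewrite mulr_ge0// ltW|]; last 1 first.
  - by rewrite /C'; move: H1 H3; move: (f x) `|C| => a b; lra.
  rewrite ler_pdivrMl ?mulr_gt0// mulr1 /C'.
  by move: H2 H3; move: (f x) `|C| => a b; lra.
have S1T : S (fun _ => 1).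
  have := S1 measurableT; congr S; apply/funext => x.
  by rewrite indicE in_setT.
have b1T : bm (fun _ : T => 1 : R) by exact: bm_cst.
suff S01 : S f1.
  have := SD (bmZ (2 * C') b1) (bmZ (- C') b1T) (SZ (2 * C') b1 S01) (SZ (- C') b1T S1T).
  congr S; apply/funext => x; rewrite /f1; field.
  by rewrite gt_eqF.
apply: Slim => // e e0.
pose k := (Num.truncn e^-1).+1.
have ke : k%:R^-1 <= e.
  rewrite invf_ple ?posrE//; apply/ltW; exact: truncnS_gt.
exists (fun x => k%:R^-1 * \sum_(i < k) \1_(level f1 k i) x); last first.
  by move=> x; apply: le_trans (level_approx (ltn0Sn _) (f01 x)) ke.
have mL i : measurable (level f1 k i).
  rewrite /level -[X in measurable X]setTI.
  have -> : [set x | i.+1%:R / k%:R <= f1 x] = f1 @^-1` `[i.+1%:R / k%:R, +oo[.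
    by apply/seteqP; split=> x /=; rewrite in_itv /= andbT.
  exact: b1.1.
have bs (s : seq 'I_k) : bm (fun x => \sum_(i <- s) \1_(level f1 k i) x : R).
  by apply: bm_sum => i; exact: bm_indic.
split; first exact: bm_level b1.1.
apply: SZ; first exact: bs.
elim: (index_enum _) => [|i s IH].
  have := SZ 0 b1T S1T; congr S; apply/funext => x.
  by rewrite big_nil mul0r.
have := SD (bm_indic R (mL i)) (bs s) (S1 (mL i)) IH; congr S; apply/funext => x.
by rewrite big_cons.
Qed.

End MonotoneClass.

Section Stationarity.
Context dU (U : measurableType dU) dY (Y : measurableType dY) (R : realType).
Variables (PU : probability U R) (xi : int -> U -> Y).
Variable P : probability (paths Y) R.
Hypothesis hbase : stationary_base PU xi P.

Lemma mean_shift k f : bm f -> mean P (fun w => f (path_shift k w)) = mean P f.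
Proof.
pose sh (f : paths Y -> R) w := f (path_shift k w).
have bsh g : bm g -> bm (sh g).
  by move=> bg; apply: (bm_comp bg); exact: measurable_path_shift.
apply: (@bm_class _ _ _ (fun f => mean P (sh f) = mean P f)).
- move=> A mA; have mS : measurable (path_shift k @^-1` A).
    by have := measurable_path_shift k measurableT mA; rewrite setTI.
  have -> : sh \1_A = \1_(path_shift k @^-1` A).
    by apply/funext => w; rewrite /sh !indicE; congr (_%:R); apply/idP/idP; rewrite !inE.
  by rewrite !mean_indic// (shift_law hbase).
- by move=> f1 f2 b1 b2 e1 e2; rewrite /sh !meanD// -/(sh f1) -/(sh f2) ?e1 ?e2//; exact: bsh.
- by move=> c f1 b1 e1; rewrite /sh !meanZ// -/(sh f1) ?e1//; exact: bsh.
- move=> f1 b1 H; apply/eqP; rewrite -subr_eq0 -normr_le0; apply/ler_addgt0Pl => e e0.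
  have e20 : 0 < e / 2 by rewrite divr_gt0.
  have [g [bg Sg] fg] := H _ e20; rewrite addr0.
  rewrite (_ : mean P (sh f1) - mean P f1 =
     mean P (fun w => sh f1 w - sh g w) + mean P (fun w => g w - f1 w)); last first.
    by rewrite !meanB ?Sg; [ring|..]; try exact: bsh.
  rewrite (splitr e); apply: le_trans (ler_normD _ _) _; apply: lerD.
    by apply: mean_le_norm => [|w]; [apply: bmB; exact: bsh|exact: fg].
  by apply: mean_le_norm => [|w]; [exact: bmB|rewrite distrC; exact: fg].
Qed.

Lemma ae_shift (Q : paths Y -> Prop) : {ae P, forall w, Q w} ->
  {ae P, forall w, forall k : nat, Q (path_shift k%:Z w)}.
Proof.
move=> [A [mA A0 QA]]; apply: ae_foralln => k.
exists (path_shift k%:Z @^-1` A); split.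
- by have := measurable_path_shift k%:Z measurableT mA; rewrite setTI.
- exact: etrans (shift_law hbase _ mA) A0.
- by move=> w /= nQ; apply: QA.
Qed.

End Stationarity.

Section ConvergenceToDensity.
Context d (X : measurableType d) dU (U : measurableType dU) dY (Y : measurableType dY) (R : realType).
Variables (m : probability X R) (v : (X -> R[i]) -> \bar R) (Cv : R).
Hypothesis hv : is_variation m v Cv.
Variables (T : paths Y -> X -> X) (L : paths Y -> (X -> R[i]) -> (X -> R[i])).
Hypothesis hmaps : random_maps m T L.
Variable h : paths Y -> X -> R.
Variable phi : paths Y * X -> R.
Variable B : R.
Variables (lam eps : R) (K : paths Y -> R).
Hypotheses (lam0 : 0 < lam) (K1 : forall w, 1 < K w).
Variables (PU : probability U R) (xi : int -> U -> Y).
Variable P : probability (paths Y) R.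
Hypothesis hbase : stationary_base PU xi P.
Hypothesis orbit_ae : {ae P, forall w, good_orbit m v T L h phi B lam eps K w}.
Hypothesis mh : measurable_fun setT (fun z : paths Y * X => h z.1 z.2).
Hypothesis h0 : forall w x, 0 <= h w x.
Hypothesis h1 : {ae P, forall w, (\int[m]_x (h w x)%:E = 1)%E}.
Variable mu : probability (paths Y * X)%type R.
Hypothesis hmu : skew_measure m P h mu.
Local Notation tau := (Defs.skew T).

Let iter_mean M g w := mean m (fun x => g (iter M tau (w, x))).

Let bm_iter M (g : paths Y * X -> R) : bm g -> bm (fun z => g (iter M tau z)).
Proof. by move=> bg; apply: (bm_comp bg); exact: (measurable_iter_tau hmaps). Qed.

Let bm_iter_mean M g : bm g -> bm (iter_mean M g).
Proof. by move=> bg; apply: (bm_fibre m (bm_iter M bg)). Qed.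

Section Indicator.
Variable A : set (paths Y * X).
Hypothesis mA : measurable A.
Let q w := pairing m (cfun (h w)) (fun x => \1_A (w, x)).
(** The clipping matters only for the null set of w where [h w] is not a probability density. *)
Let qc w := clip 1 (q w).

Let fub_ge0 : forall z : paths Y * X, (0 <= (h z.1 z.2 * \1_A z)%:E)%E.
Proof. by move=> z; rewrite lee_fin mulr_ge0// indicE. Qed.

Let fub_meas : measurable_fun setT (fun z : paths Y * X => (h z.1 z.2 * \1_A z)%:E).
Proof. by apply/measurable_EFinP; apply: measurable_funM => //; exact: measurable_indic. Qed.

Let qE w : q w = fine (fubini_F m (fun z => (h z.1 z.2 * \1_A z)%:E) w).
Proof. by []. Qed.

Let xsecE w : (\int[m]_(x in xsection A w) (h w x)%:E)%E =
  fubini_F m (fun z => (h z.1 z.2 * \1_A z)%:E) w.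
Proof.
rewrite [LHS]integral_mkcond /fubini_F; apply: eq_integral => x _ /=.
rewrite patchE indicE mem_xsection; case: ifP => _; by rewrite ?mulr1 ?mulr0.
Qed.

Let mfub : measurable_fun setT (fubini_F m (fun z => (h z.1 z.2 * \1_A z)%:E)).
Proof. exact: measurable_fun_fubini_tonelli_F. Qed.

Lemma measurable_xsection_density :
  measurable_fun setT (fun w => \int[m]_(x in xsection A w) (h w x)%:E)%E.
Proof.
rewrite (_ : (fun w => _) = fubini_F m (fun z => (h z.1 z.2 * \1_A z)%:E)) //.
by apply/funext => w; rewrite xsecE.
Qed.

Let bqc : bm qc.
Proof.
apply: bm_clip => //.
rewrite (_ : q = fine \o fubini_F m (fun z => (h z.1 z.2 * \1_A z)%:E)).
  by apply: measurableT_comp => //; exact: measurable_fine.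
by apply/funext.
Qed.

Let fub_qc w : (\int[m]_x (h w x)%:E = 1)%E ->
  fubini_F m (fun z => (h z.1 z.2 * \1_A z)%:E) w = (qc w)%:E /\ qc w = q w.
Proof.
move=> hw; set F := fubini_F _ _ w.
have F0 : (0 <= F)%E by apply: integral_ge0 => x _; exact: fub_ge0.
have F1 : (F <= 1)%E.
  rewrite -hw; apply: ge0_le_integral => //.
  - exact: (measurableT_comp fub_meas (pair1_measurable w)).
  - apply/measurable_EFinP; exact: (measurableT_comp mh (pair1_measurable w)).
  - by move=> x _ /=; rewrite lee_fin ler_piMr// indicE; case: (_ \in _).
have Ff : F \is a fin_num by rewrite ge0_fin_numE// (le_lt_trans F1)// ltry.
have qq : qc w = q w.
  rewrite /qc clip_id// qE -/F ger0_norm ?fine_ge0//.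
  by rewrite -lee_fin fineK.
by split=> //; rewrite qq qE -/F fineK.
Qed.

Let mean_qc : mean P qc = fine (mu A).
Proof.
rewrite (hmu mA) -[LHS]/(fine (mean P qc)%:E) -mean_EFin//; congr fine.
apply: ae_eq_integral => //.
- by apply/measurable_EFinP; exact: bqc.1.
- exact: measurable_xsection_density.
- move: h1; apply: filterS => w hw _; rewrite xsecE.
  by have [-> _] := fub_qc hw.
Qed.

Let defect M w := iter_mean M \1_A w - qc (path_shift M%:Z w).

Let b1A : bm (\1_A : paths Y * X -> R). Proof. exact: bm_indic. Qed.

Let bdefect M : bm (defect M).
Proof.
apply: bmB; first exact: bm_iter_mean.
by apply: (bm_comp bqc); exact: measurable_path_shift.
Qed.

Let defect_le M w : (0 < M)%N -> good_orbit m v T L h phi B lam eps K w ->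
  (\int[m]_x (h (path_shift M%:Z w) x)%:E = 1)%E ->
  `|defect M w| <= K w * expR (- lam) ^+ M.
Proof.
move=> M0 gw hw; have [_ qq] := fub_qc hw.
have gg := good_here gw.
have Ke : 0 < K w * expR (- lam * M%:R) by rewrite mulr_gt0 ?expR_gt0// (lt_trans ltr01).
have bA : bm (fun x => \1_A (path_shift M%:Z w, x) : R) by exact: bm_xsection.
have DA : dual_bound m v (fun x => \1_A (path_shift M%:Z w, x)) 1.
  move=> psi Lpsi Bpsi; rewrite -[leRHS]mulr1; apply: pairing_le => //.
    by apply: le_trans Bpsi; rewrite /BVnorm leeDl// (var_ge0 hv).
  by move=> x; rewrite indicE; case: (_ \in _); rewrite ?normr1 ?normr0.
have := mean_vs_density hv hmaps Ke (fibre_gap gg M0) bA DA (fibre_dens gg).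
have -> : pairing m (cfun (h w)) (fun x => \1_A (path_shift M%:Z w, orbit_map T M w x)) =
   q (path_shift M%:Z w).
  apply: (pairing_density hmaps M bA); first by move=> i; exact: fibre_dens (gw i).
  move=> i; have := fibre_equiv (gw i); apply: filterS => x ->.
  by rewrite path_shiftD; congr (cfun (h (path_shift _ _)) _).
rewrite -qq mulr1 expRM_natr.
rewrite /defect /iter_mean.
by congr (`|mean m _ - _| <= _); apply/funext => x; rewrite iter_skew.
Qed.

(** On almost every fibre the error is at most K w exp (- lam M). As [K] is not assumed integrable,
    the convergence is only pointwise in w and is integrated by dominated convergence with the bound
    2; stationarity then removes the shift from the limit term. *)
Lemma mean_iter_indic (e : R) : 0 < e -> exists N, forall M, (N <= M)%N ->
  `|mean P (iter_mean M \1_A) - mean mu \1_A| <= e.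
Proof.
move=> e0.
have bound2 M w : (`|(defect M w)%:E| <= (cst 2%:E : paths Y -> \bar R) w)%E.
  rewrite lee_fin; apply: le_trans (ler_normB _ _) _.
  rewrite -[leRHS]/(1 + 1 : R); apply: lerD; last exact: norm_clip.
  apply: mean_le_norm => [|x]; first exact: (bm_xsection w (bm_iter M b1A)).
  by rewrite indicE; case: (_ \in _); rewrite ?normr1 ?normr0.
have := @dominated_convergence _ _ _ P setT measurableT (fun M w => (defect M w)%:E) (cst 0%E)
  (cst 2%:E).
case.
- by move=> M; apply/measurable_EFinP; exact: (bdefect M).1.
- exact: measurable_cst.
- have := ae_shift hbase h1; move: orbit_ae; apply: filterS2 => w gw hw _.
  apply/fine_cvgP; split; first exact: nearW.
  have K0 : 0 < K w by exact: lt_trans (K1 w).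
  have gt : `|expR (- lam)| < 1 by rewrite ger0_norm ?expR_ge0// -expR0 ltr_expR oppr_lt0.
  apply/cvgrPdist_le => e1 e10.
  have e2 : 0 < e1 / K w by rewrite divr_gt0.
  move/cvgrPdist_le : (cvg_expr gt) => /(_ _ e2) [N _ HN].
  exists N.+1 => // M /= NM; rewrite sub0r normrN.
  have M0 : (0 < M)%N by exact: leq_trans NM.
  apply: le_trans (defect_le M0 gw (hw M)) _.
  have := HN M (ltnW NM); rewrite sub0r normrN ger0_norm ?exprn_ge0 ?expR_ge0//.
  by rewrite ler_pdivlMr// mulrC.
- exact: (bm_integrable P (bm_cst _ 2)).
- by apply: aeW => w n _; exact: bound2.
move=> _ _; rewrite integral_cst//= mul0e => /fine_cvgP[_] /cvgrPdist_le /(_ _ e0) [N _ HN].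
exists N => M NM; have := HN M NM; rewrite sub0r normrN /= mean_EFin//=.
have bs : bm (fun w => qc (path_shift M%:Z w)) by apply: (bm_comp bqc); exact: measurable_path_shift.
by rewrite /defect meanB//; [rewrite (mean_shift hbase _ bqc) mean_qc mean_indic|exact: bm_iter_mean].
Qed.

End Indicator.

Lemma mean_iter_cvg g : bm g -> forall e : R, 0 < e -> exists N, forall M, (N <= M)%N ->
  `|mean P (fun w => mean m (fun x => g (iter M tau (w, x)))) - mean mu g| <= e.
Proof.
move: g; apply: (@bm_class _ _ _ (fun g => forall e : R, 0 < e -> exists N, forall M, (N <= M)%N ->
  `|mean P (iter_mean M g) - mean mu g| <= e)).
- by move=> A mA e; exact: mean_iter_indic.
- move=> f1 f2 b1 b2 H1 H2 e e0; have e20 : 0 < e / 2 by rewrite divr_gt0.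
  have [N1 {}H1] := H1 _ e20; have [N2 {}H2] := H2 _ e20.
  exists (maxn N1 N2) => M; rewrite geq_max => /andP[M1 M2].
  have -> : iter_mean M (fun x => f1 x + f2 x) = fun w => iter_mean M f1 w + iter_mean M f2 w.
    by apply/funext => w; rewrite /iter_mean meanD//; [exact: (bm_xsection w (bm_iter M b1))|
      exact: (bm_xsection w (bm_iter M b2))].
  rewrite !meanD//; try exact: bm_iter_mean.
  rewrite opprD addrACA (splitr e); apply: le_trans (ler_normD _ _) _.
  by apply: lerD; [exact: H1|exact: H2].
- move=> c f b1 H e e0; have e20 : 0 < e / (`|c| + 1) by rewrite divr_gt0// ltr_wpDl.
  have [N {}H] := H _ e20; exists N => M NM.
  have -> : iter_mean M (fun x => c * f x) = fun w => c * iter_mean M f w.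
    by apply/funext => w; rewrite /iter_mean meanZ//; exact: (bm_xsection w (bm_iter M b1)).
  rewrite !meanZ//; last exact: bm_iter_mean.
  rewrite -mulrBr normrM; apply: le_trans (ler_wpM2l (normr_ge0 _) (H M NM)) _.
  rewrite mulrCA ler_piMr ?(ltW e0)// ler_pdivrMr ?ltr_wpDl// mul1r.
  by rewrite lerDl.
- move=> f b1 H e e0; have e30 : 0 < e / 3 by rewrite divr_gt0.
  have [g [bg {}H] fg] := H _ e30; have [N {}H] := H _ e30.
  exists N => M NM.
  have E1 : `|mean P (iter_mean M f) - mean P (iter_mean M g)| <= e / 3.
    rewrite -meanB; try exact: bm_iter_mean.
    apply: mean_le_norm => [|w]; first by apply: bmB; exact: bm_iter_mean.
    have bf' := bm_xsection w (bm_iter M b1); have bg' := bm_xsection w (bm_iter M bg).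
    by rewrite /iter_mean -meanB//; apply: mean_le_norm => [|x]; [exact: bmB|exact: fg].
  have E2 : `|mean mu g - mean mu f| <= e / 3.
    by rewrite -meanB//; apply: mean_le_norm => [|x]; [exact: bmB|rewrite distrC; exact: fg].
  have -> : mean P (iter_mean M f) - mean mu f = (mean P (iter_mean M f) - mean P (iter_mean M g)) +
    ((mean P (iter_mean M g) - mean mu g) + (mean mu g - mean mu f)) by ring.
  apply: le_trans (ler_normD _ _) _; apply: le_trans (lerD E1 (ler_normD _ _)) _.
  by have := lerD (H M NM) E2; move: (_ + _) => u; lra.
Qed.

End ConvergenceToDensity.

(** * Centred moments from cumulants *)

Section CenteredMoments.
Context (R : realType).
Implicit Types (f kap F : fps R).

Definition flin (c : R) : fps R := Fps (fun k => if k == 1%N then c else 0).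

Lemma fexp_flin c : fexp (flin c) = ex c.
Proof.
apply: (@fps_ode_unique _ (fder (flin c))).
- exact: fder_fexp.
- apply: fpsP => k; rewrite coefM_fps big_ord_recl /= subn0 big1 ?addr0.
    rewrite mul1r factS natrM exprS; field.
    by rewrite nat1r !pnatr_eq0 -lt0n fact_gt0.
  by move=> i _; rewrite /= mulr0 mul0r.
- by rewrite fexp0 /= expr0 fact0 divr1.
Qed.

Definition fcenter F := F * ex (- F 1%N).

Definition drop_lin f : fps R := Fps (fun k => if k == 1%N then 0 else f k).

Lemma coef1_fexp kap : kap 0%N = 0 -> fexp kap 1%N = kap 1%N.
Proof.
by move=> k0; rewrite [LHS]/= !big_ord_recl big_ord0 expr0 expr1 coef1_fps /= mulr0 add0r addr0 invr1 mul1r.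
Qed.

(** Centring a random variable removes its first cumulant and keeps the others. *)
Lemma fcenter_fexp kap : kap 0%N = 0 -> fcenter (fexp kap) = fexp (drop_lin kap).
Proof.
move=> k0; rewrite /fcenter coef1_fexp//.
have -> : fexp kap = fexp (drop_lin kap) * ex (kap 1%N).
  rewrite -fexp_flin -fexpD//; congr fexp; apply: fpsP => -[|[|k]] /=.
  - by rewrite addr0.
  - by rewrite add0r.
  - by rewrite addr0.
by rewrite -mulrA -exD subrr ex0 mulr1.
Qed.

Lemma coef_lowX2 f s : f 0%N = 0 -> f 1%N = 0 ->
  (forall k, (k < s.*2)%N -> (f ^+ s) k = 0) /\ (f ^+ s) s.*2 = f 2%N ^+ s.
Proof.
move=> f0 f1; elim: s => [|s [IH1 IH2]]; first by split=> //; rewrite expr0 coef1_fps.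
split=> [k ks|].
  rewrite exprS coefM_fps big1// => -[[|[|i]] ik] _ /=; rewrite ?f0 ?f1 ?mul0r//.
  by rewrite IH1 ?mulr0//; move: ks ik; rewrite doubleS; clear; lia.
rewrite exprS coefM_fps doubleS 3!big_ord_recl /= f0 f1 !mul0r !add0r.
rewrite big1 ?addr0; last first.
  move=> i _; rewrite /bump /= IH1 ?mulr0//.
  by case: i => i /=; clear; lia.
by rewrite exprS; congr (_ * _); rewrite -IH2; congr (_ _); clear; rewrite /bump /=; lia.
Qed.

(** The p-th moment of a centred normal variable of variance V; the quotient is the double factorial
    (p - 1)!!. *)
Definition gauss_moment (p : nat) (V : R) : R :=
  if odd p then 0 else V ^+ p./2 * (p`!%:R / (2 ^+ p./2 * p./2`!%:R)).

(** Coefficients carry a factor 1 / k!, so [2 * fcenter F 2] is the variance. *)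
Definition moment_defect p F : R := p`!%:R * fcenter F p - gauss_moment p (2 * fcenter F 2%N).

Lemma moment_defect_fexp kap p : kap 0%N = 0 -> (0 < p)%N ->
  moment_defect p (fexp kap) =
  \sum_(1 <= u < (p.-1)./2.+1) p`!%:R / u`!%:R * (drop_lin kap ^+ u) p.
Proof.
move=> k0 p0; rewrite /moment_defect fcenter_fexp//; set f := drop_lin kap.
have f0 : f 0%N = 0 by [].
have f1 : f 1%N = 0 by [].
have f2 : fexp f 2%N = f 2%N.
  rewrite [LHS]/= !big_ord_recl big_ord0 expr0 coef1_fps !lift0 expr1 /bump /=.
  by rewrite !big_ord_recl big_ord0 /= k0 /bump /= !(mulr0, mul0r, addr0, add0r) invr1 mul1r.
rewrite f2 /gauss_moment.
have -> : fexp f p = \sum_(1 <= u < p./2.+1) u`!%:R^-1 * (f ^+ u) p.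
  rewrite /fexp /fcomp [LHS]/= -(big_mkord predT (fun k => k`!%:R^-1 * (f ^+ k) p)).
  rewrite (big_cat_nat (n := p./2.+1))//=; last first.
    by rewrite ltnS; clear; lia.
  rewrite [X in _ + X]big1_seq ?addr0; last first.
    move=> u /=; rewrite mem_index_iota => /andP[pu _].
    by rewrite (coef_lowX2 u f0 f1).1 ?mulr0//; move: pu; clear; lia.
  rewrite big_ltn// fact0 invr1 mul1r expr0 coef1_fps.
  by case: (p) p0 => // p' _; rewrite add0r.
rewrite mulr_sumr (eq_bigr (fun u => p`!%:R / u`!%:R * (f ^+ u) p)); last first.
  by move=> u _; rewrite mulrA.
case: ifP => op.
  by rewrite subr0; congr (\sum_(1 <= u < _.+1) _); move: op p0; clear; lia.
have [j pj] : exists j, p = j.+1.*2 by exists (p./2.-1)%N; move: op p0; clear; lia.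
have -> : p./2 = j.+1 by rewrite pj doubleK.
have -> : (p.-1)./2 = j by rewrite pj; clear; lia.
rewrite big_nat_recr//= pj (coef_lowX2 j.+1 f0 f1).2 -addrA -[RHS]addr0; congr (_ + _).
rewrite exprMn; field.
by rewrite pnatr_eq0 -lt0n fact_gt0/= expf_neq0.
Qed.

Lemma norm_moment_defect kap p (r n : R) : kap 0%N = 0 -> (0 < p)%N -> 0 < r ->
  nrm r p kap <= n ->
  `|moment_defect p (fexp kap)| <=
  (r ^+ p)^-1 * p`!%:R * \sum_(1 <= u < (p.-1)./2.+1) n ^+ u / u`!%:R.
Proof.
move=> k0 p0 r0 kn; rewrite moment_defect_fexp//.
apply: le_trans (ler_norm_sum _ _ _) _; rewrite mulr_sumr; apply: ler_sum => u _.
rewrite normrM ger0_norm ?divr_ge0// [leRHS](_ : _ = p`!%:R / u`!%:R * ((r ^+ p)^-1 * n ^+ u)); last by ring.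
apply: ler_wpM2l; first exact: divr_ge0.
rewrite mulrC ler_pdivlMr ?exprn_gt0//.
have rge := ltW r0.
apply: le_trans (nrm_coef rge _ (leqnn p)) _.
apply: le_trans (nrmX p rge _ _) _.
have H : nrm r p (drop_lin kap) <= n.
  apply: le_trans kn; apply: nrm_le => // k _ /=; case: eqP => // _.
  by rewrite normr0.
by rewrite lerXn2r ?nnegrE ?nrm_ge0// (le_trans _ H)// nrm_ge0.
Qed.

Lemma fact_le_expn u p : (u <= p)%N -> (u`! <= p ^ u)%N.
Proof.
elim: u => // u IH up; rewrite factS expnS leq_mul// IH//.
exact: ltnW.
Qed.

Lemma expn_le_fact p : (p%:R ^+ p : R) <= expR p%:R * p`!%:R.
Proof.
rewrite -ler_pdivrMr ?ltr0n ?fact_gt0//.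
apply: le_trans (texp_le_expR p (ler0n _ p)); rewrite /texp big_ord_recr/= lerDr.
by apply: sumr_ge0 => i _; rewrite divr_ge0 ?exprn_ge0.
Qed.

(** From p ^ p <= e ^ p p!: this converts the shrinking radius into the power 1 / eta of p!, at the
    cost of a geometric factor. *)
Lemma pgam_expn (eta : R) p : 0 < eta -> (0 < p)%N ->
  pgam eta p ^+ p <= expR eta^-1 ^+ p * p`!%:R `^ eta^-1.
Proof.
move=> e0 p0; have g0 : 0 <= eta^-1 by rewrite invr_ge0 ltW.
have -> : pgam eta p ^+ p = (p%:R ^+ p) `^ eta^-1.
  by rewrite /pgam -powR_mulrn ?powR_ge0// -powRrM mulrC powRrM powR_mulrn.
apply: le_trans (ge0_ler_powR g0 _ _ (expn_le_fact p)) _; rewrite ?nnegrE ?exprn_ge0//.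
rewrite powRM ?expR_ge0//; apply: ler_wpM2r; first exact: powR_ge0.
by rewrite -expRM -expRM_natr mulrC.
Qed.

Lemma moment_defect_bound (kap : fps R) (p n : nat) (A0 A th C1 c2 eta : R) :
  0 < A0 -> 0 < A -> 0 < th -> th < 1 -> 1 <= C1 -> 0 < c2 -> 0 < eta ->
  kap 0%N = 0 -> (0 < p)%N ->
  nrm (radius A0 A th C1 c2 eta p) p kap <= n%:R * slope th c2 eta p ->
  `|moment_defect p (fexp kap)| <=
  moment_bound (expR eta^-1 / radius0 A0 A th C1 c2 eta) eta^-1 p n.
Proof.
move=> A00 Apos th0 th1 C11 c20 eta0 k0 p0 kn.
have r00 : 0 < radius0 A0 A th C1 c2 eta by exact: radius0_gt0.
have pg0 : 0 < pgam eta p by exact: pgam_gt0.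
have r0 : 0 < radius A0 A th C1 c2 eta p by exact: divr_gt0.
have kn' : nrm (radius A0 A th C1 c2 eta p) p kap <= n%:R.
  apply: le_trans kn _; apply: ler_piMr => //.
  by apply: le_trans (slope_le th0 th1 c20 eta0 p0) _; rewrite /slope0 ge_min lexx.
apply: le_trans (norm_moment_defect k0 p0 r0 kn') _.
rewrite /moment_bound; apply: ler_pM.
- by rewrite mulr_ge0// invr_ge0 exprn_ge0// ltW.
- by apply: sumr_ge0 => u _; rewrite divr_ge0 ?exprn_ge0.
- rewrite powRD; last by rewrite pnatr_eq0 -lt0n fact_gt0 implybT.
  rewrite powRr1// [X in _ <= X](_ : _ = (expR eta^-1 ^+ p * p`!%:R `^ eta^-1) *
     (radius0 A0 A th C1 c2 eta)^-1 ^+ p * p`!%:R); last by rewrite exprMn; ring.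
  apply: ler_wpM2r => //.
  rewrite -exprVn /radius invf_div exprMn.
  apply: ler_wpM2r; first by rewrite exprn_ge0// invr_ge0 ltW.
  exact: pgam_expn.
(* The factor p ^ u / u! of the claimed bound is at least 1, since u! <= p ^ u for u <= p. *)
- rewrite !big_nat; apply: ler_sum => u /andP[_ up].
  apply: ler_wpM2l; first exact: exprn_ge0.
  have u0 : 0 < u`!%:R :> R by rewrite ltr0n fact_gt0.
  rewrite -exprVn expr2 mulrA ler_peMl ?invr_ge0 ?(ltW u0)//.
  rewrite ler_pdivlMr// mul1r -natrX ler_nat fact_le_expn//.
  by move: up p0; clear; lia.
Qed.

Lemma cvg_sumr (I : Type) (s : seq I) (f : I -> nat -> R) (l : I -> R) :
  (forall i, f i M @[M --> \oo] --> l i) ->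
  \sum_(i <- s) f i M @[M --> \oo] --> \sum_(i <- s) l i.
Proof.
move=> H; elim: s => [|i s IH].
  rewrite big_nil (_ : (fun M => _) = fun _ => 0); first exact: cvg_cst.
  by apply/funext => M; rewrite big_nil.
rewrite big_cons (_ : (fun M => _) = fun M => f i M + \sum_(j <- s) f j M).
  by apply: cvgD.
by apply/funext => M; rewrite big_cons.
Qed.

Lemma cvg_fcenter (Fs : nat -> fps R) F k : (forall k, Fs M k @[M --> \oo] --> F k) ->
  fcenter (Fs M) k @[M --> \oo] --> fcenter F k.
Proof.
move=> H; rewrite /fcenter; under eq_fun do rewrite coefM_fps; rewrite coefM_fps.
have HX j : (- Fs M 1%N) ^+ j @[M --> \oo] --> (- F 1%N) ^+ j.
  elim: j => [|j IH]; first exact: cvg_cst.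
  rewrite exprS; under eq_fun do rewrite exprS.
  by apply: cvgM => //; apply: cvgN; exact: H.
apply: (@cvg_sumr _ _ (fun (i : 'I_k.+1) M => Fs M i * ex (- Fs M 1%N) (k - i)%N)) => i.
apply: cvgM; first exact: H.
by apply: cvgM; [exact: HX|exact: cvg_cst].
Qed.

Lemma moment_defect_limit (Fs : nat -> fps R) F p (b : R) :
  (forall k, Fs M k @[M --> \oo] --> F k) ->
  (forall M, `|moment_defect p (Fs M)| <= b) -> `|moment_defect p F| <= b.
Proof.
move=> H Hb.
have HV j : (2 * fcenter (Fs M) 2%N) ^+ j @[M --> \oo] --> (2 * fcenter F 2%N) ^+ j.
  elim: j => [|j IH]; first exact: cvg_cst.
  rewrite exprS; under eq_fun do rewrite exprS.
  by apply: cvgM => //; apply: cvgM; [exact: cvg_cst|exact: cvg_fcenter].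
have C : moment_defect p (Fs M) @[M --> \oo] --> moment_defect p F.
  apply: cvgB; first by apply: cvgM; [exact: cvg_cst|exact: cvg_fcenter].
  rewrite /gauss_moment; case: (odd p); first exact: cvg_cst.
  by apply: cvgM; [exact: HV|exact: cvg_cst].
apply/ler_addgt0Pl => e e0; move/cvgrPdist_le : C => /(_ _ e0) [N _ HN].
rewrite -(subrK (moment_defect p (Fs N)) (moment_defect p F)).
by apply: le_trans (ler_normD _ _) _; apply: lerD => //; apply: HN => /=.
Qed.

End CenteredMoments.

(** * Gaussian moments *)

Section DensityIntegral.
Context d (T : measurableType d) (R : realType).
Variables (mu nu : {measure set T -> \bar R}) (w : T -> R).
Hypotheses (mw : measurable_fun setT w) (w0 : forall x, 0 <= w x).
Hypothesis nuE : forall A, measurable A -> nu A = (\int[mu]_(x in A) (w x)%:E)%E.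

Import HBNNSimple.

Lemma ge0_integral_density (f : T -> R) : measurable_fun setT f -> (forall x, 0 <= f x) ->
  (\int[nu]_x (f x)%:E = \int[mu]_x (f x * w x)%:E)%E.
Proof.
move=> mf f0; have mf' : measurable_fun setT (EFin \o f) by apply/measurable_EFinP.
pose g := nnsfun_approx measurableT mf'.
have gf x : (g n x)%:E @[n --> \oo] --> (f x)%:E.
  by apply: cvg_nnsfun_approx => // y _; rewrite lee_fin.
have gS x n k : (n <= k)%N -> g n x <= g k x by move=> nk; exact/lefP/nd_nnsfun_approx.
have mgw n : measurable_fun setT (fun x => (g n x * w x)%:E).
  by apply/measurable_EFinP; apply: measurable_funM => //; exact/measurable_funP.
transitivity (limn (fun n => \int[nu]_x (g n x)%:E)%E).
  rewrite -monotone_convergence//.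
  - by apply: eq_integral => x _; apply/esym/cvg_lim => //; exact: gf.
  - by move=> n; exact/measurable_EFinP/measurable_funP.
  - by move=> n x _; rewrite lee_fin.
  - by move=> x _ n k nk; rewrite lee_fin gS.
transitivity (limn (fun n => \int[mu]_x (g n x * w x)%:E)%E); last first.
  rewrite -monotone_convergence//.
  - apply: eq_integral => x _; apply/cvg_lim => //.
    have -> : (f x * w x)%:E = ((f x)%:E * (w x)%:E)%E by [].
    have fw : (w x)%:E \is a fin_num by [].
    exact: (cvgeZr fw (gf x)).
  - by move=> n x _; rewrite lee_fin mulr_ge0.
  - by move=> x _ n k nk; rewrite lee_fin ler_wpM2r// gS.
congr (limn _); apply/funext => n.
transitivity (\sum_(r \in range (g n)) r%:E * nu (g n @^-1` [set r]))%E.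
  by rewrite integralT_nnsfun sintegralE.
transitivity (\int[mu]_x (\sum_(r \in range (g n)) (r * (\1_(g n @^-1` [set r]) x * w x))%:E))%E.
  rewrite ge0_integral_fsum//; last 2 first.
  - move=> r; apply/measurable_EFinP; apply: measurable_funM => //.
    by apply: measurable_funM => //; exact: measurable_indic.
  - move=> r x _; rewrite mulrA lee_fin mulr_ge0//.
    by have := nnfun_muleindic_ge0 (g n) r x; rewrite lee_fin.
  apply: eq_fsbigr => r; rewrite inE => -[y _ ry].
  have r0 : 0 <= r by rewrite -ry.
  under eq_integral do rewrite EFinM.
  rewrite ge0_integralZl//; last first.
  - by move=> x _; rewrite lee_fin mulr_ge0// indicE.
  - by apply/measurable_EFinP; apply: measurable_funM => //; exact: measurable_indic.
  rewrite nuE// integral_mkcond; congr (_ * _)%E; apply: eq_integral => x _.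
  by rewrite patchE indicE; case: ifP => _; rewrite ?mul1r ?mul0r.
apply: eq_integral => x _; rewrite fsumEFin//; congr EFin.
rewrite [X in _ = X * _]fimfunE /= mulrC mulr_fsumr.
by apply: eq_fsbigr => r _; rewrite [RHS]mulrC mulrA.
Qed.

End DensityIntegral.

Section GaussianMoments.
Context (R : realType).
Local Notation mu := (@lebesgue_measure R).
Local Notation w := (@normal_pdf R 0 1).

Definition gpeak : R := normal_peak 1.

Lemma gaussE x : w x = gpeak * expR (- (x ^+ 2 / 2)).
Proof.
rewrite normal_pdfE ?oner_eq0// /normal_fun subr0 expr1n; congr (_ * expR _).
by rewrite mulNr.
Qed.

Lemma is_derive_monomial (k : nat) (x : R) :
  is_derive x 1 (fun x : R => x ^+ k) (k%:R * x ^+ k.-1).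
Proof.
have := is_deriveX k (is_derive_id x (1 : R)).
by rewrite exprfctE [_ *: _]mulr1.
Qed.

Lemma is_derive_gauss (x : R) : is_derive x 1 w (- (x * w x)).
Proof.
have -> : w = gpeak \*: (expR \o ((- 2^-1) \*: (fun x : R => x ^+ 2))).
  apply/funext => y; rewrite gaussE /= [_ *: expR _]/(_ * _); congr (_ * expR _).
  by rewrite /GRing.scale /= mulNr mulrC.
have d1 := is_deriveZ (- 2^-1) (is_derive_monomial 2 x).
have d2 := is_derive1_comp (is_derive_expR _) d1.
have d3 := is_deriveZ gpeak d2.
apply: (@is_derive_eq _ _ _ _ _ _ _ _ d3).
by rewrite /GRing.scale /= /GRing.scale /= expr1; set E := expR _; field.
Qed.

(** Integration by parts in the form of a primitive: its derivative links the moments of orders k +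
    2 and k. *)
Definition gprim k x : R := - (x ^+ k.+1 * w x).

Lemma is_derive_gprim k (x : R) :
  is_derive x 1 (gprim k) (x ^+ k.+2 * w x - k.+1%:R * (x ^+ k * w x)).
Proof.
have d1 := is_deriveM (is_derive_monomial k.+1 x) (is_derive_gauss x).
have := is_deriveN d1; move=> d2; apply: (@is_derive_eq _ _ _ _ _ _ _ _ d2).
by rewrite /GRing.scale /= !exprS; ring.
Qed.

Lemma continuous_gterm k : continuous (fun x : R => x ^+ k * w x).
Proof.
move=> x; apply: cvgM; last by apply: continuous_normal_pdf; rewrite oner_eq0.
exact: exprn_continuous.
Qed.

Lemma gprim_cvgy k : gprim k x @[x --> +oo] --> (0 : R).
Proof.
pose C := gpeak * (2 ^+ k.+1 * k.+1`!%:R).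
apply/cvgrPdist_le => e e0; near=> x.
have x0 : 1 <= x by near: x; apply: nbhs_pinfty_ge; exact: num_real.
have xC : C / e <= x by near: x; apply: nbhs_pinfty_ge; exact: num_real.
have xp : 0 < x by exact: lt_le_trans x0.
have p0 : 0 <= gpeak by exact: normal_peak_ge0.
rewrite sub0r opprK gaussE ger0_norm; last by rewrite !mulr_ge0 ?expR_ge0// exprn_ge0 ?ltW.
have E : (x ^+ 2 / 2) ^+ k.+1 / k.+1`!%:R <= expR (x ^+ 2 / 2).
  apply: le_trans (texp_le_expR k.+1 _); last by rewrite divr_ge0 ?sqr_ge0.
  rewrite /texp big_ord_recr /= lerDr; apply: sumr_ge0 => i _.
  by rewrite divr_ge0// exprn_ge0// divr_ge0 ?sqr_ge0.
have x2 : 0 < x ^+ 2 / 2 by rewrite divr_gt0 ?exprn_gt0.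
have {}E : expR (- (x ^+ 2 / 2)) <= k.+1`!%:R / (x ^+ 2 / 2) ^+ k.+1.
  rewrite expRN invf_ple ?posrE ?expR_gt0// ?invf_div//.
  by rewrite divr_gt0 ?ltr0n ?fact_gt0// exprn_gt0.
apply: (@le_trans _ _ (C / x)); last first.
  by rewrite ler_pdivrMr// mulrC -ler_pdivrMr.
apply: (@le_trans _ _ (x ^+ k.+1 * (gpeak * (k.+1`!%:R / (x ^+ 2 / 2) ^+ k.+1)))).
  by do 2 (apply: ler_wpM2l; first by rewrite ?exprn_ge0// ltW).
have -> : x ^+ k.+1 * (gpeak * (k.+1`!%:R / (x ^+ 2 / 2) ^+ k.+1)) = C / x ^+ k.+1.
  by rewrite /C expr_div_n -exprM mulnC exprM expr2; field; rewrite !expf_neq0// gt_eqF.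
apply: ler_wpM2l; first by rewrite /C !mulr_ge0// exprn_ge0.
by rewrite lef_pV2 ?posrE ?exprn_gt0// ler_eXnr.
Unshelve. all: by end_near. Qed.

Definition half_moment k : \bar R := (\int[mu]_(x in `[0%R, +oo[) (x ^+ k * w x)%:E)%E.

Let m1 k (A : set R) : measurable_fun A (fun x : R => (x ^+ k * w x)%:E).
Proof.
apply: measurable_funTS; apply/measurable_EFinP.
by apply: continuous_measurable_fun; exact: continuous_gterm.
Qed.

Let pos k (x : R) : 0 <= x -> (0 <= (x ^+ k * w x)%:E)%E.
Proof. by move=> x0; rewrite lee_fin mulr_ge0 ?exprn_ge0// normal_pdf_ge0. Qed.

Lemma half_moment_split k (a : R) : 0 < a -> half_moment k =
  (\int[mu]_(x in `[0%R, a]) (x ^+ k * w x)%:E + \int[mu]_(x in `[a, +oo[) (x ^+ k * w x)%:E)%E.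
Proof.
move=> a0; have -> : (\int[mu]_(x in `[a, +oo[) (x ^+ k * w x)%:E = \int[mu]_(x in `]a, +oo[) (x ^+ k * w x)%:E)%E.
  by rewrite integral_itv_obnd_cbnd//; exact: m1.
rewrite /half_moment.
rewrite (@itv_bndbnd_setU _ _ (BLeft 0) (BRight a) +oo%O) ?bnd_simp//; last exact: ltW.
rewrite ge0_integral_setU//=.
- exact: m1.
- move=> x [|]; rewrite /= in_itv/=.
    by move=> /andP[x0 _]; exact: pos.
  by rewrite andbT => ax; apply: pos; exact: le_trans (ltW a0) (ltW ax).
- apply/disj_setPLR => x /=; rewrite !in_itv/= andbT => /andP[_ xa] ax.
  by move: (le_lt_trans xa ax); rewrite ltxx.
Qed.

Lemma half_momentS k : half_moment k.+2 = (k.+1%:R%:E * half_moment k)%E.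
Proof.
(* The derivative of [gprim k] changes sign at [a] on the half-line. Cutting there leaves integrands
   of constant sign, so no difference of possibly infinite integrals is formed; the boundary terms
   at [a], both equal to [c], match. *)
pose a : R := Num.sqrt k.+1%:R.
have a0 : 0 < a by rewrite sqrtr_gt0.
have a2 : a ^+ 2 = k.+1%:R by rewrite sqr_sqrtr.
pose f (x : R) := x ^+ k.+2 * w x - k.+1%:R * (x ^+ k * w x).
have fE x : f x = (x ^+ 2 - k.+1%:R) * (x ^+ k * w x) by rewrite /f !exprS; ring.
have cf : continuous f.
  move=> x; apply: cvgB; first exact: continuous_gterm.
  by apply: cvgM; [exact: cvg_cst|exact: continuous_gterm].
have dF x : derivable (gprim k) x 1 by case: (is_derive_gprim k x).
have F' x : ((gprim k)^`())%classic x = f x.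
  by rewrite derive1E; case: (is_derive_gprim k x).
have cF : continuous (gprim k).
  by move=> x; apply: differentiable_continuous; exact/derivable1_diffP.
pose c := a ^+ k.+1 * w a.
have c0 : 0 <= c by rewrite mulr_ge0 ?exprn_ge0 ?(ltW a0)// normal_pdf_ge0.
have wx x : 0 <= x -> 0 <= x ^+ k * w x by move=> x0; rewrite mulr_ge0 ?exprn_ge0// normal_pdf_ge0.
have fpos x : a <= x -> 0 <= f x.
  move=> ax; have x0 : 0 <= x by exact: le_trans (ltW a0) ax.
  by rewrite fE; apply: mulr_ge0 (wx _ x0); rewrite subr_ge0 -a2 lerXn2r ?nnegrE// ltW.
have fneg x : 0 <= x -> x <= a -> 0 <= - f x.
  move=> x0 xa; rewrite fE -mulNr; apply: mulr_ge0 (wx _ x0).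
  by rewrite opprB subr_ge0 -a2 lerXn2r ?nnegrE// ltW.
have F2 : (\int[mu]_(x in `[a, +oo[) (f x)%:E = c%:E)%E.
  rewrite (@ge0_continuous_FTC2y _ f (gprim k) a 0).
  - by rewrite /gprim -/c sub0e -EFinN opprK.
  - exact: fpos.
  - exact: continuous_subspaceT.
  - exact: gprim_cvgy.
  - by move=> x _; exact: dF.
  - exact/cvg_at_right_filter/cF.
  - by move=> x _; exact: F'.
have F1 : (\int[mu]_(x in `[0%R, a]) (- f x)%:E = c%:E)%E.
  rewrite (@continuous_FTC2 _ (fun x => - f x) (fun x => - gprim k x) 0 a)//.
  - by rewrite /gprim expr0n mul0r oppr0 oppr0 sube0 opprK.
  - by apply: continuous_subspaceT => x; apply: cvgN; exact: cf.
  - split=> /=.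
    + by move=> x _; apply: derivableN; exact: dF.
    + by apply: cvg_at_right_filter; apply: cvgN; exact: cF.
    + by apply: cvg_at_left_filter; apply: cvgN; exact: cF.
  - by move=> x _; rewrite derive1N ?F'//; exact: dF.
have mf A : measurable_fun A (fun x => (f x)%:E).
  by apply: measurable_funTS; apply/measurable_EFinP; exact: continuous_measurable_fun.
have mNf A : measurable_fun A (fun x => (- f x)%:E).
  apply: measurable_funTS; apply/measurable_EFinP; apply: continuous_measurable_fun.
  by move=> x; apply: cvgN; exact: cf.
have kp : (0 <= k.+1%:R%:E :> \bar R)%E by rewrite lee_fin.
have mk A : measurable_fun A (fun x : R => (k.+1%:R * (x ^+ k * w x))%:E).
  apply: measurable_funTS; apply/measurable_EFinP; apply: measurable_funM => //.
  by apply: continuous_measurable_fun; exact: continuous_gterm.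
have Z (A : set R) : measurable A -> (forall x, A x -> 0 <= x) ->
    (\int[mu]_(x in A) (k.+1%:R * (x ^+ k * w x))%:E = k.+1%:R%:E * \int[mu]_(x in A) (x ^+ k * w x)%:E)%E.
  move=> mA A0; under eq_integral do rewrite EFinM.
  by rewrite ge0_integralZl//; [exact: m1|move=> x /A0; exact: pos].
have E2 : (\int[mu]_(x in `[a, +oo[) (x ^+ k.+2 * w x)%:E =
    c%:E + k.+1%:R%:E * \int[mu]_(x in `[a, +oo[) (x ^+ k * w x)%:E)%E.
  rewrite -Z//; last by move=> x; rewrite /= in_itv /= andbT; exact: le_trans (ltW a0).
  rewrite -F2 -ge0_integralD//.
  - by apply: eq_integral => x _; rewrite -EFinD /f subrK.
  - by move=> x; rewrite /= in_itv /= andbT => ax; rewrite lee_fin; exact: fpos.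
  - exact: mf.
  - move=> x; rewrite /= in_itv /= andbT => ax.
    by rewrite lee_fin mulr_ge0// wx// (le_trans (ltW a0)).
  - exact: mk.
have E1 : (k.+1%:R%:E * \int[mu]_(x in `[0%R, a]) (x ^+ k * w x)%:E =
    c%:E + \int[mu]_(x in `[0%R, a]) (x ^+ k.+2 * w x)%:E)%E.
  rewrite -Z//; last by move=> x; rewrite /= in_itv /= => /andP[].
  rewrite -F1 -ge0_integralD//.
  - by apply: eq_integral => x _; rewrite -EFinD /f opprB subrK.
  - by move=> x; rewrite /= in_itv /= => /andP[x0 xa]; rewrite lee_fin; exact: fneg.
  - exact: mNf.
  - by move=> x; rewrite /= in_itv /= => /andP[x0 xa]; exact: pos.
  - exact: m1.
have I1 : (0 <= \int[mu]_(x in `[0%R, a]) (x ^+ k * w x)%:E)%E.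
  by apply: integral_ge0 => x; rewrite /= in_itv /= => /andP[x0 _]; exact: pos.
have I2 : (0 <= \int[mu]_(x in `[a, +oo[) (x ^+ k * w x)%:E)%E.
  apply: integral_ge0 => x; rewrite /= in_itv /= andbT => ax; apply: pos.
  exact: le_trans (ltW a0) ax.
rewrite !(half_moment_split _ a0) E2 (ge0_muleDr _ I1 I2).
by rewrite E1 addeA [in RHS](addeC c%:E).
Qed.

Lemma even_moment j : (\int[normal_prob (0 : R) 1]_x (x ^+ j.*2)%:E =
  (j.*2`!%:R / (2 ^+ j * j`!%:R))%:E)%E.
Proof.
have nz : (1 : R) != 0 by rewrite oner_eq0.
rewrite (@ge0_integral_density _ _ _ mu _ w (measurable_normal_pdf _ _) (normal_pdf_ge0 _ _))//; last first.
  by move=> x; rewrite -mul2n exprM exprn_ge0// sqr_ge0.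
have S i : (\int[mu]_x (x ^+ i.*2 * w x)%:E = 2%:E * half_moment i.*2)%E.
  rewrite ge0_symfun_integralT.
  - by rewrite /half_moment set_itvcy.
  - by move=> x; rewrite mulr_ge0 ?normal_pdf_ge0// -mul2n exprM exprn_ge0// sqr_ge0.
  - exact: continuous_gterm.
  - by move=> x; rewrite /= !gaussE -mul2n !exprM sqrrN.
elim: j => [|j IH].
  rewrite fact0 expr0 mulr1 divr1 -(integral_normal_pdf 0 1).
  by apply: eq_integral => x _; rewrite expr0 mul1r.
rewrite S doubleS half_momentS muleCA -S IH -EFinM; congr EFin.
have -> : (j.*2.+2`! = (2 * j.+1) * (j.*2.+1 * j.*2`!))%N by rewrite !factS mul2n doubleS.
rewrite exprS [j.+1`!]factS !natrM; field.
by rewrite expf_neq0 ?nat1r ?pnatr_eq0 -?lt0n ?fact_gt0.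
Qed.

Lemma odd_moment p : odd p -> (\int[normal_prob (0 : R) 1]_x (x ^+ p)%:E = 0 :> \bar R)%E.
Proof.
move=> op; have nz : (1 : R) != 0 by rewrite oner_eq0.
pose f (x : R) := (x ^+ p)%:E.
have mf : measurable_fun setT f by apply/measurable_EFinP; exact: exprn_measurable.
have fN x : f (- x) = (- f x)%E by rewrite /f -EFinN exprNn -signr_odd op expr1 mulN1r.
pose fp (x : R) : R := Num.max (x ^+ p) 0.
have fp0 x : 0 <= fp x by rewrite le_max lexx orbT.
have mfp : measurable_fun setT fp by apply: measurable_maxr => //; exact: exprn_measurable.
have fpE x : (f^\+ x)%E = (fp x)%:E by rewrite funeposE /f /fp EFin_max.
have fmE x : (f^\- x)%E = (fp (- x))%:E.
  by rewrite funenegE /fp EFin_max; congr (maxe _ _); rewrite -fN.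
have dens (g : R -> R) := @ge0_integral_density _ _ _ mu (normal_prob (0 : R) 1) w
  (measurable_normal_pdf _ _) (normal_pdf_ge0 _ _) (fun A _ => erefl) g.
have mw : measurable_fun setT w by exact: measurable_normal_pdf.
have mN : measurable_fun setT (-%R : measurableTypeR R -> measurableTypeR R).
  exact: oppr_measurable.
have I : (\int[normal_prob (0 : R) 1]_x (fp (- x))%:E = \int[normal_prob (0 : R) 1]_x (fp x)%:E)%E.
  rewrite (dens _ _ (fun x => fp0 (- x))); last exact: (measurableT_comp mfp mN).
  rewrite (dens _ mfp fp0).
  transitivity (\int[pushforward mu (-%R : R -> measurableTypeR R)]_x (fp x * w x)%:E)%E; last first.
    by apply: eq_measure_integral => A mA _; exact: lebesgue_measureN.
  have mfw : measurable_fun setT (fun x => (fp x * w x)%:E).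
    by apply/measurable_EFinP; apply: measurable_funM.
  have fw0 : {in setT, forall x, (0 <= (fp x * w x)%:E)%E}.
    by move=> x _; rewrite lee_fin mulr_ge0// normal_pdf_ge0.
  have := @ge0_integral_pushforward _ _ (measurableTypeR R) (measurableTypeR R) R _ mN mu setT _ measurableT mfw fw0.
  by move=> ->; apply: eq_integral => x _ /=; rewrite !gaussE sqrrN.
(* The positive and negative parts have equal integrals by symmetry; finiteness, from x ^ p <= 1 + x
   ^ (2 p), is needed before they may cancel. *)
have fin : (\int[normal_prob (0 : R) 1]_x (fp x)%:E < +oo)%E.
  apply: (@le_lt_trans _ _ (\int[normal_prob (0 : R) 1]_x (1%:E + (x ^+ p.*2)%:E))%E).
    apply: ge0_le_integral => //.
    - by move=> x _; rewrite lee_fin.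
    - exact/measurable_EFinP.
    - by apply: emeasurable_funD => //; apply/measurable_EFinP; exact: exprn_measurable.
    - move=> x _; rewrite -EFinD lee_fin /fp -mul2n mulnC exprM ge_max.
      move: (x ^+ p) => y; rewrite addr_ge0 ?sqr_ge0// andbT.
      by have := sqr_ge0 (y - 2^-1); nra.
  rewrite ge0_integralD//; last first.
  - by apply/measurable_EFinP; exact: exprn_measurable.
  - by move=> x _; rewrite lee_fin -mul2n exprM exprn_ge0// sqr_ge0.
  have -> : (\int[normal_prob (0 : R) 1]__ 1%:E = 1%:E)%E.
    by rewrite (mean_EFin (normal_prob (0 : R) 1) (bm_cst _ 1)) mean_cst.
  by rewrite even_moment -EFinD ltry.
rewrite integralE; under eq_integral do rewrite fpE.
under [X in (_ - X)%E]eq_integral do rewrite fmE.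
rewrite I subee// ge0_fin_numE//.
by apply: integral_ge0 => x _; rewrite lee_fin.
Qed.

End GaussianMoments.

(** * Moments of Birkhoff sums *)

Section MomentsOfBoundedVariable.
Context d (T : measurableType d) (R : realType).
Variables (mu : probability T R) (S : T -> R).
Hypothesis bS : bm S.
Let D z := S z - mean mu S.
Let bD : bm D. Proof. by apply: bmB => //; exact: bm_cst. Qed.

Lemma bmf_ex (f : T -> R) : bm f -> bmf (fun z => ex (f z)).
Proof.
move=> bf k; rewrite (_ : (fun w => _) = (fun w => k`!%:R^-1 * f w ^+ k)).
  by apply: bmZ; exact: bmX.
by apply/funext => z; rewrite /= mulrC.
Qed.

Lemma coef_meanf_ex (f : T -> R) k : bm f ->
  k`!%:R * meanf mu (fun z => ex (f z)) k = mean mu (fun z => f z ^+ k).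
Proof.
move=> bf; have k0 : k`!%:R != 0 :> R by rewrite pnatr_eq0 -lt0n fact_gt0.
rewrite /= (_ : (fun w => _) = (fun w => k`!%:R^-1 * f w ^+ k)).
  by rewrite meanZ ?mulrA ?mulfV ?mul1r//; exact: bmX.
by apply/funext => z; rewrite mulrC.
Qed.

Lemma fcenter_meanf : fcenter (meanf mu (fun z => ex (S z))) = meanf mu (fun z => ex (D z)).
Proof.
have E1 : meanf mu (fun z => ex (S z)) 1%N = mean mu S.
  by have := coef_meanf_ex 1 bS; rewrite (_ : 1`! = 1%N)// mul1r => ->; congr mean; apply/funext => z; rewrite expr1.
rewrite /fcenter E1 mulrC -meanfZ; last exact: bmf_ex.
by congr meanf; apply/funext => z; rewrite -exD addrC.
Qed.

Lemma moment_defect_meanf p : moment_defect p (meanf mu (fun z => ex (S z))) =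
  mean mu (fun z => D z ^+ p) - gauss_moment p (mean mu (fun z => D z ^+ 2)).
Proof.
rewrite /moment_defect fcenter_meanf (coef_meanf_ex p bD); congr (_ - gauss_moment _ _).
by have := coef_meanf_ex 2 bD.
Qed.

End MomentsOfBoundedVariable.

Section BoundedObservable.
Context d (X : measurableType d) dU (U : measurableType dU) dY (Y : measurableType dY) (R : realType).
Variables (m : probability X R) (v : (X -> R[i]) -> \bar R) (Cv : R).
Hypothesis hv : is_variation m v Cv.
Variables (T : paths Y -> X -> X) (L : paths Y -> (X -> R[i]) -> (X -> R[i])).
Hypothesis hmaps : random_maps m T L.
Variable h : paths Y -> X -> R.
Variable phi : paths Y * X -> R.
Hypothesis mphi : measurable_fun setT phi.
Variable B : R.
Hypothesis B0 : 0 <= B.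
Hypothesis phiB : forall z, `|phi z| <= Cv * B.
Hypothesis phi0 : forall w w' x, w 0 = w' 0 -> phi (w, x) = phi (w', x).
Variables (lam eps : R) (K : paths Y -> R).
Hypotheses (lam0 : 0 < lam) (eps_lam : eps < lam / 3) (K1 : forall w, 1 < K w).
Variables (PU : probability U R) (xi : int -> U -> Y).
Variable P : probability (paths Y) R.
Hypothesis hbase : stationary_base PU xi P.
Variables c1 c2 eta : R.
Hypotheses (c10 : 0 < c1) (c20 : 0 < c2) (eta0 : 0 < eta).
Hypothesis hmix : forall n : nat, (0 < n)%N ->
  (alpha_mix PU xi n <= (c1 * expR (- c2 * n%:R `^ eta))%:E)%E.
Hypothesis orbit_ae : {ae P, forall w, good_orbit m v T L h phi B lam eps K w}.
Hypothesis mh : measurable_fun setT (fun z : paths Y * X => h z.1 z.2).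
Hypothesis h0 : forall w x, 0 <= h w x.
Hypothesis h1 : {ae P, forall w, (\int[m]_x (h w x)%:E = 1)%E}.
Variable mu : probability (paths Y * X)%type R.
Hypothesis hmu : skew_measure m P h mu.
Local Notation tau := (Defs.skew T).
Local Notation S := (birkhoff_sum T phi).

Lemma bm_birkhoff n : bm (S n).
Proof.
apply: bm_sum => j; have bphi : bm phi by split=> //; exists (Cv * B).
by apply: (bm_comp bphi); exact: (measurable_iter_tau hmaps).
Qed.

Lemma cvg_fibreG n k : meanf P (fibreG m T phi M (M + n)%N) k @[M --> \oo] -->
  meanf mu (fun z => ex (S n z)) k.
Proof.
have bg := bmf_ex (bm_birkhoff n) k.
apply/cvgrPdist_le => e e0.
have [N HN] := mean_iter_cvg hv hmaps lam0 K1 hbase orbit_ae mh h0 h1 hmu bg e0.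
exists N => // M /= NM; rewrite distrC.
suff E : meanf P (fibreG m T phi M (M + n)%N) k =
    mean P (fun w => mean m (fun x => ex (S n (iter M.+1 tau (w, x))) k)).
  by have := HN M.+1 (leqW NM); rewrite -E.
rewrite -[LHS]/(mean P (fun w => mean m (fun x => fprod T phi M (M + n) (w, x) k))).
have E' w : (fun x => fprod T phi M (M + n) (w, x) k) =
    (fun x => ex (S n (iter M.+1 tau (w, x))) k).
  by apply/funext => x; rewrite fprod_birkhoff.
by congr (mean P _); apply/funext => w; rewrite E'.
Qed.

Definition moment_const : R :=
  expR eta^-1 / radius0 (gA0 lam) (gA Cv B lam) (gth lam) (4 * c1 + 2) c2 eta.

Let A00 : 0 < gA0 lam.
Proof. by rewrite /gA0 mulr_gt0// (lt_le_trans _ (gc_ge3 lam0)). Qed.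
Let Apos : 0 < gA Cv B lam. Proof. exact: (gA_gt0 hv). Qed.
Let th0 : 0 < gth lam. Proof. exact: gth_gt0. Qed.
Let th1 : gth lam < 1. Proof. exact: gth_lt1. Qed.
Let C11 : 1 <= 4 * c1 + 2. Proof. by move: c10; lra. Qed.

Let cumulants M p n (p0 : (0 < p)%N) :=
  fibre_cumulants hv hmaps mphi B0 phiB phi0 lam0 eps_lam K1 hbase c10 c20 eta0 hmix orbit_ae M n p0.

Lemma bounded_moments n p : (0 < p)%N ->
  `|moment_defect p (meanf mu (fun z => ex (S n z)))| <= moment_bound moment_const eta^-1 p n.
Proof.
move=> p0; apply: (@moment_defect_limit R (fun M => meanf P (fibreG m T phi M (M + n)%N)) _ p _ (fun k => @cvg_fibreG n k)) => M.
have [kap [k0 -> kn]] := cumulants M n p0.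
exact: moment_defect_bound.
Qed.

(** For p = 2 [bounded_moments] compares the variance with itself and says nothing. The linear bound
    comes from the second cumulant in the norm with p = 2: the variance is 2 kap_2, and kap_2 r ^ 2
    <= n. *)
Lemma bounded_variance n :
  mean mu (fun z => (S n z - mean mu (S n)) ^+ 2) <= 2 / system_radius Cv B lam c1 c2 eta 2 ^+ 2 * n%:R.
Proof.
set b := (X in _ <= X); set r := system_radius _ _ _ _ _ _ _ in b *.
have r0 : 0 < r by apply: divr_gt0; [exact: radius0_gt0|exact: pgam_gt0].
have -> : mean mu (fun z => (S n z - mean mu (S n)) ^+ 2) =
    2 * fcenter (meanf mu (fun z => ex (S n z))) 2%N.
  rewrite fcenter_meanf; last exact: bm_birkhoff.
  rewrite -(coef_meanf_ex mu 2)//; apply: bmB; [exact: bm_birkhoff|exact: bm_cst].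
have C := @cvg_fcenter R (fun M => meanf P (fibreG m T phi M (M + n)%N)) _ 2 (fun k => @cvg_fibreG n k).
apply/ler_addgt0Pl => e e0; have e20 : 0 < e / 2 by rewrite divr_gt0.
move/cvgrPdist_le : C => /(_ _ e20) [N _ HN].
have := HN N (leqnn N); set a := fcenter _ 2%N; set a' := fcenter _ 2%N => Ha.
suff : 2 * a' <= b.
  by move: Ha; rewrite ler_norml => /andP[_]; move: a a' b => x y z; lra.
rewrite /a'; have [kap [k0 -> kn]] := cumulants N n (isT : (0 < 2)%N).
rewrite fcenter_fexp// -/(drop_lin kap).
have -> : fexp (drop_lin kap) 2%N = kap 2%N.
  rewrite [LHS]/= !big_ord_recl big_ord0 expr0 coef1_fps !lift0 expr1 /bump /=.
  by rewrite !big_ord_recl big_ord0 /= k0 /bump /= !(mulr0, mul0r, addr0, add0r) invr1 mul1r.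
have := nrm_coef (ltW r0) kap (leqnn 2) => H.
have {}kn : nrm r 2 kap <= n%:R.
  apply: le_trans kn _; apply: ler_piMr => //.
  by apply: le_trans (slope_le th0 th1 c20 eta0 _) _ => //; rewrite /slope0 ge_min lexx.
have : kap 2%N * r ^+ 2 <= n%:R.
  apply: le_trans _ (le_trans H kn); apply: ler_wpM2r; first by rewrite exprn_ge0// ltW.
  exact: ler_norm.
rewrite -ler_pdivlMr ?exprn_gt0// /b => /(ler_wpM2l (ler0n R 2)) /le_trans; apply.
by rewrite le_eqVlt; apply/orP; left; apply/eqP; ring.
Qed.

End BoundedObservable.

Lemma ae_ex d (T : measurableType d) (R : realType) (P : probability T R) (Q : T -> Prop) :
  {ae P, forall x, Q x} -> exists x, Q x.
Proof.
move=> [A [mA A0 QA]]; apply: contrapT => nQ.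
have AT : A = setT by apply/seteqP; split=> // x _; apply: QA => Qx; apply: nQ; exists x.
by move: A0; rewrite AT probability_setT => /eqP; rewrite onee_eq0.
Qed.

(** * Reduction to an observable bounded everywhere *)

Section ClippedObservable.
Context d (X : measurableType d) dU (U : measurableType dU) dY (Y : measurableType dY) (R : realType).
Variables (m : probability X R) (v : (X -> R[i]) -> \bar R) (Cv : R).
Hypothesis hv : is_variation m v Cv.
Variables (T : paths Y -> X -> X) (L : paths Y -> (X -> R[i]) -> (X -> R[i])).
Hypothesis hmaps : random_maps m T L.
Variable h : paths Y -> X -> R.
Variable phi : paths Y * X -> R.
Hypothesis mphi : measurable_fun setT phi.
Variable P : probability (paths Y) R.
Variable K : paths Y -> R.
Hypothesis K1 : forall w, 1 < K w.
Hypothesis phi_norm : (norm_K m v P K phi < +oo)%E.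

Local Notation B := (fine (norm_K m v P K phi)).
(** By [varV3] and K > 1, almost every fibre of [phi] is bounded by Cv B almost everywhere, so
    clipping leaves the Birkhoff sums unchanged almost surely. *)
Let phi' z := clip (Cv * B) (phi z).
Let K0 w : 0 < K w. Proof. exact: lt_trans ltr01 (K1 w). Qed.
Let Cv1 : 1 <= Cv. Proof. exact: varV3_ge1 hv. Qed.
Let Cv0 : 0 <= Cv. Proof. exact: le_trans ler01 Cv1. Qed.

Lemma BVnorm_ge0 psi : (0 <= BVnorm m v psi)%E.
Proof. by rewrite adde_ge0 ?cLnorm1_ge0// (var_ge0 hv). Qed.

Lemma norm_K_ge0 : (0 <= norm_K m v P K phi)%E.
Proof.
have /ess_supP/ae_ex[w] : (norm_K m v P K phi <= norm_K m v P K phi)%E by [].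
by apply: le_trans; rewrite mule_ge0 ?BVnorm_ge0// lee_fin ltW.
Qed.

Lemma norm_K_fine : norm_K m v P K phi = B%:E.
Proof. by rewrite fineK// ge0_fin_numE// norm_K_ge0. Qed.

Let B0 : 0 <= B. Proof. by rewrite fine_ge0// norm_K_ge0. Qed.

Lemma clipped_bound z : `|phi' z| <= Cv * B.
Proof. by rewrite norm_clip// mulr_ge0. Qed.

Lemma measurable_clipped : measurable_fun setT phi'.
Proof. by case: (bm_clip (mulr_ge0 Cv0 B0) mphi). Qed.

Lemma ae_BVnorm_phi : {ae P, forall w,
  (BVnorm m v (cfun (fun x => phi (w, x))) <= (B / K w)%:E)%E}.
Proof.
have /ess_supP : (norm_K m v P K phi <= B%:E)%E by rewrite norm_K_fine.
by apply: filterS => w; rewrite mulrC EFinM lee_pdivlMl.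
Qed.

Let mphix w : measurable_fun setT (fun x => phi (w, x)).
Proof. exact: (measurableT_comp mphi (pair1_measurable w)). Qed.

Let bclip w : bm (fun x => phi' (w, x)).
Proof.
apply: (@bm_xsection _ _ _ _ _ phi'); split; first exact: measurable_clipped.
by exists (Cv * B); exact: clipped_bound.
Qed.

Lemma clipped_ae w : (BVnorm m v (cfun (fun x => phi (w, x))) <= (B / K w)%:E)%E ->
  cLfun m 1 (cfun (fun x => phi (w, x))) /\ {ae m, forall x, phi (w, x) = phi' (w, x)}.
Proof.
move=> H; have Lphi : cLfun m 1 (cfun (fun x => phi (w, x))).
  split; first by split => //; exact: mphix.
  have [N [V [-> _ _ _ _]]] := BVnorm_fin hv H.
  exact: ltry.
split=> //.
have : (cLnorm m +oo (cfun (fun x => phi (w, x))) <= (Cv * B)%:E)%E.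
  apply: le_trans (varV3 hv Lphi) _; apply: le_trans (lee_wpmul2l _ H) _.
    by rewrite lee_fin.
  rewrite -EFinM lee_fin ler_wpM2l// ler_pdivrMr// ler_peMr// ltW//.
rewrite cLinfE => /ess_supP; apply: filterS => x; rewrite lee_fin normc_real => Hx.
by rewrite /phi' clip_id.
Qed.

Lemma BVnorm_clipped w : (BVnorm m v (cfun (fun x => phi (w, x))) <= (B / K w)%:E)%E ->
  (BVnorm m v (cfun (fun x => phi' (w, x))) <= (B / K w)%:E)%E.
Proof.
move=> H; have [Lphi E] := clipped_ae H.
have Lphi' := cLfun1_cfun m (bclip w).
suff -> : BVnorm m v (cfun (fun x => phi' (w, x))) = BVnorm m v (cfun (fun x => phi (w, x))) by [].
rewrite /BVnorm; congr (_ + _)%E.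
  rewrite !cL1E; apply: ae_eq_integral => //.
  - by apply/measurable_EFinP; apply: measurable_normc; exact: Lphi'.1.
  - by apply/measurable_EFinP; apply: measurable_normc; exact: Lphi.1.
  - by move: E; apply: filterS => x Ex _; rewrite /cfun Ex.
by apply: (var_ae hv) => //; move: E; apply: filterS => x Ex; rewrite /cfun Ex.
Qed.

Lemma nonsingular_orbit_map j w (A : set X) : measurable A -> m A = 0%E ->
  m (orbit_map T j w @^-1` A) = 0%E.
Proof.
elim: j A => [|j IH] A mA A0; first by rewrite (_ : orbit_map T 0 w = id).
rewrite (_ : orbit_map T j.+1 w = T (path_shift j%:Z w) \o orbit_map T j w); last first.
  by apply/funext => x; rewrite orbit_mapS.
have [mT nT] := maps_nonsingular hmaps (path_shift j%:Z w).
rewrite comp_preimage; apply: IH; last exact: nT.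
by rewrite -[X in measurable X]setTI; exact: mT.
Qed.

Variables (PU : probability U R) (xi : int -> U -> Y).
Hypothesis hbase : stationary_base PU xi P.
Hypothesis mh : measurable_fun setT (fun z : paths Y * X => h z.1 z.2).
Hypothesis h0 : forall w x, 0 <= h w x.
Variable mu : probability (paths Y * X)%type R.
Hypothesis hmu : skew_measure m P h mu.
Local Notation tau := (Defs.skew T).

(** The fibre over w of the preimage is the preimage, under a composition of nonsingular maps, of
    the fibre of [A] over the shifted path, which is null for almost every w by shift invariance. *)
Lemma skew_null (A : set (paths Y * X)) j : measurable A ->
  {ae P, forall w, m (xsection A w) = 0%E} -> mu (iter j tau @^-1` A) = 0%E.
Proof.
move=> mA A0; set A' := _ @^-1` A.
have mA' : measurable A'.
  by rewrite -[X in measurable X]setTI; exact: (measurable_iter_tau hmaps).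
rewrite (hmu mA').
rewrite (@ae_eq_integral _ _ _ P setT (cst 0%E))//.
- by rewrite integral_cst// mul0e.
- exact: (measurable_xsection_density m mh h0 mA').
- have := ae_shift hbase A0; apply: filterS => w Hw _.
  apply: null_set_integral.
  + exact: measurable_xsection.
  + apply: measurable_funTS; apply/measurable_EFinP.
    exact: (measurableT_comp mh (pair1_measurable w)).
  + have -> : xsection A' w = orbit_map T j w @^-1` (xsection A (path_shift j%:Z w)).
      by apply/seteqP; split=> x; rewrite /= !/xsection /= !inE /A' /= iter_skew.
    by apply: nonsingular_orbit_map => //; exact: measurable_xsection.
Qed.

Lemma birkhoff_clipped :
  {ae mu, forall z, forall n, birkhoff_sum T phi n z = birkhoff_sum T phi' n z}.
Proof.
pose A := [set z | (phi z)%:E != (phi' z)%:E].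
have mA : measurable A.
  rewrite -[X in measurable X]setTI; apply: measurable_neqe => //; apply/measurable_EFinP => //.
  exact: measurable_clipped.
have A0 : {ae P, forall w, m (xsection A w) = 0%E}.
  move: ae_BVnorm_phi; apply: filterS => w /clipped_ae[_ E].
  apply/negligibleP; first exact: measurable_xsection.
  move: E; rewrite /almost_everywhere /prop_near1 /= /nbhs /=.
  apply: negligibleS => x; rewrite /xsection /= inE /A /= => /eqP H E.
  by apply: H; rewrite E.
have : {ae mu, forall z, forall j, phi (iter j tau z) = phi' (iter j tau z)}.
  apply: ae_foralln => j; exists (iter j tau @^-1` A); split.
  - by rewrite -[X in measurable X]setTI; exact: (measurable_iter_tau hmaps).
  - exact: skew_null.
  - by move=> z /= H; apply/eqP => -[E]; apply: H.
apply: filterS => z H n; rewrite /birkhoff_sum; apply: eq_bigr => j _; exact: H.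
Qed.

Variables (N : paths Y -> R) (lam eps eps' : R) (D D' : paths Y -> R).
Hypothesis hgood : good_cocycle m v P T L N.
Hypothesis hdens : equivariant_density m v P L h.
Hypothesis hgap : spectral_gap m v P L h lam eps' D D'.
Hypothesis hK : tempered_bound P eps (Ktilde m v h D D' N) K.

Lemma ae_good_orbit : {ae P, forall w, good_orbit m v T L h phi' B lam eps K w}.
Proof.
apply: (ae_shift hbase).
have aeI (Q1 Q2 : paths Y -> Prop) : {ae P, forall w, Q1 w} -> {ae P, forall w, Q2 w} ->
  {ae P, forall w, Q1 w /\ Q2 w} by apply: filterS2.
have := aeI _ _ ae_BVnorm_phi (aeI _ _ (good2 hgood) (aeI _ _ (dens_BV hdens)
  (aeI _ _ (dens_equiv hdens) (aeI _ _ (gap_contr hgap) (aeI _ _ (bound_Kt hK) (bound_growth hK)))))).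
apply: filterS => w [Hphi [Hvar [[Lh _] [Hequiv [Hgap [/andP[_ HK] Hgrowth]]]]]].
have DK : D w <= K w by apply: le_trans HK; rewrite /Ktilde !le_max lexx.
have NK : N w <= K w by apply: le_trans HK; rewrite /Ktilde !le_max lexx !orbT.
split=> //.
- exact: BVnorm_clipped.
- move=> n n0; apply: le_trans (Hgap n n0) _.
  by rewrite lee_fin ler_wpM2r ?expR_ge0.
- move=> g Hg; apply: le_trans (Hvar g Hg) _.
  by apply: lee_wpmul2r; [exact: (var_ge0 hv)|rewrite lee_fin].
- move=> n; have /andP[+ _] := Hgrowth n%:Z.
  rewrite mulNr expRN ler_pdivrMr ?expR_gt0// normr_nat -pmulrn.
Qed.

End ClippedObservable.

(** * Growth in n and L^p norms *)

Section GrowthOfMomentBound.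
Context (R : realType).
Variables (c gamma : R) (p : nat).

Definition moment_bound_coef : R :=
  `|c ^+ p * (p`!%:R `^ (1 + gamma))| *
  \sum_(1 <= u < (p.-1)./2.+1) (p%:R ^+ u / u`!%:R ^+ 2).

Lemma moment_bound_coef_ge0 : 0 <= moment_bound_coef.
Proof.
by rewrite mulr_ge0//; apply: sumr_ge0 => u _; rewrite divr_ge0 ?exprn_ge0.
Qed.

Lemma norm_moment_bound n : (0 < n)%N ->
  `|moment_bound c gamma p n| <= moment_bound_coef * n%:R ^+ (p.-1)./2.
Proof.
move=> n0; rewrite /moment_bound normrM /moment_bound_coef -mulrA; apply: ler_wpM2l => //.
rewrite mulr_suml; apply: le_trans (ler_norm_sum _ _ _) _.
rewrite !big_nat; apply: ler_sum => u /andP[_ up].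
rewrite ger0_norm; last by rewrite mulr_ge0 ?exprn_ge0// divr_ge0 ?exprn_ge0.
rewrite mulrC; apply: ler_wpM2l; first by rewrite divr_ge0 ?exprn_ge0.
by apply: ler_weXn2l; rewrite ?ler1n// -ltnS.
Qed.

Lemma moment_bound_bigO :
  (fun n : nat => moment_bound c gamma p n : R^o) =O_\oo (fun n : nat => n%:R ^+ (p.-1)./2 : R^o).
Proof.
apply/eqO_exP; exists (moment_bound_coef + 1); first by rewrite ltr_wpDl// moment_bound_coef_ge0.
exists 1%N => // n /= n1; apply: le_trans (norm_moment_bound n1) _.
rewrite [X in _ <= _ * X]ger0_norm ?exprn_ge0//.
by apply: ler_wpM2r; rewrite ?exprn_ge0// lerDl.
Qed.

End GrowthOfMomentBound.

Section GaussMoment.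
Context (R : realType).

Lemma normal_momentE p : normal_moment R p =
  (if odd p then 0 else p`!%:R / (2 ^+ p./2 * p./2`!%:R))%:E.
Proof.
rewrite /normal_moment expectation.unlock; case: ifPn => op; first exact: odd_moment.
have pE : p = p./2.*2 by rewrite -[LHS]odd_double_half (negbTE op).
by rewrite {1 2}pE; exact: even_moment.
Qed.

Lemma poweR_normal_moment p (V : R) : 0 <= V ->
  (V%:E `^ (p%:R / 2) * normal_moment R p = (gauss_moment p V)%:E)%E.
Proof.
move=> V0; rewrite normal_momentE poweR_EFin -EFinM /gauss_moment; congr EFin.
case: ifPn => op; first by rewrite mulr0.
have pE : p = p./2.*2 by rewrite -[LHS]odd_double_half (negbTE op).
congr (_ * _); rewrite {1}pE -muln2 natrM mulfK ?pnatr_eq0//.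
exact: powR_mulrn.
Qed.

Lemma gauss_moment_double q (V b : R) : 0 <= V -> V <= b ->
  gauss_moment q.*2 V <= b ^+ q * (q.*2`!%:R / (2 ^+ q * q`!%:R)).
Proof.
move=> V0 Vb; rewrite /gauss_moment odd_double doubleK.
apply: ler_wpM2r; first by rewrite divr_ge0// mulr_ge0 ?exprn_ge0.
by rewrite lerXn2r ?nnegrE// (le_trans V0).
Qed.

End GaussMoment.

Section CenteredStatistics.
Context d (T : measurableType d) (R : realType).
Variables (mu : probability T R) (S S' : T -> R).
Hypotheses (mS : measurable_fun setT S) (bS' : bm S').
Hypothesis SS' : {ae mu, forall z, S z = S' z}.
Let D z := S' z - mean mu S'.
Let bD : bm D. Proof. by apply: bmB => //; exact: bm_cst. Qed.

Lemma expectation_bounded : ('E_mu[S] = (mean mu S')%:E)%E.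
Proof.
rewrite expectation.unlock -mean_EFin//; apply: ae_eq_integral => //.
- exact/measurable_EFinP.
- by apply/measurable_EFinP; exact: bS'.1.
- by move: SS'; apply: filterS => z -> .
Qed.

Lemma centeredE z : centered mu S z = S z - mean mu S'.
Proof. by rewrite /centered expectation_bounded. Qed.

Lemma measurable_centered : measurable_fun setT (centered mu S).
Proof.
rewrite (_ : centered mu S = fun z => S z - mean mu S'); first exact: measurable_funB.
by apply/funext => z; rewrite centeredE.
Qed.

Lemma integral_centered (g : R -> R) : measurable_fun setT g -> bm (fun z => g (D z)) ->
  (\int[mu]_z (g (centered mu S z))%:E = (mean mu (fun z => g (D z)))%:E)%E.
Proof.
move=> mg bg; rewrite -mean_EFin//; apply: ae_eq_integral => //.
- by apply/measurable_EFinP; apply: measurableT_comp => //; exact: measurable_centered.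
- by apply/measurable_EFinP; exact: bg.1.
- by move: SS'; apply: filterS => z Ez _; rewrite centeredE Ez.
Qed.

Lemma expectation_centered p :
  ('E_mu[(fun z => centered mu S z ^+ p)%R] = (mean mu (fun z => D z ^+ p))%:E)%E.
Proof.
rewrite expectation.unlock; apply: (integral_centered (g := fun x => x ^+ p)).
  exact: exprn_measurable.
exact: bmX.
Qed.

Lemma variance_bounded : ('V_mu[S] = (mean mu (fun z => D z ^+ 2))%:E)%E.
Proof.
rewrite -expectation_centered /variance covariance.unlock; congr expectation.
Qed.

Lemma Lnorm_centered p : (0 < p)%N ->
  ('N[mu]_(p%:R%:E)[EFin \o centered mu S] =
   (mean mu (fun z => `|D z| ^+ p) `^ p%:R^-1)%:E)%E.
Proof.
move=> p0; rewrite Lnorm.unlock -poweR_EFin; congr (_ `^ _)%E.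
rewrite -(integral_centered (g := fun x => `|x| ^+ p)).
- by apply: eq_integral => z _; rewrite -[X in (X `^ _)%E]/(`|centered mu S z|%:E) poweR_EFin powR_mulrn.
- by apply: measurable_funX; exact: normr_measurable.
- by apply: bmX; exact: bm_norm.
Qed.

(** From y <= s + y ^ 2 / s with y = |D| ^ p and s = t ^ p: absolute moments, also of odd order, are
    reduced to moments of even order 2 p. *)
Lemma mean_norm_expn p (t : R) : 0 < t ->
  mean mu (fun z => `|D z| ^+ p) <= t ^+ p + mean mu (fun z => D z ^+ p.*2) / t ^+ p.
Proof.
move=> t0; have tp : 0 < t ^+ p by rewrite exprn_gt0.
have b1 : bm (fun z => (t ^+ p)^-1 * D z ^+ p.*2) by apply: bmZ; exact: bmX.
rewrite mulrC -meanZ; last exact: bmX.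
rewrite -[X in X + _](mean_cst mu) -meanD//; last exact: bm_cst.
apply: ler_mean; [by apply: bmX; exact: bm_norm|by apply: bmD => //; exact: bm_cst|].
move=> z; have -> : D z ^+ p.*2 = (`|D z| ^+ p) ^+ 2.
  by rewrite -mul2n exprM -real_normK ?num_real// -!exprM mulnC.
move: (`|D z| ^+ p) => y; rewrite -lerBlDl [_^-1 * _]mulrC ler_pdivlMr//.
by move: (t ^+ p) tp => s s0; have := sqr_ge0 (y - s); nra.
Qed.

End CenteredStatistics.

Section LpGrowth.
Context d (T : measurableType d) (R : realType).
Variables (mu : probability T R) (S S' : nat -> T -> R).
Hypotheses (mS : forall n, measurable_fun setT (S n)) (bS' : forall n, bm (S' n)).
Hypothesis SS' : forall n, {ae mu, forall z, S n z = S' n z}.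
Let D n z := S' n z - mean mu (S' n).
Variables (c gamma a : R).
Hypothesis a0 : 0 <= a.
Hypothesis D2 : forall n, mean mu (fun z => D n z ^+ 2) <= a * n%:R.
Hypothesis Dp : forall n p, (0 < p)%N ->
  `|mean mu (fun z => D n z ^+ p) - gauss_moment p (mean mu (fun z => D n z ^+ 2))| <=
  moment_bound c gamma p n.

Lemma Lnorm_growth p : (0 < p)%N -> exists M : R, \forall n \near \oo,
  ('N[mu]_(p%:R%:E)[EFin \o centered mu (S n)] <= (M * Num.sqrt n%:R)%:E)%E.
Proof.
move=> p0.
pose C := 1 + (a ^+ p * (p.*2`!%:R / (2 ^+ p * p`!%:R)) + moment_bound_coef c gamma p.*2).
have C0 : 0 <= C.
  by rewrite /C !addr_ge0// ?moment_bound_coef_ge0// mulr_ge0 ?exprn_ge0// divr_ge0.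
exists (C `^ p%:R^-1); exists 1%N => // n /= n1.
rewrite (Lnorm_centered (mS n) (bS' n) (SS' n) p0) lee_fin.
set t := Num.sqrt n%:R.
have t0 : 0 < t by rewrite sqrtr_gt0 ltr0n.
have t2 : t ^+ 2 = n%:R by rewrite sqr_sqrtr.
have bD : bm (D n) by apply: bmB => //; exact: bm_cst.
(* The Gaussian part is of order n ^ p by the linear variance bound, and the error at order 2 p
   grows like n ^ (p - 1) only. *)
have E2p : mean mu (fun z => D n z ^+ p.*2) <= (C - 1) * n%:R ^+ p.
  have := Dp n (_ : (0 < p.*2)%N); rewrite double_gt0 => /(_ p0) H.
  have H1 := le_trans (ler_norm _) H.
  have V0 : 0 <= mean mu (fun z => D n z ^+ 2).
    rewrite -(mean_cst mu 0); apply: ler_mean; [exact: bm_cst|exact: bmX|].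
    by move=> z; rewrite sqr_ge0.
  have H2 := gauss_moment_double p V0 (D2 n).
  have H3 := le_trans (ler_norm _) (norm_moment_bound c gamma p.*2 n1).
  have H4 : moment_bound_coef c gamma p.*2 * n%:R ^+ (p.*2.-1)./2 <=
      moment_bound_coef c gamma p.*2 * n%:R ^+ p.
    apply: ler_wpM2l; first exact: moment_bound_coef_ge0.
    by apply: ler_weXn2l; rewrite ?ler1n//; clear; lia.
  rewrite exprMn in H2.
  rewrite /C addrC addKr mulrDl.
  move: H1; rewrite lerBlDr => /le_trans; apply.
  rewrite addrC; apply: lerD; last exact: le_trans H3 H4.
  by apply: le_trans H2 _; rewrite le_eqVlt; apply/orP; left; apply/eqP; ring.
have Ep : mean mu (fun z => `|D n z| ^+ p) <= C * t ^+ p.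
  have := mean_norm_expn mu (bS' n) p t0; rewrite -/(D n) => /le_trans; apply.
  have tp : 0 < t ^+ p by rewrite exprn_gt0.
  rewrite -[C](subrK 1) mulrDl mul1r addrC; apply: lerD => //.
  rewrite ler_pdivrMr//; apply: le_trans E2p _.
  by rewrite -t2 -exprM mul2n -addnn exprD mulrA.
have p'0 : 0 <= p%:R^-1 :> R by rewrite invr_ge0.
apply: le_trans (ge0_ler_powR p'0 _ _ Ep) _; rewrite ?nnegrE.
- rewrite -(mean_cst mu 0); apply: ler_mean; [exact: bm_cst|by apply: bmX; exact: bm_norm|].
  by move=> z; rewrite exprn_ge0.
- by rewrite mulr_ge0// exprn_ge0// ltW.
rewrite powRM ?exprn_ge0// ?(ltW t0)//.
rewrite -[t ^+ p]powR_mulrn ?(ltW t0)// -powRrM mulfV ?powRr1 ?(ltW t0)//.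
by rewrite pnatr_eq0 -lt0n.
Qed.

End LpGrowth.

Theorem theorem2p17 (R : realType) (lambda : R) (hlambda : 0 < lambda) :
  exists c0 : R -> R -> R -> R -> R -> R,
  forall (dX : measure_display) (X : measurableType dX) (m : probability X R)
    (v : (X -> R[i]) -> \bar R) (Cv : R)
    (hv : is_variation m v Cv)
    (dU : measure_display) (U : measurableType dU) (PU : probability U R)
    (dY : measure_display) (Y : measurableType dY) (xi : int -> U -> Y)
    (P : probability (paths Y) R)
    (hbase : stationary_base PU xi P)
    (T : paths Y -> X -> X) (L : paths Y -> (X -> R[i]) -> (X -> R[i]))
    (hmaps : random_maps m T L)
    (N : paths Y -> R)
    (hgood : good_cocycle m v P T L N)
    (h : paths Y -> X -> R)
    (hdens : equivariant_density m v P L h)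
    (mu : probability (paths Y * X)%type R)
    (hmu : skew_measure m P h mu)
    (eps' : R) (D D' : paths Y -> R)
    (hgap : spectral_gap m v P L h lambda eps' D D')
    (eps : R) (heps0 : 0 < eps) (heps : eps < lambda / 3)
    (K : paths Y -> R)
    (hK : tempered_bound P eps (Ktilde m v h D D' N) K)
    (phi : paths Y * X -> R)
    (hphi_meas : measurable_fun setT phi)
    (hphi_coord0 : forall w w' x, w 0 = w' 0 -> phi (w, x) = phi (w', x))
    (hphi_mean : 'E_mu[phi]%E = 0%E)
    (hphi_norm : (norm_K m v P K phi < +oo)%E)
    (c1 c2 eta : R) (hc1 : 0 < c1) (hc2 : 0 < c2) (heta : 0 < eta)
    (hmix : forall n : nat, (0 < n)%N ->
      (alpha_mix PU xi n <= (c1 * expR (- c2 * n%:R `^ eta))%:E)%E),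
  let S := birkhoff_sum T phi in
  let gamma := eta^-1 in
  let c := c0 c1 c2 eta (fine (norm_K m v P K phi)) Cv in
  [/\ forall p n : nat, (0 < p)%N ->
        (`| 'E_mu[(fun z => centered mu (S n) z ^+ p)%R] -
            'V_mu[S n] `^ (p%:R / 2) * normal_moment R p |
         <= (moment_bound c gamma p n)%:E)%E,
      forall p : nat, (0 < p)%N ->
        (fun n : nat => moment_bound c gamma p n : R^o) =O_\oo
        (fun n : nat => n%:R ^+ (p.-1)./2 : R^o) &
      forall p : nat, (0 < p)%N ->
        exists M : R, \forall n \near \oo,
          ('N[mu]_(p%:R%:E)[EFin \o centered mu (S n)]
           <= (M * Num.sqrt n%:R)%:E)%E].
Proof.
(* Besides its arguments the constant involves only the decay rate [lambda], through [gth], [gc] and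
   [gA]. *)
exists (fun c1 c2 eta B Cv => moment_const Cv B lambda c1 c2 eta).
move=> dX X m v Cv hv dU U PU dY Y xi P hbase T L hmaps N hgood h hdens mu hmu eps' D D' hgap
  eps heps0 heps K hK phi mphi phi0 _ phi_norm c1 c2 eta c10 c20 eta0 hmix S gamma c.
pose B := fine (norm_K m v P K phi).
pose phi' z := clip (Cv * B) (phi z).
have K1 := bound_gt1 hK.
have B0 : 0 <= B by rewrite fine_ge0// (norm_K_ge0 hv).
have mphi' : measurable_fun setT phi' by exact: (measurable_clipped hv).
have phi'B : forall z, `|phi' z| <= Cv * B by exact: (clipped_bound hv).
have phi'0 w w' x : w 0 = w' 0 -> phi' (w, x) = phi' (w', x).
  by move=> ww; rewrite /phi' (phi0 w w').
have orbit := ae_good_orbit hv mphi K1 phi_norm hbase hgood hdens hgap hK.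
have mh := dens_measurable hdens; have h0 := dens_ge0 hdens; have h1 := dens_int hdens.
pose S' := birkhoff_sum T phi'.
have bS' n : bm (S' n) by exact: (bm_birkhoff hmaps mphi' phi'B).
have mS n : measurable_fun setT (S n).
  rewrite /S /birkhoff_sum; apply: measurable_sum => j.
  by apply: measurableT_comp => //; exact: (measurable_iter_tau hmaps).
have SS n : {ae mu, forall z, S n z = S' n z}.
  have := birkhoff_clipped hv hmaps mphi K1 phi_norm hbase mh h0 hmu.
  by apply: filterS => z.
pose Dz n z := S' n z - mean mu (S' n).
have bD n : bm (Dz n) by apply: bmB => //; exact: bm_cst.
have Dp n p : (0 < p)%N ->
    `|mean mu (fun z => Dz n z ^+ p) - gauss_moment p (mean mu (fun z => Dz n z ^+ 2))| <=
    moment_bound c gamma p n.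
  move=> p0; rewrite -moment_defect_meanf//.
  exact: (bounded_moments hv hmaps mphi' B0 phi'B phi'0 hlambda heps K1 hbase c10 c20 eta0 hmix orbit mh h0 h1 hmu n p0).
split.
- move=> p n p0.
  rewrite (expectation_centered (mS n) (bS' n) (SS n)) (variance_bounded (mS n) (bS' n) (SS n)).
  rewrite poweR_normal_moment; last first.
    rewrite -(mean_cst mu 0); apply: ler_mean; [exact: bm_cst|exact: bmX (bD n)|].
    by move=> z; rewrite sqr_ge0.
  by rewrite -EFinB lee_fin; exact: Dp.
- by move=> p _; exact: moment_bound_bigO.
- move=> p p0.
  pose a := 2 / system_radius Cv B lambda c1 c2 eta 2 ^+ 2.
  apply: (@Lnorm_growth _ _ _ mu S S' mS bS' SS c gamma a) => //.
  + by rewrite divr_ge0// sqr_ge0.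
  + by move=> n; exact: (bounded_variance hv hmaps mphi' B0 phi'B phi'0 hlambda heps K1 hbase c10 c20 eta0 hmix orbit mh h0 h1 hmu n).
Qed.
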